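(* Let $\alpha_0>0$, let $0<\delta\le\alpha_0$, and let $\{u(t;s;\cdot):t\ge s\ge0\}$ be an $\mathcal F_{s,t}$-measurable white noise stochastic semi-flow on $\mathcal C^{-\alpha_0}$ satisfying the following four assumptions. (1) (Continuity) For every $t>s\ge0$, every $\alpha\in(\alpha_0-\delta,\alpha_0]$ and every $\omega\in\Omega$, the map $f\mapsto u(t;s;f)(\omega)$ maps $\mathcal C^{-\alpha_0}$ into $\mathcal C^{-\alpha}$ and is continuous in $f$. (2) (Order preservation) Whenever $f\preceq g$, one has $u(t;s;f)(\omega)\preceq u(t;s;g)(\omega)$ for every $t\ge s\ge0$ and $\omega\in\Omega$. (3) (Coming down from infinity) For every $s\ge0$ there exists a non-negative random variable $K_s$ such that $\sup_{s\ge0}\mathbf E K_s^p<\infty$ for every $p\ge1$, and the following bound holds for some $\gamma>0$, $$\sup_{f\in\mathcal C^{-\alpha_0}}\ \sup_{t\in[s,s+1]}(t-s)^\gamma\|u(t;s;f)(\omega)\|_{-\alpha}\le K_s(\omega),\qquad\omega\in\Omega,$$ for every $\alpha\in(\alpha_0-\delta,\alpha_0]$. (4) (Exponential mixing) There exists $\lambda_*>0$ such that for every $\alpha\in(\alpha_0-\delta,\alpha_0]$ and every $p\ge1$, $$\sup_{f_1,f_2\in\mathcal C^{-\alpha_0}}\mathcal W_{\|\cdot-\cdot\|_{-\alpha;p}\wedge1;\,p}\big(u(t;0;f_1),u(t;0;f_2)\big)\lesssim_{\alpha,p}e^{-\lambda_*t}.$$ Then, with $\lambda_*$ as in (4), for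 every $\alpha\in(\alpha_0-\delta,\alpha_0]$ and every integer $p>\frac{d}{\alpha-\alpha_0+\delta}$, we have that $$\left(\mathbf E\Big(\sup_{f_1,f_2\in\mathcal C^{-\alpha_0}}\|u(t;0;f_2)-u(t;0;f_1)\|_{-\alpha}\Big)^p\right)^{\frac1p}\lesssim_p e^{-\frac{\lambda_*}{p}t}.$$
   Context: The notation $\lesssim_{p}$ (respectively $\lesssim_{\alpha,p}$) means $\le$ up to a multiplicative constant which depends on the indicated parameters and not on $t$. $\mathbb T^d$ is the $d$-dimensional torus of fixed, but arbitrarily large, size; periodic distributions are distributions on $\mathbb T^d$. For a periodic distribution $f$ and $s\in(0,1]$, $f_s:=e^{s\Delta}f$ (convolution with the heat kernel). For $\alpha>0$ and $p\in[1,\infty)$, $$\|f\|_{-\alpha;p}:=\left(\int_0^1 s^{\frac{\alpha p}{2}}\|f_s\|_{L^p}^p\,\frac{ds}{s}\right)^{1/p},\qquad \|f\|_{-\alpha}:=\sup_{s\in(0,1]}s^{\frac\alpha2}\|f_s\|_{L^\infty},$$ and $\mathcal C^{-\alpha}$ is the closure of $\mathcal C^\infty(\mathbb T^d)$ with respect to $\|\cdot\|_{-\alpha}$. For periodic distributions, $f\preceq g$ means $\langle f,\varphi\rangle\le\langle g,\varphi\rangle$ for every non-negative $\varphi\in\mathcal C^\infty(\mathbb T^d)$. Let $(\Omega,\mathcal F,\mathbf P)$ be a probability space (expectation $\mathbf E$) with a family $(\mathcal F_{s,t})_{t\ge s\ge0}$ of sub-$\sigma$-algebras of $\mathcal F$.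 A collection $\{u(t;s;\cdot):t\ge s\ge0\}$ of $\mathcal F_{s,t}$-measurable random maps $\mathcal C^{-\alpha_0}\ni f\mapsto u(t;s;f)(\omega)\in\mathcal C^{-\alpha_0}$, $\omega\in\Omega$, is called a white noise stochastic semi-flow on $\mathcal C^{-\alpha_0}$ if: (i) $\mathcal F_{s,t}$ and $\mathcal F_{s',t'}$ are independent for $s\le t\le s'\le t'$; (ii) (flow property) $u(t;0;f)(\omega)=u(t;s;u(s;0;f)(\omega))(\omega)$ for every $t\ge s\ge0$, $f\in\mathcal C^{-\alpha_0}$, $\omega\in\Omega$; (iii) for every $f\in\mathcal C^{-\alpha_0}$ and $t\ge s\ge0$, $u(t;s;f)$ and $u(t-s;0;f)$ have the same law. For probability measures $\mu,\nu$ on a space with metric $\mathfrak m$ and $p\ge1$, $\mathcal W_{\mathfrak m;p}(\mu,\nu):=\big(\inf_{\pi}\int\mathfrak m(k,l)^p\,\pi(dk,dl)\big)^{1/p}$, the infimum being over all couplings $\pi$ of $\mu$ and $\nu$; for random variables $X,Y$, $\mathcal W_{\mathfrak m;p}(X,Y)$ denotes the distance between their laws.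
   Formalization: The final bound is proved with a constant uniform over t ≥ t₀ for each t₀ > 0, not over all t ≥ 0, where it fails (the left side can blow up as t → 0); the constant is chosen after α and p. *)

(* Defs.v *)
From HB Require Import structures.
From mathcomp Require Import all_boot all_order all_algebra.
From mathcomp Require Import all_classical all_reals all_analysis.

Set Implicit Arguments.
Unset Strict Implicit.
Unset Printing Implicit Defensive.

Import Order.TTheory GRing.Theory Num.Theory.
Import numFieldNormedType.Exports.

Local Open Scope classical_set_scope.
Local Open Scope ring_scope.

(* The torus is (R / L Z)^d: functions on it are the functions on R^d that are
   L-periodic in each coordinate. *)

Section torus.
Context {R : realType} (d : nat) (L : R).
Implicit Types (g : 'rV[R]_d -> R^o) (s p alpha : R).

Definition pderiv (b : seq 'I_d) g : 'rV[R]_d -> R^o :=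
  foldr (fun i h => 'D_(delta_mx 0 i) h) g b.

Definition torus_smooth g := forall (b : seq 'I_d) x, differentiable (pderiv b g) x.

Definition torus_periodic g := forall (i : 'I_d) x, g (x + L *: delta_mx 0 i) = g x.

Definition smooth_periodic : {pred ('rV[R]_d -> R^o)} :=
  fun g => `[< torus_smooth g /\ torus_periodic g >].

Lemma pderivD (b : seq 'I_d) (a : R) g1 g2 : torus_smooth g1 -> torus_smooth g2 ->
  pderiv b (a *: g1 + g2) = a *: pderiv b g1 + pderiv b g2.
Proof.
move=> s1 s2; elim: b => [//|i b IH] /=.
rewrite IH; apply/funext => x.
have D1 : derivable (pderiv b g1) x (delta_mx 0 i) by exact: diff_derivable.
have D2 : derivable (pderiv b g2) x (delta_mx 0 i) by exact: diff_derivable.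
by rewrite deriveD ?deriveZ //; exact: derivableZ.
Qed.

Lemma smooth_periodic_submod : submod_closed smooth_periodic.
Proof.
have pd0 b : pderiv b 0 = 0.
  elim: b => [//|i b IH] /=; rewrite IH; apply/funext => x.
  by rewrite (_ : 0 = cst 0) // derive_cst.
split=> [|a g1 g2 /asboolP[s1 p1] /asboolP[s2 p2]]; apply/asboolP; split.
- by move=> b x; rewrite pd0; exact: differentiable_cst.
- by [].
- by move=> b x; rewrite pderivD//; apply: differentiableD => //; exact: differentiableZ.
- by move=> i x; rewrite !fctE p1 p2.
Qed.

HB.instance Definition _ :=
  GRing.isSubmodClosed.Build R ('rV[R]_d -> R^o) smooth_periodic
    smooth_periodic_submod.

(* The space C^oo(T^d). *)
Record testfun := TestFun {
  testfun_val :> 'rV[R]_d -> R^o ;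
  _ : testfun_val \in smooth_periodic }.

HB.instance Definition _ := [isSub for testfun_val].
HB.instance Definition _ := [Choice of testfun by <:].
HB.instance Definition _ := [SubChoice_isSubLmodule of testfun by <:].

(* Continuity of a linear functional on C^oo(T^d) for its Frechet topology:
   |f phi| <= C max_(|b| <= N) sup |d_b phi|. *)
Definition finite_order (f : testfun -> R^o) :=
  exists (C : R) (N : nat), forall (phi : testfun) (M : R),
    (forall b x, (size b <= N)%N -> `|pderiv b phi x| <= M) ->
    `|f phi| <= C * M.

Definition is_distribution (f : testfun -> R^o) := linear f /\ finite_order f.

Definition distr_le (f g : testfun -> R^o) :=
  forall phi : testfun, (forall x, 0 <= phi x) -> f phi <= g phi.

(* Kernel of e^(s Delta) on the torus: the L-periodisation of
   (4 pi s)^(-d/2) exp(- |y|^2 / (4 s)). *)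
Definition heat_kernel s (y : 'rV[R]_d) : R :=
  (4 * pi * s) `^ (- (d%:R / 2)) *
  fine (\esum_(k in [set: 'rV[int]_d])
    (expR (- ((\sum_i (y 0 i + L * (k 0 i)%:~R) ^+ 2) / (4 * s))))%:E).

(* f_s x = <f, heat_kernel s (x - .)>.  The kernel is smooth and periodic for
   0 < s and 0 < L; only such values are used, so that the default value 0 of
   insubd is irrelevant. *)
Definition heat (f : testfun -> R^o) s (x : 'rV[R]_d) : R :=
  f (insubd (0 : testfun) (fun y => heat_kernel s (x - y))).

End torus.

Arguments heat {R d L} f s x.

Section norms.
Local Open Scope ereal_scope.
Context {R : realType}.

(* Integral over the cell [0, L]^n, as an iterated Lebesgue integral. *)
Fixpoint torus_integral (L : R) (n : nat) : ('rV[R]_n -> \bar R) -> \bar R :=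
  match n with
  | 0%N => fun g => g 0%R
  | m.+1 => fun g =>
      \int[lebesgue_measure]_(x in `[0%R, L])
        torus_integral L (fun y : 'rV[R]_m =>
          g (row_mx (const_mx x : 'rV[R]_1) y : 'rV[R]_(1 + m)))
  end.

Context {d : nat} {L : R}.
Implicit Types (f h : testfun d L -> R^o) (p alpha : R).

Definition Lp_norm p (g : 'rV[R]_d -> R) : \bar R :=
  (torus_integral L (fun x => (`|g x| `^ p)%:E)) `^ p^-1.

(* For continuous g the essential supremum is the supremum. *)
Definition Loo_norm (g : 'rV[R]_d -> R) : \bar R :=
  ereal_sup [set `|g x|%:E | x in [set: 'rV[R]_d]].

Definition besov_norm_p alpha p f : \bar R :=
  (\int[lebesgue_measure]_(s in `]0%R, 1%R])
     ((s `^ (alpha * p / 2) / s)%:E * (Lp_norm p (heat f s)) `^ p)) `^ p^-1.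

Definition besov_norm alpha f : \bar R :=
  ereal_sup [set (s `^ (alpha / 2))%:E * Loo_norm (heat f s) | s in `]0%R, 1%R]].

Definition embed (phi : testfun d L) : testfun d L -> R^o :=
  fun psi => fine (torus_integral L (fun x => (phi x * psi x)%:E)).

Definition in_Cneg alpha f :=
  is_distribution f /\
  forall e : R, (0 < e)%R ->
    exists phi : testfun d L, besov_norm alpha (f \- embed phi)%R < e%:E.

Lemma torus_integral0 n : @torus_integral L n (fun=> 0) = 0.
Proof.
elim: n => [//|n IH] /=.
by under eq_integral do rewrite IH; rewrite integral0.
Qed.

Lemma besov0 alpha f : (forall phi, f phi = 0%R) -> besov_norm alpha f = 0.
Proof.
move=> f0.
have H s : Loo_norm (heat f s) = 0.
  rewrite /Loo_norm (_ : [set _ | _ in _] = [set 0]) ?ereal_sup1//.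
  apply/seteqP; split=> [_ [x _ <-]|_ ->] /=; first by rewrite /heat f0 normr0.
  by exists 0%R => //; rewrite /heat f0 normr0.
rewrite /besov_norm (_ : [set _ | _ in _] = [set 0]) ?ereal_sup1//.
apply/seteqP; split=> [_ [s _ <-]|_ ->] /=; first by rewrite H mule0.
by exists 1%R; rewrite ?H ?mule0//= in_itv/= ltr01 lexx.
Qed.

Lemma besovN alpha f h : besov_norm alpha (f \- h)%R = besov_norm alpha (h \- f)%R.
Proof.
rewrite /besov_norm /Loo_norm; congr ereal_sup.
apply: eq_imagel => s _; congr (_ * ereal_sup _).
by apply: eq_imagel => x _; rewrite /heat /= distrC.
Qed.

Lemma Loo_norm_ge0 g : 0 <= Loo_norm g.
Proof.
apply: (@le_trans _ _ `|g 0%R|%:E); first by rewrite lee_fin.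
by apply: ereal_sup_ubound; exists 0%R.
Qed.

Lemma besov_triangle alpha f h (f' : testfun d L -> R^o) :
  besov_norm alpha (f \- h)%R <= besov_norm alpha (f \- f')%R + besov_norm alpha (f' \- h)%R.
Proof.
apply: ge_ereal_sup => _ [s s01 <-].
have le_b (k : testfun d L -> R^o) : (s `^ (alpha / 2))%:E * Loo_norm (heat k s) <= besov_norm alpha k.
  by apply: ereal_sup_ubound; exists s.
apply: le_trans (leeD (le_b (f \- f')%R) (le_b (f' \- h)%R)).
rewrite -ge0_muleDr ?Loo_norm_ge0//.
apply: lee_pmul; rewrite ?lee_fin ?powR_ge0 ?Loo_norm_ge0 ?lexx//.
apply: ge_ereal_sup => _ [x _ <-].
have le_x (k : testfun d L -> R^o) : `|heat k s x|%:E <= Loo_norm (heat k s).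
  by apply: ereal_sup_ubound; exists x.
apply: le_trans (leeD (le_x (f \- f')%R) (le_x (f' \- h)%R)); rewrite -EFinD lee_fin /heat /=.
by rewrite (le_trans _ (ler_normD _ _))// addrA subrK.
Qed.

Lemma in_Cneg0 alpha : in_Cneg alpha (fun=> 0%R).
Proof.
split.
  split; first by move=> a x y; rewrite scaler0 addr0.
  by exists 0%R, 0%N => phi M _; rewrite normr0 mul0r.
move=> e e0; exists 0%R; rewrite besov0// => psi.
rewrite /= /embed (_ : (fun _ => _) = fun=> 0) ?torus_integral0 ?subr0//.
by apply/funext => x; rewrite mul0r.
Qed.

End norms.

Arguments Lp_norm {R d} L p g.

(* The space C^(-alpha), with the pseudometric of the norm besov_norm alpha. *)
Section Cneg.
Context {R : realType} (d : nat) (L alpha : R).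

Record Cneg := MkCneg {
  Cneg_val :> testfun d L -> R^o ;
  _ : in_Cneg alpha Cneg_val }.

HB.instance Definition _ := gen_eqMixin Cneg.
HB.instance Definition _ := gen_choiceMixin Cneg.
HB.instance Definition _ := isPointed.Build Cneg (MkCneg (in_Cneg0 alpha)).

Definition Cneg_ball (f : Cneg) (e : R) (g : Cneg) : Prop :=
  (besov_norm alpha (f \- g)%R < e%:E)%E.

Let ent : set_system (Cneg * Cneg) := entourage_ Cneg_ball.

HB.instance Definition _ := hasNbhs.Build Cneg (nbhs_ ent).

Let ball_center (f : Cneg) (e : R) : 0 < e -> Cneg_ball f e f.
Proof. by move=> e0; rewrite /Cneg_ball besov0// => phi /=; rewrite subrr. Qed.

Let ball_sym (f g : Cneg) (e : R) : Cneg_ball f e g -> Cneg_ball g e f.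
Proof. by rewrite /Cneg_ball besovN. Qed.

Let ball_triangle (f g h : Cneg) (e1 e2 : R) :
  Cneg_ball f e1 g -> Cneg_ball g e2 h -> Cneg_ball f (e1 + e2) h.
Proof.
move=> fg gh; apply: le_lt_trans (besov_triangle alpha f h g) _.
by rewrite EFinD lteD.
Qed.

HB.instance Definition _ := @Nbhs_isPseudoMetric.Build R Cneg ent erefl
  Cneg_ball ball_center ball_sym ball_triangle erefl.

End Cneg.

Notation borel T := (g_sigma_algebraType (@open T)).

Section wasserstein.
Local Open Scope ereal_scope.
Context {R : realType} (dX : measure_display) (X : measurableType dX).

Definition coupling (mu nu : set X -> \bar R) : set (probability (X * X)%type R) :=
  [set pi | forall A : set X, measurable A ->
     pi (A `*` setT) = mu A /\ pi (setT `*` A) = nu A].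

Definition wasserstein (m : X -> X -> \bar R) (p : R) (mu nu : set X -> \bar R) :=
  (ereal_inf [set \int[pi]_z (m z.1 z.2) `^ p | pi in coupling mu nu]) `^ p^-1.

End wasserstein.

Section semiflow.
Context {R : realType} {d : nat} {L alpha0 : R}.
Context {dOm : measure_display} {Om : measurableType dOm}.
Variable P : probability Om R.
Local Notation C := (Cneg d L alpha0).
Variables (F : R -> R -> set (set Om)) (u : R -> R -> C -> Om -> C).

Definition law (X : Om -> C) : set (borel C) -> \bar R :=
  pushforward P (X : Om -> borel C).

Record white_noise_semiflow : Prop := {
  wn_sub_sigma : forall t s : R, 0 <= s <= t ->
    sigma_algebra setT (F s t) /\ F s t `<=` measurable ;
  wn_measurable : forall (t s : R) (f : C), 0 <= s <= t ->
    forall B : set (borel C), measurable B -> F s t (u t s f @^-1` B) ;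
  wn_independent : forall s t s' t' : R, 0 <= s -> s <= t -> t <= s' -> s' <= t' ->
    forall A B : set Om, F s t A -> F s' t' B -> P (A `&` B) = (P A * P B)%E ;
  wn_flow : forall (t s : R) (f : C) (w : Om), 0 <= s <= t -> u t 0 f w = u t s (u s 0 f w) w ;
  wn_law : forall (t s : R) (f : C), 0 <= s <= t ->
    forall B : set (borel C), measurable B ->
    law (u t s f) B = law (u (t - s) 0 f) B }.

(* f |-> u(t;s;f)(w) takes values in C^(-alpha), for which v is a lift, and
   the lift is continuous for the topologies of C^(-alpha0) and C^(-alpha). *)
Definition flow_continuity (delta : R) :=
  forall (t s alpha : R) (w : Om), 0 <= s < t -> alpha0 - delta < alpha <= alpha0 ->
  exists2 v : C -> Cneg d L alpha,
    (forall f, (v f : testfun d L -> R^o) = u t s f w) & continuous v.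

Definition order_preserving :=
  forall (t s : R) (f g : C) (w : Om), 0 <= s <= t -> distr_le f g -> distr_le (u t s f w) (u t s g w).

Definition coming_down (delta : R) :=
  exists K : R -> {RV P >-> R},
  [/\ forall (s : R) (w : Om), 0 <= s -> 0 <= K s w,
      forall p : R, 1 <= p ->
        (ereal_sup [set 'E_P[fun w => (K s w `^ p)%R] | s in `[0%R, +oo[] < +oo)%E &
      forall s : R, 0 <= s -> exists2 gamma : R, 0 < gamma &
        forall (alpha : R) (w : Om), alpha0 - delta < alpha <= alpha0 ->
        (ereal_sup [set ereal_sup
             [set ((t - s) `^ gamma)%:E * besov_norm alpha (u t s f w)
               | t in `[s, (s + 1)%R]]
           | f in [set: C]] <= (K s w)%:E)%E].

Definition metric_p (alpha p : R) (f g : borel C) : \bar R :=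
  mine (besov_norm_p alpha p ((f : C) \- (g : C))%R) 1%E.

Definition exponential_mixing (delta lambda : R) :=
  forall alpha p : R, alpha0 - delta < alpha <= alpha0 -> 1 <= p ->
  exists M : R, forall t : R, 0 <= t ->
    (ereal_sup [set wasserstein (metric_p alpha p) p
                      (law (u t 0%R f1)) (law (u t 0%R f2))
                 | f1 in [set: C] & f2 in [set: C]]
     <= (M * expR (- (lambda * t)))%:E)%E.

End semiflow.

(* Main.v *)
Require Import Defs.
From HB Require Import structures.
From mathcomp Require Import all_boot all_order all_algebra.
From mathcomp Require Import all_classical all_reals all_analysis.
From mathcomp Require Import measurable_realfun ring lra.

Set Implicit Arguments.
Unset Strict Implicit.
Unset Printing Implicit Defensive.

Import Order.TTheory GRing.Theory Num.Theory.
Import numFieldNormedType.Exports.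

Local Open Scope classical_set_scope.
Local Open Scope ring_scope.

(** Fix p, alpha and write alpha' = alpha - d / p; the hypothesis on p says that
    alpha' > alpha0 - delta, which leaves room for an exponent alpha'' strictly
    between alpha0 - delta and alpha'.

    The supremum over all pairs of data is an increasing limit along constant
    data. Order preservation bounds the difference of two solutions started from
    smooth functions by X - Y, where X and Y are the solutions started from large
    constants m and - m; smooth functions are dense and the flow is continuous
    into the space of exponent alpha, so the bound reaches all data
    (sup_over_constants). Hence, by monotone convergence (mean_sup), it suffices
    to bound the p-th moment of the norm of X - Y uniformly in m.

    What makes this possible is that U = X - Y is a nonnegative distribution.
    First, the supremum norm of exponent alpha is then controlled by the integral
    norm of exponent alpha' and integrability p (besov_pos_embed): the heat
    kernel at time s is pointwise below a multiple of the kernel at the times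
    between 2 s and 4 s and at the points within distance sqrt s, and a
    nonnegative distribution preserves this inequality, so that a large value of
    the heat flow U_s at one point forces large values on a whole space-time box.
    Second, although X and Y are coupled through the same noise and mixing only
    speaks of some coupling of their laws, monotonicity of the odd power
    g (a) = a |a|^(p - 1) gives
      E (X_s - Y_s)^p <= 2^p (E g (X_s) - E g (Y_s)),
    whose right-hand side only depends on the two laws and can therefore be
    computed with any coupling pi of them (ordered_pointwise, ordered_st_int):
      E g (X_s) - E g (Y_s) <= p E_pi |k_s - l_s| (|k_s| + |l_s|)^(p - 1).

    Exponential mixing with exponents alpha'' and 2 supplies a coupling for which
    the square of the truncated distance has mean at most M exp (- 2 lambda t)
    (good_coupling), while coming down from infinity bounds all moments of
    the norms of exponent alpha'' uniformly in the data and in t >= t0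
    (flow_moments). By
    Young's inequality with threshold h = exp (- lambda t) (coupled_bound), the
    time singularity being integrable since alpha'' < alpha', both contributions
    are of order exp (- lambda t). The p-th root gives the stated rate.

    Interchanging expectation and the integrals over time and space requires the
    joint measurability of the heat flow in the data, the time and the point.
    The kernel is a product of one-dimensional theta functions, each of which is a
    combination of entire power series in exponentials: this gives smoothness,
    joint continuity, and the pointwise comparisons above. Continuity of
    the flow of an arbitrary element of the space follows by density of smooth
    functions. *)

(** * Entire power series *)

Section entire.
Context {R : realType}.
Implicit Types (c : R^nat) (K x : R).

(** Coefficients that decay faster than any geometric sequence: stating this
    through bounds rather than through convergence makes the stability under
    termwise derivation a one-line estimate. *)
Definition rapid c := forall K, 0 < K -> exists B, forall n, `|c n| * K ^+ n <= B.

Definition psum c x : R := limn (pseries c x).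

Lemma rapid_cvg c K : rapid c -> cvgn (pseries c K).
Proof.
move=> rc; have K1 : 0 < 2 * (`|K| + 1) by rewrite mulr_gt0// ltr_wpDl.
have [B cB] := rc _ K1.
have B0 : 0 <= B by apply: le_trans (cB 0%N); rewrite expr0 mulr1.
apply: normed_cvg.
apply: (@series_le_cvg _ _ (geometric B (2^-1))) => [n|n|n|].
- by rewrite normr_ge0.
- by rewrite /geometric /= mulr_ge0// exprn_ge0// invr_ge0.
- rewrite /geometric /= normrM normrX exprVn ler_pdivlMr ?exprn_gt0//.
  apply: le_trans (cB n); rewrite exprMn -mulrA ler_wpM2l//.
  by rewrite mulrC ler_wpM2l ?exprn_ge0// lerXn2r ?nnegrE// ?addr_ge0// lerDl.
- apply: is_cvg_geometric_series; rewrite ger0_norm ?invr_ge0// invf_lt1//.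
  by rewrite ltr1n.
Qed.

Lemma rapid_diffs c : rapid c -> rapid (pseries_diffs c).
Proof.
move=> rc K K0.
have K1 : 0 < 2 * (K + 1) by rewrite mulr_gt0// addr_gt0.
have [B cB] := rc _ K1; exists B => n; apply: le_trans (cB n.+1).
rewrite /pseries_diffs normrM mulrAC mulrC ler_wpM2l// exprMn ger0_norm//.
rewrite ler_pM ?exprn_ge0 ?(ltW K0)//.
  by rewrite -natrX ler_nat (ltnW (ltn_expl _ _)).
rewrite exprS; apply: (@le_trans _ _ (1 * (K + 1) ^+ n)); last first.
  by rewrite ler_wpM2r// ?exprn_ge0 ?addr_ge0// ?lerDr// ltW.
rewrite mul1r lerXn2r ?nnegrE ?(ltW K0)//; first by rewrite addr_ge0// ltW.
by rewrite lerDl.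
Qed.

Lemma rapid_shift c : rapid c -> rapid (fun n => c n.+1).
Proof.
move=> rc K K0; have [B cB] := rc _ K0; exists (B / K) => n.
by rewrite ler_pdivlMr// -mulrA -exprSr.
Qed.

Lemma is_derive_psum c x : rapid c -> is_derive x (1 : R) (psum c) (psum (pseries_diffs c) x).
Proof.
move=> rc; apply: (@pseries_snd_diffs _ _ (`|x| + 1)).
- exact: rapid_cvg.
- exact/rapid_cvg/rapid_diffs.
- exact/rapid_cvg/rapid_diffs/rapid_diffs.
- by rewrite (ger0_norm (addr_ge0 _ _))// ltrDl.
Qed.

Lemma psum_esum c x : rapid c -> (forall n, 0 <= c n) -> 0 <= x ->
  (\esum_(n in [set: nat]) (c n * x ^+ n)%:E = (psum c x)%:E)%E.
Proof.
move=> rc c0 x0; rewrite -nneseries_esumT; last first.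
  by move=> n; rewrite lee_fin mulr_ge0// exprn_ge0.
rewrite /psum -EFin_lim; last exact: rapid_cvg.
congr (limn _); apply/funext => n; rewrite /= /pseries /series /=.
by rewrite sumEFin.
Qed.

(** Completing the square. *)
Lemma rapid_gauss (g : R) : 0 < g -> rapid (fun n => expR (- (g * n%:R ^+ 2))).
Proof.
move=> g0 K K0; exists (expR (ln K ^+ 2 / (4 * g))) => n.
rewrite ger0_norm ?expR_ge0// -{1}(lnK (_ : K \is Num.pos)) ?posrE//.
rewrite -expRM_natl -expRD ler_expR.
have -> : ln K ^+ 2 / (4 * g) = - (g * n%:R ^+ 2) + n%:R * ln K
    + (2 * g * n%:R - ln K) ^+ 2 / (4 * g) by field; rewrite gt_eqF.
by rewrite lerDl divr_ge0 ?sqr_ge0// mulr_ge0// ltW.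
Qed.

End entire.

(** * The periodised Gaussian in one variable *)

Lemma ge0_esumZl {R : realType} {T : choiceType} (I : set T) (k : R) (a : T -> \bar R) :
  0 <= k -> (forall i, I i -> 0 <= a i)%E ->
  (\esum_(i in I) (k%:E * a i) = k%:E * \esum_(i in I) a i)%E.
Proof.
have le_k r (f : T -> \bar R) : 0 <= r -> (forall i, I i -> 0 <= f i)%E ->
    (\esum_(i in I) (r%:E * f i) <= r%:E * \esum_(i in I) f i)%E.
  move=> r0 f0; apply: ge_ereal_sup => _ [X [finX XI] <-].
  rewrite fsbig_finite//= big_seq -ge0_sume_distrr; last first.
    by move=> i; rewrite in_fset_set// inE => /XI /f0.
  rewrite -big_seq lee_wpmul2l ?lee_fin// -fsbig_finite//.
  by apply: ereal_sup_ubound; exists X.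
rewrite le_eqVlt => /predU1P[<- a0|k0 a0].
  by rewrite mul0e esum1// => i _; rewrite mul0e.
apply/eqP; rewrite eq_le; apply/andP; split; first by apply: le_k => //; exact: ltW.
rewrite -lee_pdivlMl//.
have ki0 : (0 <= k^-1)%R by rewrite invr_ge0 ltW.
have ka0 i : I i -> (0 <= k%:E * a i)%E.
  by move=> Ii; apply: mule_ge0; [rewrite lee_fin ltW|exact: a0].
apply: le_trans (le_k _ _ ki0 ka0).
by apply: le_esum => i Ii; rewrite muleA -EFinM mulVf ?gt_eqF// mul1e.
Qed.

Section theta.
Context {R : realType} (L : R).
Implicit Types (b y z : R) (j : int).
Local Open Scope ereal_scope.

Definition gterm b y j : R := expR (- (b * (y + L * j%:~R) ^+ 2)).

(** Jacobi's theta function. *)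
Definition theta b y : R := fine (\esum_(j in [set: int]) (gterm b y j)%:E).

(** The terms with j >= 0 and those with j < 0, as power series. *)
Definition thetap b y : R := (expR (- (b * y ^+ 2)) *
  psum (fun n => expR (- (b * L ^+ 2 * n%:R ^+ 2))) (expR (- (2 * b * L * y))))%R.

Definition thetan b y : R := (expR (- (b * y ^+ 2)) * (expR (2 * b * L * y) *
  psum (fun n => expR (- (b * L ^+ 2 * n.+1%:R ^+ 2))) (expR (2 * b * L * y))))%R.

Lemma gterm_ge0 b y j : (0 <= gterm b y j)%R.
Proof. exact: expR_ge0. Qed.

(** Expanding the square (y + L j)^2 exhibits a power of exp (- 2 b L y) in the
    j-th term; the negative j are the powers of the inverse. *)
Lemma theta_series b y : (0 < b)%R -> (0 < L)%R ->
  \esum_(j in [set: int]) (gterm b y j)%:E = (thetap b y + thetan b y)%:E.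
Proof.
move=> b0 L0.
have bL : (0 < b * L ^+ 2)%R by rewrite mulr_gt0// exprn_gt0.
have rp := rapid_gauss bL; have rn := rapid_shift rp.
rewrite (esumID (range Posz)); last by move=> i _; rewrite lee_fin gterm_ge0.
have -> : [set: int] `&` ~` range Posz = range Negz.
  rewrite setTI; apply/seteqP; split => [[n|n] /= H|_ [n _ <-] [m _]//].
    by exfalso; apply: H; exists n.
  by exists n.
rewrite setTI EFinD; congr (_ + _).
  rewrite esum_image; last by move=> i k _ _ [].
  rewrite /thetap EFinM -psum_esum ?expR_ge0//.
  rewrite -ge0_esumZl ?expR_ge0//.
  apply: eq_esum => n _; rewrite -EFinM; congr EFin.
  by rewrite /gterm -expRM_natl -!expRD /=; congr expR; rewrite -pmulrn; ring.
rewrite esum_image; last by move=> i k _ _ [].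
rewrite /thetan 2!EFinM -psum_esum ?expR_ge0//.
rewrite -!ge0_esumZl ?expR_ge0//.
apply: eq_esum => n _; rewrite -!EFinM; congr EFin.
rewrite /gterm -expRM_natl -!expRD /=; congr expR.
by rewrite NegzE mulrNz -pmulrn -natr1; ring.
Qed.

Hypothesis L0 : (0 < L)%R.

Lemma theta_esum b y : (0 < b)%R ->
  \esum_(j in [set: int]) (gterm b y j)%:E = (theta b y)%:E.
Proof. by move=> b0; rewrite /theta theta_series. Qed.

Lemma thetaE b y : (0 < b)%R -> theta b y = (thetap b y + thetan b y)%R.
Proof. by move=> b0; rewrite /theta theta_series. Qed.

Lemma gterm_le_theta b y j : (0 < b)%R -> (gterm b y j <= theta b y)%R.
Proof.
move=> b0; rewrite -lee_fin -theta_esum//; apply: esum_ge.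
exists [set j]; first by split => //; exact: finite_set1.
by rewrite fsbig_set1.
Qed.

Lemma theta_gt0 b y : (0 < b)%R -> (0 < theta b y)%R.
Proof. by move=> b0; apply: lt_le_trans (gterm_le_theta y 0 b0); exact: expR_gt0. Qed.

Lemma theta_ge0 b y : (0 < b)%R -> (0 <= theta b y)%R.
Proof. by move=> b0; exact/ltW/theta_gt0. Qed.

Lemma le_theta b b' y y' k : (0 < b)%R -> (0 < b')%R -> (0 <= k)%R ->
  (forall j, gterm b y j <= k * gterm b' y' j)%R -> (theta b y <= k * theta b' y')%R.
Proof.
move=> b0 b'0 k0 H; rewrite -lee_fin EFinM -!theta_esum// -ge0_esumZl//; last first.
  by move=> i _; rewrite lee_fin gterm_ge0.
by apply: le_esum => j _; rewrite -EFinM lee_fin.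
Qed.

Lemma theta_periodic b y (n : int) : (0 < b)%R -> theta b (y + L * n%:~R) = theta b y.
Proof.
move=> b0; rewrite /theta; congr fine; apply/esym.
rewrite (@reindex_esum _ _ _ setT setT (fun j => n + j)%R).
  by apply: eq_esum => j _; rewrite /gterm intrD mulrDr addrA.
by split.
Qed.

Lemma theta_decr b b' y : (0 < b)%R -> (b <= b')%R -> (theta b' y <= theta b y)%R.
Proof.
move=> b0 bb'; rewrite -[leRHS]mul1r; apply: le_theta => //.
  exact: lt_le_trans bb'.
by move=> j; rewrite mul1r /gterm ler_expR lerN2 ler_wpM2r// sqr_ge0.
Qed.

(** Termwise, this is y^2 <= 2 z^2 + 2 (y - z)^2. *)
Lemma theta_move b b' y z : (0 < b')%R -> (2 * b' <= b)%R ->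
  (theta b z <= expR (b * (y - z) ^+ 2) * theta b' y)%R.
Proof.
move=> b'0 bb'; have b0 : (0 < b)%R by apply: lt_le_trans bb'; rewrite mulr_gt0.
apply: le_theta => //.
move=> j; rewrite /gterm -expRD ler_expR.
set w := (z + _)%R; rewrite (_ : y + L * j%:~R = w + (y - z))%R; last by rewrite /w; ring.
set h := (y - z)%R.
have H : (b' * (w + h) ^+ 2 <= b / 2 * (w + h) ^+ 2)%R.
  by rewrite ler_wpM2r ?sqr_ge0//; lra.
have H2 : (0 <= b / 2 * (w - h) ^+ 2)%R by rewrite mulr_ge0 ?sqr_ge0//; lra.
have -> : (- (b * w ^+ 2) = b * h ^+ 2 - b / 2 * (w + h) ^+ 2 - b / 2 * (w - h) ^+ 2)%R.
  by field.
lra.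
Qed.

Lemma period_rep y : exists n : int, (0 <= y + L * n%:~R <= L)%R.
Proof.
exists (- Num.floor (y / L))%R; rewrite mulrNz mulrN.
have /andP[H1 H2] := real_floor_itv (num_real (y / L)).
rewrite subr_ge0 lerBlDr (mulrC L) -ler_pdivlMr// H1 /=.
have := ltW H2; rewrite intrD ler_pdivrMr// mulrDl mul1r addrC (mulrC _%:~R); lra.
Qed.

Definition theta_bound b : R := (expR (b * L ^+ 2) * theta (b / 2) 0)%R.

Lemma theta_le_bound b y : (0 < b)%R -> (theta b y <= theta_bound b)%R.
Proof.
move=> b0; have [n /andP[H1 H2]] := period_rep y.
rewrite -(theta_periodic y n)//; apply: le_trans (@theta_move _ (b / 2) 0 _ _ _) _.
- by rewrite divr_gt0.
- by rewrite mulrC divfK.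
rewrite ler_wpM2r ?theta_ge0 ?divr_gt0// ler_expR ler_wpM2l ?(ltW b0)//.
by rewrite sub0r sqrrN lerXn2r// nnegrE ltW.
Qed.

Lemma theta_lb b y : (0 < b)%R -> (expR (- (b * L ^+ 2)) <= theta b y)%R.
Proof.
move=> b0; have [n /andP[H1 H2]] := period_rep y.
rewrite -(theta_periodic y n)//; apply: le_trans (gterm_le_theta _ 0 b0).
rewrite /gterm ler_expR lerN2 ler_wpM2l ?(ltW b0)// mulr0 addr0.
by rewrite lerXn2r// nnegrE ltW.
Qed.

(** Termwise, a^2 exp (- b a^2) <= (2 / b) exp (- b a^2 / 2). *)
Lemma theta_sub b b' y : (0 < b)%R -> (b <= b')%R ->
  (theta b y <= theta b' y + (b' - b) * (2 / b) * theta (b / 2) y)%R.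
Proof.
move=> b0 bb'; have b'0 := lt_le_trans b0 bb'; have b20 : (0 < b / 2)%R by rewrite divr_gt0.
have k0 : (0 <= (b' - b) * (2 / b))%R.
  by rewrite mulr_ge0 ?subr_ge0// divr_ge0// ltW.
rewrite -lee_fin EFinD EFinM -!theta_esum// -ge0_esumZl//; last first.
  by move=> i _; rewrite lee_fin gterm_ge0.
rewrite -esumD; last 2 first.
- by move=> i _; rewrite lee_fin gterm_ge0.
- by move=> i _; rewrite -EFinM lee_fin mulr_ge0// gterm_ge0.
apply: le_esum => j _; rewrite -EFinM -EFinD lee_fin /gterm.
set a := ((y + _) ^+ 2)%R; have a0 : (0 <= a)%R by rewrite /a sqr_ge0.
have -> : (- (b' * a) = - (b * a) - (b' - b) * a)%R by ring.
rewrite expRD.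
have H1 : (1 - (b' - b) * a <= expR (- ((b' - b) * a)))%R by exact: expR_ge1Dx.
have H2 : (b / 2 * a <= expR (b / 2 * a))%R.
  by apply: le_trans (expR_ge1Dx _); rewrite lerDr.
have H3 : (a * expR (- (b * a)) <= 2 / b * expR (- (b / 2 * a)))%R.
  have -> : (- (b * a) = - (b / 2 * a) - (b / 2 * a))%R by field.
  rewrite expRD mulrA mulrAC ler_wpM2r ?expR_ge0//.
  rewrite [X in (_ * X)%R]expRN ler_pdivrMr ?expR_gt0//.
  have -> : a = (2 / b * (b / 2 * a))%R by field; rewrite gt_eqF.
  by rewrite ler_wpM2l ?divr_ge0// ?(ltW b0)// {1}(_ : 2 / b * (b / 2 * a) = a)%R ?H2//; field; rewrite gt_eqF.
have H4 := ler_wpM2l (expR_ge0 (- (b * a))) H1.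
have b'b : (0 <= b' - b)%R by rewrite subr_ge0.
have H5 := ler_wpM2l b'b H3.
lra.
Qed.

End theta.

(** * Smoothness from a class of functions stable under derivation *)

Section smooth_expr.
Context {R : realType} {d : nat}.
Implicit Types (g h : 'rV[R]_d -> R^o).

(** An inductive class whose members are differentiable and whose derivatives are
    again members; hence all of its members are smooth. *)
Inductive smooth_expr : ('rV[R]_d -> R^o) -> Prop :=
| SE_cst c : smooth_expr (cst c)
| SE_coord i : smooth_expr (fun y => y 0 i)
| SE_add g h : smooth_expr g -> smooth_expr h -> smooth_expr (g + h)
| SE_mul g h : smooth_expr g -> smooth_expr h -> smooth_expr (g * h)
| SE_exp g : smooth_expr g -> smooth_expr (expR \o g)
| SE_psum c g : rapid c -> smooth_expr g -> smooth_expr (psum c \o g).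

Lemma derive_comp1 (f : R -> R) (f' : R) g x v : differentiable g x ->
  is_derive (g x) (1 : R) f f' ->
  differentiable (f \o g : 'rV[R]_d -> R^o) x /\
  'D_v (f \o g : 'rV[R]_d -> R^o) x = f' * 'D_v g x.
Proof.
move=> dg df; have df1 : differentiable f (g x) by apply/derivable1_diffP.
split; first exact: differentiable_comp.
rewrite (deriveE _ (differentiable_comp dg df1)) diff_comp//= (deriveE _ dg).
by rewrite diff1E// derive1E (@derive_val _ _ _ _ _ _ _ df) -mulrC.
Qed.

Lemma smooth_exprP g : smooth_expr g -> (forall x, differentiable g x) /\
  (forall v, smooth_expr ('D_v g)).
Proof.
elim=> {g} [c|i|g h _ [dg Dg] _ [dh Dh]|g h sg [dg Dg] sh [dh Dh]|g sg [dg Dg]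
           |c g rc sg [dg Dg]].
- split => [x|v]; first exact: differentiable_cst.
  rewrite (_ : 'D_v _ = cst 0); first exact: SE_cst.
  by apply/funext => x; rewrite derive_cst.
- split => [x|v]; first exact: differentiable_coord.
  rewrite (_ : 'D_v _ = cst (v 0 i)); first exact: SE_cst.
  apply/funext => x; rewrite deriveE; last exact: differentiable_coord.
  have @f : {linear 'rV[R]_d -> R^o}.
    by exists (fun y : 'rV[R]_d => y 0 i); do 2![eexists]; do ?[constructor];
      rewrite ?mxE// => ? *; rewrite ?mxE//; move=> ?; rewrite !mxE.
  by rewrite (_ : (fun _ => _) = f)// diff_lin//; exact: coord_continuous.
- split => [x|v]; first exact: differentiableD.
  rewrite (_ : 'D_v _ = 'D_v g + 'D_v h); first exact: SE_add.
  by apply/funext => x; rewrite deriveD//; exact: diff_derivable.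
- split => [x|v]; first exact: differentiableM.
  rewrite (_ : 'D_v _ = g * 'D_v h + h * 'D_v g).
    by apply: SE_add; apply: SE_mul.
  by apply/funext => x; rewrite deriveM//; exact: diff_derivable.
- split => [x|v]; first by have [] := derive_comp1 0 (dg x) (is_derive_expR (g x)).
  rewrite (_ : 'D_v _ = (expR \o g) * 'D_v g); first exact: (SE_mul (SE_exp sg)).
  by apply/funext => x; have [_ ->] := derive_comp1 v (dg x) (is_derive_expR (g x)).
- split => [x|v]; first by have [] := derive_comp1 0 (dg x) (is_derive_psum (g x) rc).
  rewrite (_ : 'D_v _ = (psum (pseries_diffs c) \o g) * 'D_v g).
    by apply: SE_mul => //; apply: SE_psum => //; exact: rapid_diffs.
  by apply/funext => x; have [_ ->] := derive_comp1 v (dg x) (is_derive_psum (g x) rc).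
Qed.

Lemma smooth_expr_smooth g : smooth_expr g -> torus_smooth g.
Proof.
move=> sg b; suff /smooth_exprP[] : smooth_expr (pderiv b g) by [].
by elim: b => //= i b /smooth_exprP[].
Qed.

Lemma SE_prod n (f : 'I_n -> 'rV[R]_d -> R^o) : (forall i, smooth_expr (f i)) ->
  smooth_expr (fun y => \prod_i f i y).
Proof.
move=> sf; rewrite (_ : (fun _ => _) = \prod_i f i); last first.
  by apply/funext => y; rewrite fct_prodE.
by apply: big_ind => [||i _]; [exact: SE_cst|exact: SE_mul|exact: sf].
Qed.

End smooth_expr.

(** * The heat kernel of the torus *)

(** A sum over the lattice Z^d of products is the product of the sums over Z, by
    splitting off one coordinate at a time. *)
Lemma esum_rV_prod {R : realType} d (f : 'I_d -> int -> R) (S : 'I_d -> R) :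
  (forall i j, 0 <= f i j) ->
  (forall i, \esum_(j in [set: int]) (f i j)%:E = (S i)%:E)%E ->
  (\esum_(k in [set: 'rV[int]_d]) (\prod_i f i (k 0%R i))%:E = (\prod_i S i)%:E)%E.
Proof.
elim: d f S => [|d IH] f S f0 fS.
  rewrite big_ord0 (_ : [set: 'rV[int]_0] = [set 0%R]); last first.
    by apply/seteqP; split => // k _; rewrite (thinmx0 k).
  by rewrite esum_set1 big_ord0// lee_fin.
pose e (jk : int * 'rV[int]_d) : 'rV[int]_d.+1 := row_mx (const_mx jk.1 : 'rV_1) jk.2.
rewrite (@reindex_esum _ _ _ (setT `*`` (fun=> setT)) setT e); last first.
  split => //.
  - move=> [j k] [j' k'] _ _; rewrite /e => /(@eq_row_mx _ 1 1 d) [/matrixP/(_ 0 0)].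
    by rewrite !mxE /= => -> ->.
  - move=> k _; exists (lsubmx (k : 'rV_(1 + d)) 0 0, rsubmx (k : 'rV_(1 + d))) => //.
    have lk : const_mx (lsubmx (k : 'rV_(1 + d)) 0 0) = lsubmx (k : 'rV_(1 + d)).
      by apply/matrixP => a b; rewrite !ord1 !mxE.
    exact: (etrans (f_equal (fun a => row_mx a (rsubmx (k : 'rV_(1 + d)))) lk) (@hsubmxK _ 1 1 d k)).
have E jk : (\prod_i f i (e jk 0%R i) = f ord0 jk.1 * \prod_i f (lift ord0 i) (jk.2 0%R i)).
  rewrite big_ord_recl; congr (f _ _ * _).
    transitivity ((const_mx jk.1 : 'rV[int]_1) 0 0); last by rewrite mxE.
    rewrite -(row_mxEl (const_mx jk.1 : 'rV_1) jk.2).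
    by congr (row_mx _ _ _ _); exact: val_inj.
  apply: eq_bigr => i _; congr (f _ _).
  rewrite -(row_mxEr (const_mx jk.1 : 'rV_1) jk.2).
  by congr (row_mx _ _ _ _); exact: val_inj.
under eq_esum do rewrite E EFinM.
rewrite -(@esum_esum _ int 'rV[int]_d setT (fun=> setT)
  (fun j k => (f ord0 j)%:E * (\prod_i f (lift ord0 i) (k 0%R i))%:E)%E); last first.
  by move=> j k _ _; rewrite -EFinM lee_fin mulr_ge0// prodr_ge0.
under eq_esum => j _.
  rewrite ge0_esumZl//; last by move=> k _; rewrite lee_fin prodr_ge0.
  rewrite (IH (fun i => f (lift ord0 i)) (fun i => S (lift ord0 i)))//; over.
under eq_esum do rewrite muleC.
rewrite ge0_esumZl//; first by rewrite fS -EFinM mulrC -big_ord_recl.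
  apply: prodr_ge0 => i _; rewrite -lee_fin -fS; apply: esum_ge0 => j _.
  by rewrite lee_fin.
by move=> j _; rewrite lee_fin.
Qed.

Section heat1.
Context {R : realType} (L : R).
Hypothesis L0 : 0 < L.
Implicit Types (s r y z : R).

(** The heat kernel of the circle of length L. *)
Definition heat1 s y : R := (Num.sqrt (4 * pi * s))^-1 * theta L (4 * s)^-1 y.

Lemma heat_kernelE d s (y : 'rV[R]_d) : 0 < s ->
  heat_kernel L s y = \prod_i heat1 s (y 0 i).
Proof.
move=> s0; rewrite /heat_kernel /heat1 big_split /=; congr (_ * _).
  rewrite big_const_ord iter_mulr mulr1.
  rewrite powRN [d%:R / 2]mulrC powRrM powR12_sqrt; last by rewrite !mulr_ge0// ?pi_ge0// ltW.
  by rewrite powR_mulrn ?sqrtr_ge0// exprVn.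
rewrite (_ : (\esum_(k in _) _)%E = (\prod_i theta L (4 * s)^-1 (y 0 i))%:E)//.
rewrite -(@esum_rV_prod _ _ (fun i => gterm L (4 * s)^-1 (y 0 i))).
- apply: eq_esum => k _; congr EFin; rewrite -expR_sum; congr expR.
  rewrite sumrN; congr (- _).
  by rewrite mulr_suml; apply: eq_bigr => i _; rewrite mulrC.
- by move=> i j; exact: gterm_ge0.
- by move=> i; rewrite theta_esum// invr_gt0 mulr_gt0.
Qed.

Let b_gt0 s : 0 < s -> 0 < (4 * s)^-1.
Proof. by move=> s0; rewrite invr_gt0 mulr_gt0. Qed.

Let w_gt0 s : 0 < s -> 0 < (Num.sqrt (4 * pi * s))^-1 :> R.
Proof. by move=> s0; rewrite invr_gt0 sqrtr_gt0 !mulr_gt0// pi_gt0. Qed.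

Lemma heat1_gt0 s y : 0 < s -> 0 < heat1 s y.
Proof. by move=> s0; rewrite /heat1 mulr_gt0 ?w_gt0// theta_gt0// b_gt0. Qed.

Lemma heat1_periodic s y (n : int) : 0 < s -> heat1 s (y + L * n%:~R) = heat1 s y.
Proof. by move=> s0; rewrite /heat1 theta_periodic// b_gt0. Qed.

(** A local Harnack inequality. Doubling the time halves the inverse variance,
    which is what theta_move asks for; up to the factor 4 in time, the
    normalisations differ by at most 2. *)
Lemma heat1_move s r y z : 0 < s -> 2 * s <= r <= 4 * s -> (y - z) ^+ 2 <= s ->
  heat1 s z <= 2 * expR 1 * heat1 r y.
Proof.
move=> s0 /andP[sr rs] yz; have r0 : 0 < r by apply: lt_le_trans sr; rewrite mulr_gt0.
rewrite /heat1 mulrACA ler_pM ?theta_ge0 ?b_gt0// ?(ltW (w_gt0 _))//.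
  rewrite -ler_pdivrMl// -invrM ?unitfE ?gt_eqF ?invr_gt0 ?sqrtr_gt0 ?mulr_gt0 ?pi_gt0//.
  rewrite lef_pV2 ?posrE ?mulr_gt0 ?sqrtr_gt0 ?mulr_gt0 ?pi_gt0//.
  rewrite -[X in _ <= _ * X](ger0_norm (ler0n _ _)) -sqrtr_sqr -sqrtrM ?mulr_ge0 ?pi_ge0 ?(ltW s0)//.
  rewrite ler_wsqrtr//.
  have := pi_gt0 R; nra.
apply: (le_trans (theta_move L0 y z (b_gt0 r0) _)).
  rewrite !invfM mulrA ler_pdivlMr// mulrAC ler_pdivrMr//; lra.
rewrite ler_wpM2r ?theta_ge0 ?b_gt0// ler_expR ler_pdivrMl ?mulr_gt0//; nra.
Qed.

(** At the times in [1/4, 1] the kernel is bounded above and below; this replaces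
    the Harnack inequality, whose times 2 s and 4 s would leave ]0, 1]. *)
Definition quarter_bound : R := theta_bound L 4^-1 * expR (L ^+ 2).

Lemma heat1_quarter s z : 4^-1 <= s <= 1 -> heat1 s z <= quarter_bound * heat1 4^-1 z.
Proof.
move=> /andP[s4 s1]; have s0 : 0 < s by apply: lt_le_trans s4.
rewrite /heat1 mulrCA ler_pM ?theta_ge0 ?b_gt0// ?(ltW (w_gt0 _))//.
  by rewrite lef_pV2 ?posrE ?sqrtr_gt0 ?mulr_gt0 ?pi_gt0// ler_wsqrtr// ler_wpM2l// mulr_ge0// pi_ge0.
have b14 : 4^-1 <= (4 * s)^-1 by rewrite lef_pV2 ?posrE ?mulr_gt0//; lra.
apply: le_trans (theta_decr L0 z _ b14) _ => //.
apply: le_trans (theta_le_bound L0 z _) _ => //.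
rewrite /quarter_bound -mulrA ler_peMr//.
  by rewrite mulr_ge0 ?expR_ge0// theta_ge0.
rewrite divff// invr1 -[leLHS](mulfV (lt0r_neq0 (expR_gt0 (L ^+ 2)))) ler_wpM2l ?expR_ge0//.
by rewrite -expRN -{1}[L ^+ 2]mul1r theta_lb.
Qed.

(** The Lipschitz constant does not depend on y: this upgrades continuity in each
    variable to joint continuity. *)
Lemma theta_lip c b b' y : 0 < c -> c <= b -> c <= b' ->
  `|theta L b y - theta L b' y| <= `|b - b'| * (2 / c * theta_bound L (c / 2)).
Proof.
move=> c0; wlog bb' : b b' / b <= b'.
  move=> H cb cb'; have [bb'|/ltW b'b] := leP b b'; first exact: H.
  by rewrite distrC (distrC b) H.
move=> cb cb'; have b0 : 0 < b by apply: lt_le_trans cb.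
rewrite distrC (distrC b) ler0_norm ?subr_le0 ?theta_decr// opprB.
rewrite ger0_norm ?subr_ge0// lerBlDl; apply: le_trans (theta_sub L0 y b0 bb') _.
rewrite lerD2l -mulrA ler_wpM2l ?subr_ge0//.
rewrite ler_pM ?divr_ge0 ?(ltW b0) ?theta_ge0 ?divr_gt0//.
  by rewrite ler_wpM2l// lef_pV2.
apply: le_trans (theta_decr L0 y _ _) (theta_le_bound L0 y _); rewrite ?divr_gt0//.
by rewrite ler_wpM2r.
Qed.

Lemma SE_theta d b (g : 'rV[R]_d -> R^o) : 0 < b -> smooth_expr g ->
  smooth_expr (theta L b \o g).
Proof.
move=> b0 sg.
have rp := rapid_gauss (_ : 0 < b * L ^+ 2); have rn := rapid_shift (rp _).
have bL : 0 < b * L ^+ 2 by rewrite mulr_gt0// exprn_gt0.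
pose e c := expR \o (cst c * g : 'rV[R]_d -> R^o).
have se c : smooth_expr (e c) by exact/SE_exp/SE_mul/sg/SE_cst.
pose q := expR \o (cst (- b) * (g * g) : 'rV[R]_d -> R^o).
have sq : smooth_expr q by exact/SE_exp/(SE_mul (SE_cst _))/SE_mul.
pose A := psum (fun n => expR (- (b * L ^+ 2 * n%:R ^+ 2))).
pose B := psum (fun n => expR (- (b * L ^+ 2 * n.+1%:R ^+ 2))).
rewrite (_ : _ \o _ = q * (A \o e (- (2 * b * L))) + q * (e (2 * b * L) * (B \o e (2 * b * L)))).
  apply: SE_add; first by apply: SE_mul => //; apply: SE_psum => //; exact: rp.
  by do 2 apply: SE_mul => //; apply: SE_psum => //; exact: rn.
apply/funext => y; rewrite /= thetaE// /thetap /thetan /q /e /A /B /= !fctE.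
by rewrite !mulNr expr2.
Qed.

Lemma SE_heat1 d s (g : 'rV[R]_d -> R^o) : 0 < s -> smooth_expr g ->
  smooth_expr (heat1 s \o g).
Proof.
move=> s0 sg; apply: (SE_mul (SE_cst _)); apply: SE_theta => //; exact: b_gt0.
Qed.

End heat1.

(** * Iterated integrals over the cell *)

Section cell_integral.
Local Open Scope ereal_scope.
Context {R : realType} (L : R).
Local Notation mR := (measurableTypeR R).
Local Notation leb := (@lebesgue_measure R).

Definition rcons_rv {n} (x : R) (y : 'rV[R]_n) : 'rV[R]_n.+1 :=
  row_mx (const_mx x : 'rV[R]_1) y.

Definition in_cell {n} (x : 'rV[R]_n) := forall i, (0 <= x 0 i <= L)%R.

Lemma in_cell_rcons n x (y : 'rV[R]_n) : (0 <= x <= L)%R -> in_cell y -> in_cell (rcons_rv x y).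
Proof.
move=> xL yL i; rewrite mxE; case: splitP => j _; [by rewrite mxE|exact: yL].
Qed.

Lemma torus_integralS n (g : 'rV[R]_n.+1 -> \bar R) :
  torus_integral L g = \int[leb]_(x in `[0%R, L]) torus_integral L (fun y => g (rcons_rv x y)).
Proof. by []. Qed.

(** Joint measurability in a parameter and the coordinates, the coordinates being
    moved one at a time into the parameter space so that Tonelli's theorem for
    products of two spaces applies at each step. *)
Fixpoint jmeas n : forall dZ (Z : measurableType dZ), (Z -> 'rV[R]_n -> \bar R) -> Prop :=
  match n return forall dZ (Z : measurableType dZ), (Z -> 'rV[R]_n -> \bar R) -> Prop with
  | 0%N => fun dZ Z G => measurable_fun [set: Z] (fun z : Z => G z 0%R : \bar R)
  | m.+1 => fun dZ Z G =>
      @jmeas m _ (Z * mR)%type (fun z y => G z.1 (rcons_rv z.2 y))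
  end.

Lemma jmeas_comp n dZ (Z : measurableType dZ) dY (Y : measurableType dY)
    (G : Z -> 'rV[R]_n -> \bar R) (f : Y -> Z) :
  measurable_fun setT f -> jmeas G -> jmeas (fun y => G (f y)).
Proof.
elim: n dZ Z dY Y G f => [|n IH] dZ Z dY Y G f mf /=.
  by move=> mG; exact: (measurableT_comp mG mf).
move=> JG; apply: (IH _ (Z * mR)%type _ (Y * mR)%type _ (fun z => (f z.1, z.2)) _ JG).
apply: measurable_fun_pair => /=; last exact: measurable_snd.
exact: measurableT_comp.
Qed.

Lemma measurable_cell_section dZ (Z : measurableType dZ) (H : Z * mR -> \bar R)
    (D : set R) : measurable D ->
  measurable_fun setT H -> measurable_fun setT (fun z => \int[leb]_(x in D) H (z, x)).
Proof.
move=> mD mH.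
have K (H' : Z * mR -> \bar R) : measurable_fun setT H' -> (forall z, 0 <= H' z) ->
    measurable_fun setT (fun z => \int[leb]_(x in D) H' (z, x)).
  move=> mH' H'0.
  have mHD : measurable_fun setT (H' \_ (setT `*` D)).
    by apply/(measurable_restrictT _ _).1 => //; [exact: measurableX|exact: measurable_funS mH'].
  have HD0 z : 0 <= (H' \_ (setT `*` D)) z by rewrite /patch; case: ifP.
  have := measurable_fun_fubini_tonelli_F (m2 := leb) _ mHD HD0.
  apply: eq_measurable_fun => z _; rewrite /fubini_F [RHS]integral_mkcond.
  apply: eq_integral => x _; rewrite /patch.
  by congr (if _ then _ else _); apply/idP/idP; rewrite !inE //= => -[].
under eq_fun do rewrite integralE.
apply: emeasurable_funB.
  apply: eq_measurable_fun (K _ (measurable_funepos mH) (funepos_ge0 H)) => z _.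
  by apply: eq_integral => x _; rewrite !funeposE.
have KN := K _ (measurable_funeneg mH) (funeneg_ge0 H).
by apply: eq_measurable_fun KN => z _; apply: eq_integral => x _; rewrite !funenegE.
Qed.

Lemma jmeas_torus_integral n dZ (Z : measurableType dZ) (G : Z -> 'rV[R]_n -> \bar R) :
  jmeas G -> measurable_fun setT (fun z => torus_integral L (G z)).
Proof.
elim: n dZ Z G => [//|n IH] dZ Z G /= JG.
exact: (measurable_cell_section (measurable_itv _) (IH _ _ _ JG)).
Qed.

(** The integral of a nonnegative function is a supremum over the simple functions
    below it, hence it is monotone on arbitrary functions. *)
Lemma integral_mono d (T : measurableType d) (mu : {measure set T -> \bar R})
    (D : set T) (f g : T -> \bar R) :
  (forall x, D x -> f x <= g x) -> \int[mu]_(x in D) f x <= \int[mu]_(x in D) g x.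
Proof.
have K (h k : T -> \bar R) : (forall x, D x -> 0 <= h x) ->
    (forall x, D x -> h x <= k x) -> \int[mu]_(x in D) h x <= \int[mu]_(x in D) k x.
  move=> h0 hk; rewrite !ge0_integralE//; last first.
    by move=> x Dx; apply: le_trans (h0 _ Dx) (hk _ Dx).
  apply: le_ereal_sup => _ [s sh <-]; exists s => // x; apply: le_trans (sh x) _.
  by rewrite /patch; case: ifPn => // /[!inE] /hk.
move=> fg; rewrite [leLHS]integralE [leRHS]integralE; apply: leeB; apply: K => x Dx.
- by rewrite funepos_ge0.
- by rewrite !funeposE ge_max !le_max fg// lexx orbT.
- by rewrite funeneg_ge0.
- by rewrite !funenegE ge_max !le_max leeN2 fg// lexx orbT.
Qed.

Lemma torus_integral_mono n (f g : 'rV[R]_n -> \bar R) :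
  (forall x, in_cell x -> f x <= g x) ->
  torus_integral L f <= torus_integral L g.
Proof.
elim: n f g => [|n IH] f g fg; first by apply: fg => -[].
apply: integral_mono => x /=; rewrite in_itv /= => x0L.
by apply: IH => y y0L; apply: fg; exact: in_cell_rcons.
Qed.

Lemma eq_torus_integral n (f g : 'rV[R]_n -> \bar R) :
  (forall x, in_cell x -> f x = g x) ->
  torus_integral L f = torus_integral L g.
Proof.
by move=> fg; apply/eqP; rewrite eq_le !torus_integral_mono// => x /fg ->.
Qed.

Lemma torus_integral_ge0 n (f : 'rV[R]_n -> \bar R) :
  (forall x, in_cell x -> 0 <= f x) -> 0 <= torus_integral L f.
Proof.
by move=> f0; rewrite -(torus_integral0 (L := L) n); exact: torus_integral_mono.
Qed.

Hypothesis L0 : (0 <= L)%R.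

Lemma torus_integral_cst n (c : R) : torus_integral L (fun _ : 'rV[R]_n => c%:E) = (c * L ^+ n)%:E.
Proof.
elim: n => [|n IH] /=; first by rewrite expr0 mulr1.
under eq_integral do rewrite IH.
rewrite integral_cst//= lebesgue_measure_itv /= lte_fin; case: ifPn => [L1|].
  by rewrite oppr0 adde0 -EFinM exprSr mulrA.
rewrite -leNgt => L1; have -> : L = 0%R by apply/eqP; rewrite eq_le L0 L1.
by rewrite mule0 expr0n mulr0.
Qed.

Lemma jmeas_section n dZ (Z : measurableType dZ) (G : Z -> 'rV[R]_n.+1 -> \bar R) x :
  jmeas G -> jmeas (fun z y => G z (rcons_rv x y)).
Proof.
move=> /= JG; apply: (@jmeas_comp _ _ (Z * mR)%type _ Z _ (fun z => (z, x))) JG.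
by apply: measurable_fun_pair => //; exact: measurable_cst.
Qed.

Lemma jmeas_slice n dZ (Z : measurableType dZ) (G : Z -> 'rV[R]_n.+1 -> \bar R) z :
  jmeas G -> jmeas (fun (x : mR) y => G z (rcons_rv x y)).
Proof.
move=> /= JG; apply: (@jmeas_comp _ _ (Z * mR)%type _ mR _ (fun x => (z, x))) JG.
by apply: measurable_fun_pair => //; exact: measurable_cst.
Qed.

Lemma tonelli_cell dZ (Z : measurableType dZ) (mu : {sigma_finite_measure set Z -> \bar R})
    (H : Z * mR -> \bar R) (D : set R) : measurable D ->
  measurable_fun setT H -> (forall z, 0 <= H z) ->
  \int[mu]_z \int[leb]_(x in D) H (z, x) = \int[leb]_(x in D) \int[mu]_z H (z, x).
Proof.
move=> mD mH H0.
have mHD : measurable_fun setT (H \_ (setT `*` D)).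
  by apply/(measurable_restrictT _ _).1 => //; [exact: measurableX|exact: measurable_funS mH].
have HD0 z : 0 <= (H \_ (setT `*` D)) z by rewrite /patch; case: ifP.
have E z x : (H \_ (setT `*` D)) (z, x) = ((fun x => H (z, x)) \_ D) x.
  by rewrite /patch; congr (if _ then _ else _); apply/idP/idP; rewrite !inE //= => -[].
have := fubini_tonelli (m1 := mu) (m2 := leb) _ mHD HD0.
under eq_integral do under eq_integral do rewrite E.
under eq_integral do rewrite -integral_mkcond.
move=> ->; rewrite [RHS]integral_mkcond; apply: eq_integral => x _.
under eq_integral do rewrite E.
by rewrite /patch; case: ifPn => // xD; rewrite integral0_eq.
Qed.

Lemma tonelli_torus n dZ (Z : measurableType dZ)
    (mu : {sigma_finite_measure set Z -> \bar R}) (G : Z -> 'rV[R]_n -> \bar R) :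
  jmeas G -> (forall z x, 0 <= G z x) ->
  \int[mu]_z torus_integral L (G z) = torus_integral L (fun x => \int[mu]_z G z x).
Proof.
elim: n G => [//|n IH] G JG G0.
transitivity (\int[leb]_(x in `[0%R, L]) \int[mu]_z torus_integral L (fun y => G z (rcons_rv x y))); last first.
  apply: eq_integral => x _.
  by rewrite (IH (fun z y => G z (rcons_rv x y)))//; exact: jmeas_section.
apply: (@tonelli_cell _ _ mu (fun zx => torus_integral L (fun y => G zx.1 (rcons_rv zx.2 y)))).
- exact: measurable_itv.
- exact: (jmeas_torus_integral (JG : jmeas (fun (zx : Z * mR) y => G zx.1 (rcons_rv zx.2 y)))).
- by move=> z; apply: torus_integral_ge0.
Qed.

Lemma ge0_torus_integralD n dZ (Z : measurableType dZ) (f g : Z -> 'rV[R]_n -> \bar R) z :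
  jmeas f -> jmeas g -> (forall z x, 0 <= f z x) -> (forall z x, 0 <= g z x) ->
  torus_integral L (fun x => f z x + g z x) = torus_integral L (f z) + torus_integral L (g z).
Proof.
elim: n dZ Z f g z => [//|n IH] dZ Z f g z Jf Jg f0 g0 /=.
under eq_integral => x _.
  rewrite (IH _ _ (fun (x : mR) y => f z (rcons_rv x y)) (fun x y => g z (rcons_rv x y)))//.
  - over.
  - exact: jmeas_slice.
  - exact: jmeas_slice.
rewrite ge0_integralD//.
- by move=> x _; exact: torus_integral_ge0.
- exact: measurable_funTS (jmeas_torus_integral (jmeas_slice z Jf)).
- by move=> x _; exact: torus_integral_ge0.
- exact: measurable_funTS (jmeas_torus_integral (jmeas_slice z Jg)).
Qed.

Lemma ge0_torus_integralZl n dZ (Z : measurableType dZ) (f : Z -> 'rV[R]_n -> \bar R) z (k : R) :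
  jmeas f -> (forall z x, 0 <= f z x) -> (0 <= k)%R ->
  torus_integral L (fun x => k%:E * f z x) = k%:E * torus_integral L (f z).
Proof.
move=> + + k0; elim: n dZ Z f z => [//|n IH] dZ Z f z Jf f0 /=.
under eq_integral => x _.
  rewrite (IH _ _ (fun (x : mR) y => f z (rcons_rv x y)))//.
  - over.
  - exact: jmeas_slice.
rewrite ge0_integralZl_EFin//.
- by move=> x _; exact: torus_integral_ge0.
- exact: measurable_funTS (jmeas_torus_integral (jmeas_slice z Jf)).
Qed.

End cell_integral.

(** * Joint measurability from separate regularity *)

Section caratheodory.
Context {R : realType}.
Local Notation mR := (measurableTypeR R).

(** Approximating x from below by the multiples of 1/(n+1) presents f as a
    limit of functions that are piecewise constant in x. Left continuity is
    enough, and it is what survives at time 1 when the heat flow is cut off. *)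
Lemma measurable_left_continuous dZ (Z : measurableType dZ) (f : Z * mR -> R) :
  (forall x, measurable_fun setT (fun z => f (z, x))) ->
  (forall z (x e : R), 0 < e -> exists2 r : R, 0 < r &
     forall y : R, x - r < y <= x -> `|f (z, y) - f (z, x)| < e) ->
  measurable_fun setT f.
Proof.
move=> mf lf.
pose q (n : nat) (m : int) : R := m%:~R / n.+1%:R.
pose h (n : nat) (zx : Z * mR) := f (zx.1, q n (Num.floor (n.+1%:R * zx.2))).
apply: (@measurable_fun_cvg _ _ _ _ h).
  move=> n _ B mB; rewrite setTI.
  rewrite (_ : _ @^-1` _ = \bigcup_m (((fun z => f (z, q n m)) @^-1` B) `*`
      [set` `[q n m, q n (m + 1)[])); last first.
    have qle m (x : R) : (q n m <= x) = (m%:~R <= n.+1%:R * x) by rewrite ler_pdivrMr// mulrC.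
    have qgt m (x : R) : (x < q n m) = (n.+1%:R * x < m%:~R) by rewrite ltr_pdivlMr// mulrC.
    apply/seteqP; split => [[z x] /= Bf|[z x] [m _] [/= Bf]].
      exists (Num.floor (n.+1%:R * x)) => //; split => //=.
      by rewrite in_itv /= qle qgt real_floor_itv// num_real.
    rewrite in_itv /= qle qgt => /andP[H1 H2].
    by rewrite /h /= (floor_def (m := m)) ?H1.
  apply: countable_bigcupT_measurable => // m; apply: measurableX.
    by rewrite -[X in measurable X]setTI; exact: mf.
  exact: measurable_itv.
move=> [z x] _; apply/cvgrPdist_lt => e e0.
have [r r0 H] := lf z x e e0.
near=> n; rewrite distrC; apply: H.
have /andP[H1 H2] := real_floor_itv (num_real (n.+1%:R * x : R)).
apply/andP; split; last by rewrite ler_pdivrMr// [leRHS]mulrC.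
rewrite ltr_pdivlMr// mulrBl ltrBlDl.
move: H2; rewrite intrD mulr1z [ltLHS]mulrC => /lt_le_trans; apply; rewrite addrC lerD2r.
near: n; exists (Num.truncn r^-1) => // n /= rn.
rewrite -ler_pdivrMl// mulr1; apply: ltW; apply: lt_le_trans (truncnS_gt _) _.
by rewrite ler_nat.
Unshelve. all: by end_near. Qed.

Lemma continuous_left (f : R -> R) x e : {for x, continuous f} -> 0 < e ->
  exists2 r : R, 0 < r & forall y : R, x - r < y <= x -> `|f y - f x| < e.
Proof.
move=> /cvgrPdist_lt H /H /nbhs_ballP[r r0 fr]; exists r => // y /andP[y1 y2].
by rewrite distrC; apply: fr; rewrite -ball_normE /= ger0_norm ?subr_ge0// ltrBlDl -ltrBlDr.
Qed.

Lemma measurable_continuous2 dZ (Z : measurableType dZ) (f : Z -> R -> R) :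
  (forall x, measurable_fun setT (fun z => f z x)) ->
  (forall z, continuous (f z)) -> measurable_fun setT (fun zx : Z * mR => f zx.1 zx.2).
Proof.
move=> mf cf; apply: measurable_left_continuous => //= z x e e0.
exact: (@continuous_left (f z) x e (cf z x) e0).
Qed.

Lemma continuous_rconsl n (y : 'rV[R]_n) : continuous (fun x : R => rcons_rv x y).
Proof.
move=> x; apply/cvg_ballP => e e0.
have : nbhs x (ball x e) by exact: nbhsx_ballx.
apply: filterS => z xz; split => // i j; rewrite !mxE.
by case: splitP => k _; [rewrite !mxE; exact: xz|exact: ballxx].
Qed.

Lemma continuous_rconsr n (x : R) : continuous (fun y : 'rV[R]_n => rcons_rv x y).
Proof.
move=> y; have FF : Filter (nbhs y) by exact: nbhs_filter.
apply/cvg_ballP => e e0; have nb : nbhs y (ball y e) by exact: nbhsx_ballx.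
apply: (@filterS _ (nbhs y) (nbhs_filter y) _ _ _ nb) => z [_ yz]; split => // i j; rewrite !mxE.
by case: splitP => k _; [rewrite !mxE; exact: ballxx|exact: yz].
Qed.

Lemma jmeas_continuous n dZ (Z : measurableType dZ) (G : Z -> 'rV[R]_n -> R) :
  (forall x, measurable_fun setT (fun z => G z x)) ->
  (forall z, continuous (G z)) -> jmeas (fun z x => (G z x)%:E).
Proof.
elim: n dZ Z G => [|n IH] dZ Z G mG cG /=.
  by apply/measurable_EFinP; exact: mG.
apply: (IH _ (Z * mR)%type (fun z y => G z.1 (rcons_rv z.2 y))) => [y|[z x]] /=.
  apply: (@measurable_continuous2 _ _ (fun z x => G z (rcons_rv x y))) => // z x.
  apply: (@continuous_comp _ _ _ (fun x => rcons_rv x y) (G z)); last exact: cG.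
  exact: continuous_rconsl.
move=> y; apply: (@continuous_comp _ _ _ (fun y => rcons_rv x y) (G z)); last exact: cG.
exact: continuous_rconsr.
Qed.

(** ** Bounded functions of any sign *)

Lemma torus_integral_bounded (L : R) n (f : 'rV[R]_n -> R) (M : R) : 0 <= L ->
  (forall x, in_cell L x -> `|f x| <= M) ->
  (`|torus_integral L (fun x => (f x)%:E)| <= (M * L ^+ n)%:E)%E.
Proof.
move=> L0 fM; set t := torus_integral _ _.
have lo : ((- (M * L ^+ n))%:E <= t)%E.
  rewrite -mulNr -torus_integral_cst//; apply: torus_integral_mono => x /fM.
  by rewrite lee_fin ler_norml => /andP[].
have : (t <= (M * L ^+ n)%:E)%E.
  rewrite -torus_integral_cst//; apply: torus_integral_mono => x /fM.
  by rewrite lee_fin ler_norml => /andP[].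
by case: t lo => //= r; rewrite !lee_fin ler_norml => -> ->.
Qed.

Lemma torus_integral_fin_num (L : R) n (f : 'rV[R]_n -> R) (M : R) : 0 <= L ->
  (forall x, in_cell L x -> `|f x| <= M) ->
  torus_integral L (fun x => (f x)%:E) \is a fin_num.
Proof.
move=> L0 /(torus_integral_bounded L0) H.
by rewrite fin_num_abs (le_lt_trans H)// ltry.
Qed.

Lemma torus_integral_linear (L : R) n dZ (Z : measurableType dZ) (z : Z)
    (f g : Z -> 'rV[R]_n -> R) (a M : R) : 0 <= L ->
  jmeas (fun z x => (f z x)%:E) -> jmeas (fun z x => (g z x)%:E) ->
  (forall x, in_cell L x -> `|f z x| <= M) -> (forall x, in_cell L x -> `|g z x| <= M) ->
  torus_integral L (fun x => (a * f z x + g z x)%:E) =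
  (a%:E * torus_integral L (fun x => (f z x)%:E) + torus_integral L (fun x => (g z x)%:E))%E.
Proof.
move=> L0; elim: n dZ Z z f g => [//|n IH] dZ Z z f g Jf Jg fM gM.
have I (h : Z -> 'rV[R]_n.+1 -> R) : jmeas (fun z x => (h z x)%:E) ->
    (forall x, in_cell L x -> `|h z x| <= M) ->
    (@lebesgue_measure R).-integrable `[0, L]
      (fun x : mR => torus_integral L (fun y => (h z (rcons_rv x y))%:E)).
  move=> Jh hM; pose q x := fine (torus_integral L (fun y => (h z (rcons_rv x y))%:E)).
  have qE x : 0 <= x <= L -> torus_integral L (fun y => (h z (rcons_rv x y))%:E) = (q x)%:E.
    move=> x0L; rewrite fineK//; apply: (torus_integral_fin_num (M := M) L0) => y y0L.
    by apply: hM; exact: in_cell_rcons.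
  have mt := jmeas_torus_integral L (jmeas_slice z Jh).
  have mD : measurable (`[0, L]%classic : set mR) by exact: measurable_itv.
  apply: (eq_integrable mD (EFin \o (q : mR -> R))).
    by move=> x; rewrite inE /= in_itv /= => /qE ->.
  apply: (measurable_bounded_integrable mD).
  - rewrite /= lebesgue_measure_itv /=; by case: ifP => // _; rewrite -EFinD ltry.
  - apply/measurable_EFinP; apply: eq_measurable_fun (measurable_funTS mt) => x.
    by rewrite inE /= in_itv /= => /qE.
  - exists (M * L ^+ n); split; first by rewrite num_real.
    move=> r Mr x /=; rewrite in_itv /= => x0L; apply: le_trans (ltW Mr).
    rewrite -lee_fin -abse_EFin -qE//; apply: torus_integral_bounded => // y y0L.
    by apply: hM; exact: in_cell_rcons.
rewrite !torus_integralS -integralZl//; last exact: I.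
rewrite -integralD//; last exact: I.
  apply: eq_integral => x; rewrite inE /= in_itv /= => x0L.
  rewrite (IH _ _ x (fun x y => f z (rcons_rv x y)) (fun x y => g z (rcons_rv x y)))//.
  - exact: (jmeas_slice z Jf).
  - exact: (jmeas_slice z Jg).
  - by move=> y y0L; apply: fM; exact: in_cell_rcons.
  - by move=> y y0L; apply: gM; exact: in_cell_rcons.
by apply: integrableZl => //; exact: I.
Qed.

End caratheodory.

(** * Heat kernels as test functions *)

Section kernels.
Context {R : realType} {d : nat} {L : R}.
Hypothesis L0 : 0 < L.
Local Notation TF := (testfun d L).
Implicit Types (phi psi : TF) (x y z : 'rV[R]_d) (s r : R).

Definition hk s x : TF := insubd (0 : TF) (fun y => heat_kernel L s (x - y)).

Lemma heatE (f : TF -> R^o) s x : heat f s x = f (hk s x).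
Proof. by []. Qed.

Lemma heat_kernel_smooth s x : 0 < s ->
  (fun y => heat_kernel L s (x - y)) \in @smooth_periodic R d L.
Proof.
move=> s0; apply/asboolP; split.
  rewrite (_ : (fun y => _) = fun y => \prod_i heat1 L s (x 0 i - y 0 i)); last first.
    by apply/funext => y; rewrite heat_kernelE//; apply: eq_bigr => i _; rewrite !mxE.
  apply: smooth_expr_smooth; apply: SE_prod => i.
  apply: (@SE_heat1 _ _ L0 d s (fun y => x 0 i - y 0 i)) => //.
  rewrite (_ : (fun y => _) = cst (x 0 i) + cst (-1) * (fun y => y 0 i)).
    by apply: SE_add; [exact: SE_cst|apply: SE_mul; [exact: SE_cst|exact: SE_coord]].
  by apply/funext => y; rewrite !fctE mulN1r.
move=> i y; rewrite (heat_kernelE L0 _ s0) (heat_kernelE L0 _ s0); apply: eq_bigr => j _.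
have [->|ji] := eqVneq j i.
  rewrite -[RHS](heat1_periodic L _ (-1) s0); congr (heat1 _ _ _).
  by rewrite !mxE mulrN1z !eqxx mulr1; ring.
by rewrite !mxE (negbTE ji) andbF mulr0 addr0.
Qed.

Lemma hkE s x y : 0 < s -> hk s x y = \prod_i heat1 L s (x 0 i - y 0 i).
Proof.
move=> s0; rewrite /hk -[testfun_val _]/(val _) insubdK; last exact: heat_kernel_smooth.
by rewrite heat_kernelE//; apply: eq_bigr => i _; rewrite !mxE.
Qed.

(* Unfolding a kernel exposes the theta series to conversion. *)
#[local] Opaque hk.

Lemma hk_ge0 s x y : 0 < s -> 0 <= hk s x y.
Proof. by move=> s0; rewrite hkE// prodr_ge0// => i _; exact/ltW/heat1_gt0. Qed.

Lemma hk_periodic s x (k : 'rV[int]_d) : 0 < s ->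
  hk s (x + \row_i (L * (k 0 i)%:~R)) = hk s x.
Proof.
move=> s0; apply: val_inj.
have H y : hk s (x + \row_i (L * (k 0 i)%:~R)) y = hk s x y.
  transitivity (\prod_i heat1 L s ((x + \row_i (L * (k 0 i)%:~R)) 0 i - y 0 i)).
    exact: hkE.
  rewrite (hkE x y s0); apply: eq_bigr => i _.
  by rewrite mxE mxE addrAC heat1_periodic.
exact: (funext H).
Qed.

Lemma hk_move s r x y z : 0 < s -> 2 * s <= r <= 4 * s ->
  (forall i, (y 0 i - x 0 i) ^+ 2 <= s) -> hk s x z <= (2 * expR 1) ^+ d * hk r y z.
Proof.
move=> s0 sr xy; have r0 : 0 < r by case/andP: sr => + _; apply: lt_le_trans; rewrite mulr_gt0.
have cd (c : R) : c ^+ d = \prod_(i < d) c by rewrite prodr_const card_ord.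
rewrite !hkE// cd -big_split /=.
apply: ler_prod => i _; rewrite ltW ?heat1_gt0//=; apply: heat1_move => //.
have -> : y 0 i - z 0 i - (x 0 i - z 0 i) = y 0 i - x 0 i by ring.
exact: xy.
Qed.

Lemma hk_quarter s x z : 4^-1 <= s <= 1 -> hk s x z <= quarter_bound L ^+ d * hk 4^-1 x z.
Proof.
move=> s4; have s0 : 0 < s by case/andP: s4 => + _; exact: lt_le_trans.
have cd (c : R) : c ^+ d = \prod_(i < d) c by rewrite prodr_const card_ord.
rewrite !hkE// cd -big_split /=.
by apply: ler_prod => i _; rewrite ltW ?heat1_gt0//= heat1_quarter.
Qed.

(** * Continuity of the heat kernel in time and space *)

Lemma continuous_psum (c : R^nat) : rapid c -> continuous (psum c).
Proof.
move=> rc t; apply: differentiable_continuous; apply/derivable1_diffP.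
by have [] := is_derive_psum t rc.
Qed.

Lemma continuous_theta b : 0 < b -> continuous (theta L b).
Proof.
move=> b0; rewrite (_ : theta L b = fun v => thetap L b v + thetan L b v); last first.
  by apply/funext => v; rewrite thetaE.
have bL : 0 < b * L ^+ 2 by rewrite mulr_gt0// exprn_gt0.
have rp := rapid_gauss bL; have rn := rapid_shift rp.
have cE (h : R -> R) : continuous h -> continuous (fun v => expR (h v)).
  by move=> ch t; apply: continuous_comp (ch t) _; exact: continuous_expR.
have cl (k : R) : continuous (fun v : R => k * v).
  by move=> t; apply: cvgM; [exact: cvg_cst|exact: cvg_id].
have cN (h : R -> R) : continuous h -> continuous (fun v => - h v).
  by move=> ch t; apply: cvgN; exact: ch.
have cM (h k : R -> R) : continuous h -> continuous k -> continuous (fun v => h v * k v).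
  by move=> ch ck t; apply: cvgM; [exact: ch|exact: ck].
have cP c (h : R -> R) : rapid c -> continuous h -> continuous (fun v => psum c (h v)).
  by move=> rc ch t; apply: continuous_comp (ch t) _; exact: continuous_psum.
have cG : continuous (fun v : R => expR (- (b * v ^+ 2))).
  apply/cE/cN; apply: cM; first by move=> t; exact: cvg_cst.
  by move=> t; exact: exprn_continuous.
have Hp : continuous (fun v => thetap L b v).
  apply: (cM); [exact: cG|apply: (cP _ (fun v => expR (- (2 * b * L * v))) rp)].
  exact/cE/cN/cl.
have Hn : continuous (fun v => thetan L b v).
  apply: (cM); [exact: cG|apply: (cM)]; first exact/cE/cl.
  by apply: (cP _ (fun v => expR (2 * b * L * v)) rn); exact/cE/cl.
by move=> t; apply: cvgD; [exact: Hp|exact: Hn].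
Qed.

Lemma theta_joint (b0 y0 : R) : 0 < b0 ->
  (fun q : R * R => theta L q.1 q.2) @ (b0, y0) --> theta L b0 y0.
Proof.
move=> b0p; apply/cvgrPdist_lt => e e0.
set K := 2 / (b0 / 2) * theta_bound L (b0 / 2 / 2).
have K0 : 0 <= K by rewrite /K mulr_ge0 ?divr_ge0 ?divr_ge0 ?(ltW b0p)//
  (le_trans _ (theta_le_bound L0 0 _)) ?theta_ge0 ?divr_gt0.
have e2 : 0 < e / 2 by rewrite divr_gt0.
have H1 : \forall y \near y0, `|theta L b0 y0 - theta L b0 y| < e / 2.
  by have /cvgrPdist_lt/(_ _ e2) := @continuous_theta _ b0p y0.
have H2 : \forall b \near b0, `|b0 - b| < Num.min (b0 / 2) (e / 2 / (K + 1)).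
  have /cvgrPdist_lt := @cvg_id _ (nbhs b0); apply.
  by rewrite lt_min !divr_gt0// ltr_wpDl.
exists ([set b | `|b0 - b| < Num.min (b0 / 2) (e / 2 / (K + 1))],
        [set y | `|theta L b0 y0 - theta L b0 y| < e / 2]) => // -[b y] [/= + Hy].
rewrite lt_min => /andP[Hb1]; rewrite ltr_pdivlMr ?ltr_wpDl// => Hb2.
have -> : theta L b0 y0 - theta L b y =
  (theta L b0 y0 - theta L b0 y) + (theta L b0 y - theta L b y) by ring.
apply: le_lt_trans (ler_normD _ _) _; rewrite [ltRHS](splitr e); apply: ltr_leD => //.
apply: le_trans (ltW Hb2); apply: le_trans (@theta_lip _ _ L0 (b0 / 2) _ _ _ _ _ _) _.
- by rewrite divr_gt0.
- by rewrite ler_pdivrMr// ler_peMr ?(ltW b0p)// ler1n.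
- by move: Hb1; rewrite ltr_norml => /andP[_]; lra.
- by rewrite -/K ler_wpM2l// lerDl.
Qed.

Lemma heat1_joint (s0 y0 : R) : 0 < s0 ->
  (fun q : R * R => heat1 L q.1 q.2) @ (s0, y0) --> heat1 L s0 y0.
Proof.
move=> s0p; have c1 : (fun q : R * R => q.1) @ (s0, y0) --> s0 by exact: cvg_fst.
have c2 : (fun q : R * R => q.2) @ (s0, y0) --> y0 by exact: cvg_snd.
rewrite /heat1; apply: cvgM.
  apply: cvgV; first by rewrite gt_eqF// sqrtr_gt0 !mulr_gt0// pi_gt0.
  apply: (@cvg_comp _ _ _ (fun q : R * R => 4 * pi * q.1) Num.sqrt _ (nbhs (4 * pi * s0))).
    by apply: cvgM => //; exact: cvg_cst.
  exact: sqrt_continuous.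
apply: (@cvg_comp _ _ _ (fun q : R * R => ((4 * q.1)^-1, q.2)) (fun q => theta L q.1 q.2) _
  (nbhs ((4 * s0)^-1, y0))).
  have c3 : (fun q : R * R => (4 * q.1)^-1) @ (s0, y0) --> (4 * s0)^-1.
    apply: cvgV; first by rewrite mulf_neq0// gt_eqF.
    by apply: cvgM => //; exact: cvg_cst.
  exact: (cvg_pair c3 c2).
by apply: theta_joint; rewrite invr_gt0 mulr_gt0.
Qed.

Lemma cvg_prod_seq (T : Type) (F : set_system T) {FF : Filter F} (I : Type) (l : seq I)
    (f : I -> T -> R) (a : I -> R) :
  (forall i, f i @ F --> a i) -> (fun t => \prod_(i <- l) f i t) @ F --> \prod_(i <- l) a i.
Proof.
move=> fa; elim: l => [|i l IH].
  by rewrite big_nil; under eq_fun do rewrite big_nil; exact: cvg_cst.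
by rewrite big_cons; under eq_fun do rewrite big_cons; exact: cvgM.
Qed.

Lemma kernel_joint s0 x0 y0 : 0 < s0 ->
  (fun q : 'rV[R]_d * (R * 'rV[R]_d) =>
     \prod_i heat1 L q.2.1 (q.2.2 0 i - q.1 0 i)) @ (y0, (s0, x0)) -->
  \prod_i heat1 L s0 (x0 0 i - y0 0 i).
Proof.
move=> s0p; apply: cvg_prod_seq => i.
have c1 : (fun q : 'rV[R]_d * (R * 'rV[R]_d) => q.1) @ (y0, (s0, x0)) --> y0 by exact: cvg_fst.
have c2 : (fun q : 'rV[R]_d * (R * 'rV[R]_d) => q.2) @ (y0, (s0, x0)) --> (s0, x0) by exact: cvg_snd.
have c21 : (fun q : 'rV[R]_d * (R * 'rV[R]_d) => q.2.1) @ (y0, (s0, x0)) --> s0.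
  by apply: (cvg_comp _ _ c2); exact: cvg_fst.
have c22 : (fun q : 'rV[R]_d * (R * 'rV[R]_d) => q.2.2) @ (y0, (s0, x0)) --> x0.
  by apply: (cvg_comp _ _ c2); exact: cvg_snd.
apply: (@cvg_comp _ _ _ (fun q : 'rV[R]_d * (R * 'rV[R]_d) => (q.2.1, q.2.2 0 i - q.1 0 i))
  (fun q => heat1 L q.1 q.2) _ (nbhs (s0, x0 0 i - y0 0 i))).
  have c3 : (fun q : 'rV[R]_d * (R * 'rV[R]_d) => q.2.2 0 i - q.1 0 i) @ (y0, (s0, x0)) -->
      x0 0 i - y0 0 i.
    apply: cvgB.
      exact: (cvg_comp _ _ c22 (@coord_continuous _ _ _ 0 i x0)).
    exact: (cvg_comp _ _ c1 (@coord_continuous _ _ _ 0 i y0)).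
  exact: (cvg_pair c21 c3).
exact: heat1_joint.
Qed.

Lemma compact_cell : compact [set x : 'rV[R]_d | in_cell L x].
Proof.
rewrite (_ : [set x | _] = [set x : 'rV[R]_d | forall i, `[0, L]%classic (x ord0 i)]).
  by apply: (@rV_compact R d (fun=> `[0, L]%classic)) => i; exact: segment_compact.
by apply/seteqP; split => x /= H i; have := H i; rewrite /= in_itv.
Qed.

(** By compactness of the cell, joint continuity is uniform in y. *)
Lemma kernel_joint_cell (s0 : R) x0 (e : R) : 0 < s0 -> 0 < e ->
  \forall q \near nbhs (s0, x0), forall y, in_cell L y ->
    `|\prod_i heat1 L s0 (x0 0 i - y 0 i) -
      \prod_i heat1 L q.1 ((q.2 : 'rV[R]_d) 0 i - y 0 i)| < e.
Proof.
move=> s0p e0; have e2 : 0 < e / 2 by rewrite divr_gt0.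
pose K s x y := \prod_i heat1 L s (x 0 i - y 0 i).
pose Q (q : R * 'rV[R]_d) y := `|K s0 x0 y - K q.1 q.2 y| < e.
have /compact_near_coveringP/(_ _ (nbhs (s0, x0)) Q _) := compact_cell; apply.
move=> y0 _.
have HQ : \forall y \near y0 & q \near (s0, x0), `|K s0 x0 y0 - K q.1 q.2 y| < e / 2.
  by have /cvgrPdist_lt/(_ _ e2) := @kernel_joint s0 x0 y0 s0p.
have Hs : \forall y \near y0, `|K s0 x0 y0 - K s0 x0 y| < e / 2.
  move: HQ => [[A B] /= [yA sB] AB]; apply: filterS yA => y Ay.
  by apply: (AB (y, (s0, x0))); split => //; exact: nbhs_singleton.
move: HQ => [[A B] /= [yA sB] AB].
exists (A `&` [set y | `|K s0 x0 y0 - K s0 x0 y| < e / 2], B).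
  by split => //=; exact: filterI.
move=> [y q] [[/= Ay Hy] Bq]; rewrite /Q.
have -> : K s0 x0 y - K q.1 q.2 y = (K s0 x0 y0 - K q.1 q.2 y) - (K s0 x0 y0 - K s0 x0 y) by ring.
apply: le_lt_trans (ler_normB _ _) _; rewrite [ltRHS](splitr e); apply: ltrD => //.
exact: (AB (y, q)).
Qed.

End kernels.

Arguments hk {R d} L s x.

(** * Smooth functions as distributions *)

#[local] Opaque hk heat1.

Section embedding.
Context {R : realType} {d : nat} {L : R}.
Hypothesis L0 : 0 < L.
Local Notation TF := (testfun d L).
Implicit Types (phi psi : TF) (x y z : 'rV[R]_d) (s r : R).

Lemma testfun_smooth phi : torus_smooth phi /\ @torus_periodic _ _ L phi.
Proof. by apply/asboolP; case: phi. Qed.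

Lemma testfun_continuous phi : continuous (phi : 'rV[R]_d -> R).
Proof.
move=> x; apply: differentiable_continuous.
by have [/(_ [::] x) H _] := testfun_smooth phi; exact: H.
Qed.

Lemma continuous_cell_bounded (f : 'rV[R]_d -> R) : continuous f ->
  exists2 M : R, 0 <= M & forall x, in_cell L x -> `|f x| <= M.
Proof.
move=> cf; have cP := @compact_cell R d L; move/compact_near_coveringP : cP.
move=> /(_ R (pinfty_nbhs R) (fun M x => `|f x| <= M) _).
have H x : [set x : 'rV[R]_d | in_cell L x] x ->
    \forall x' \near x & M \near pinfty_nbhs R, `|f x'| <= M.
  move=> _; exists ([set y | `|f x - f y| < 1], [set M : R | `|f x| + 1 < M]).
    split => /=; last by exists (`|f x| + 1); split; [exact: num_real|].
    by have /cvgrPdist_lt/(_ _ ltr01) := cf x.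
  move=> [y M] /= [fy fM]; rewrite (_ : f y = f x - (f x - f y)); last by ring.
  apply: le_trans (ler_normB _ _) _; apply: ltW; apply: lt_trans fM.
  by rewrite ltrD2l.
move=> /(_ H) [M [_ HM]]; exists (Num.max 0 M + 1).
  by rewrite addr_ge0// le_max lexx.
move=> x xc; apply: HM => //; first by rewrite ltr_pwDr// le_max lexx orbT.
Qed.

Lemma jmeas_cst (f : 'rV[R]_d -> R) : continuous f -> jmeas (fun (_ : unit) x => (f x)%:E).
Proof. by move=> cf; apply: jmeas_continuous => // x; exact: measurable_cst. Qed.

Lemma continuous_mulr (f g : 'rV[R]_d -> R) : continuous f -> continuous g ->
  continuous (fun x => f x * g x).
Proof. by move=> cf cg x; exact: (cvgM (cf x) (cg x)). Qed.

Definition cell_int (f : 'rV[R]_d -> R) : R := fine (torus_integral L (fun x => (f x)%:E)).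

Lemma embedE phi psi : embed phi psi = cell_int (fun x => phi x * psi x).
Proof. by []. Qed.

Lemma cell_int_linear (f g : 'rV[R]_d -> R) a : continuous f -> continuous g ->
  cell_int (fun x => a * f x + g x) = a * cell_int f + cell_int g.
Proof.
move=> cf cg; have [M M0 fM] := continuous_cell_bounded cf.
have [N N0 gN] := continuous_cell_bounded cg.
have fM' x : in_cell L x -> `|f x| <= Num.max M N by move=> /fM H; rewrite le_max H.
have gM' x : in_cell L x -> `|g x| <= Num.max M N by move=> /gN H; rewrite le_max H orbT.
have LL := ltW L0.
rewrite /cell_int (@torus_integral_linear R L d _ unit tt (fun=> f) (fun=> g) a _ LL
  (jmeas_cst cf) (jmeas_cst cg) fM' gM').
have F := torus_integral_fin_num LL fM'; have G := torus_integral_fin_num LL gM'.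
by rewrite fineD ?fineM// fin_numM.
Qed.

Lemma cell_int_bound (f : 'rV[R]_d -> R) M : (forall x, in_cell L x -> `|f x| <= M) ->
  `|cell_int f| <= M * L ^+ d.
Proof.
move=> fM; have := torus_integral_bounded (ltW L0) fM.
rewrite -lee_fin /cell_int -(fineK (torus_integral_fin_num (ltW L0) fM)) /=.
by rewrite lee_fin.
Qed.

Lemma cell_int_sub (f g : 'rV[R]_d -> R) M : continuous f -> continuous g ->
  (forall x, in_cell L x -> `|f x - g x| <= M) -> `|cell_int f - cell_int g| <= M * L ^+ d.
Proof.
move=> cf cg fgM; rewrite (_ : _ - _ = cell_int (fun x => -1 * g x + f x)); last first.
  by rewrite cell_int_linear// mulN1r addrC.
by apply: cell_int_bound => x xc; rewrite mulN1r addrC; exact: fgM.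
Qed.

Lemma le_cell_int (f g : 'rV[R]_d -> R) : continuous f -> continuous g ->
  (forall x, in_cell L x -> f x <= g x) -> cell_int f <= cell_int g.
Proof.
move=> cf cg fg; have [M M0 fM] := continuous_cell_bounded cf.
have [N N0 gN] := continuous_cell_bounded cg; have LL := ltW L0.
apply: fine_le; rewrite ?(torus_integral_fin_num LL fM) ?(torus_integral_fin_num LL gN)//.
by apply: torus_integral_mono => x /fg; rewrite lee_fin.
Qed.

Lemma embed_linear phi : linear (embed phi : TF -> R^o).
Proof.
move=> a psi1 psi2; have c1 := continuous_mulr (@testfun_continuous phi) (@testfun_continuous psi1).
have c2 := continuous_mulr (@testfun_continuous phi) (@testfun_continuous psi2).
apply: etrans (cell_int_linear a c1 c2); rewrite embedE; congr cell_int.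
apply/funext => x; rewrite -[testfun_val (a *: psi1 + psi2) x]/(a * psi1 x + psi2 x).
by rewrite mulrDr mulrCA.
Qed.

Lemma embed_distribution phi : is_distribution (embed phi).
Proof.
split; first exact: embed_linear.
have [M M0 fM] := continuous_cell_bounded (@testfun_continuous phi).
exists (M * L ^+ d), 0%N => psi N psiN; rewrite embedE mulrAC.
apply: cell_int_bound => x xc; rewrite normrM ler_pM// ?fM//.
exact: (psiN [::]).
Qed.

Lemma embed_in_Cneg alpha phi : in_Cneg alpha (embed phi).
Proof.
split; first exact: embed_distribution.
by move=> e e0; exists phi; rewrite besov0// => psi /=; rewrite subrr.
Qed.

Definition Cneg_embed alpha phi : Cneg d L alpha := MkCneg (embed_in_Cneg alpha phi).

Lemma cst_smooth (c : R) : (cst c : 'rV[R]_d -> R^o) \in @smooth_periodic R d L.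
Proof. by apply/asboolP; split => //; apply/smooth_expr_smooth/SE_cst. Qed.

Definition cst_testfun (c : R) : TF := TestFun (cst_smooth c).

Lemma embed_le phi psi : (forall x, in_cell L x -> phi x <= psi x) ->
  distr_le (embed phi) (embed psi).
Proof.
move=> le_pp chi chi0; rewrite !embedE.
apply: le_cell_int; try exact/continuous_mulr/testfun_continuous/testfun_continuous.
by move=> x xc; rewrite ler_wpM2r// le_pp.
Qed.

Lemma embed_between phi : exists n : nat, forall m : nat, (n <= m)%N ->
  distr_le (embed (cst_testfun (- m%:R))) (embed phi) /\
  distr_le (embed phi) (embed (cst_testfun m%:R)).
Proof.
have [M M0 fM] := continuous_cell_bounded (@testfun_continuous phi).
exists (Num.truncn M).+1 => m Mm.
have Mm' : M <= m%:R by apply: le_trans (ltW (truncnS_gt M)) _; rewrite ler_nat.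
split; apply: embed_le => x /fM; rewrite ler_norml => /andP[H1 H2] /=.
  by apply: le_trans H1; rewrite lerN2.
exact: le_trans Mm'.
Qed.

(** * Regularity of the heat flow of a distribution *)

Lemma heat_le_besov alpha (f : TF -> R^o) s x : 0 < s <= 1 ->
  ((s `^ (alpha / 2) * `|heat f s x|)%:E <= besov_norm alpha f)%E.
Proof.
move=> s01; apply: (@le_trans _ _ ((s `^ (alpha / 2))%:E * Loo_norm (heat f s))%E).
  rewrite EFinM lee_wpmul2l ?lee_fin ?powR_ge0//.
  by apply: ereal_sup_ubound; exists x.
by apply: ereal_sup_ubound; exists s => //=; rewrite in_itv.
Qed.

Lemma heat_embed_near phi (s0 : R) x0 (e : R) : 0 < s0 -> 0 < e ->
  \forall q \near nbhs (s0, x0), `|heat (embed phi) s0 x0 - heat (embed phi) q.1 q.2| < e.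
Proof.
move=> s0p e0; have [M M0 fM] := continuous_cell_bounded (@testfun_continuous phi).
have ML : 0 < M * L ^+ d + 1 by rewrite ltr_wpDl// mulr_ge0// exprn_ge0// ltW.
have e1 : 0 < e / (M * L ^+ d + 1) by rewrite divr_gt0.
have H2 : \forall q \near nbhs (s0, x0), 0 < q.1.
  exists ([set s | 0 < s], setT) => /=; first by split; [exact: lt_nbhsr|exact: filterT].
  by move=> [s x] /= [].
have H3 := @kernel_joint_cell R d L L0 s0 x0 _ s0p e1.
near=> q; have q0 : 0 < q.1 by near: q.
have Hk : forall y, in_cell L y -> `|\prod_i heat1 L s0 (x0 0 i - y 0 i) -
    \prod_i heat1 L q.1 ((q.2 : 'rV[R]_d) 0 i - y 0 i)| < e / (M * L ^+ d + 1).
  by near: q; exact: H3.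
have Hq : forall y : 'rV[R]_d, in_cell L y -> `|hk L s0 x0 y - hk L q.1 q.2 y| <= e / (M * L ^+ d + 1).
  move=> y yc; have E := f_equal2 (fun a b : R => `|a - b|) (hkE L0 x0 y s0p) (hkE L0 q.2 y q0).
  exact: (eq_ind_r (fun t => t <= _) (ltW (Hk y yc)) E).
rewrite !heatE !embedE; apply: le_lt_trans (_ : M * (e / (M * L ^+ d + 1)) * L ^+ d < e).
  apply: cell_int_sub; try exact/continuous_mulr/testfun_continuous/testfun_continuous.
  by move=> x xc; rewrite -mulrBr normrM ler_pM ?fM ?Hq.
rewrite mulrAC mulrA ltr_pdivrMr// mulrC ltr_pM2l//; lra.
Unshelve. all: by end_near. Qed.

(** Density of smooth functions transfers continuity in time and space from the
    kernel to every element of the space. The norm only sees the times up to 1,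
    so the approximation is uniform on [s0 / 2, 1] only. *)
Lemma heat_near alpha (f : TF -> R^o) (s0 : R) x0 (e : R) : 0 <= alpha -> in_Cneg alpha f ->
  0 < s0 -> 0 < e ->
  \forall q \near nbhs (s0, x0), q.1 <= 1 -> s0 <= 1 ->
     `|heat f s0 x0 - heat f q.1 q.2| < e.
Proof.
move=> a0 [_ fd] s0p e0; set w := (s0 / 2) `^ (alpha / 2).
have w0 : 0 < w by apply: powR_gt0; rewrite divr_gt0.
have e4 : 0 < e / 4 * w by rewrite !mulr_gt0.
have [phi fphi] := fd _ e4.
have H s x : s0 / 2 <= s -> s <= 1 -> `|heat f s x - heat (embed phi) s x| <= e / 4.
  move=> s2 s1; have sp : 0 < s by apply: lt_le_trans s2; rewrite divr_gt0.
  have s01 : 0 < s <= 1 by rewrite sp.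
  rewrite -(ler_pM2l w0) [leRHS]mulrC.
  have := le_lt_trans (heat_le_besov alpha (f \- embed phi) x s01) fphi.
  rewrite lte_fin => /ltW; apply: le_trans; rewrite ler_wpM2r//.
  by rewrite ge0_ler_powR ?nnegrE ?divr_ge0 ?(ltW s0p) ?(ltW sp)//.
have e4' : 0 < e / 4 by rewrite divr_gt0.
have H2 : \forall q \near nbhs (s0, x0), s0 / 2 <= q.1.
  exists ([set s | s0 / 2 < s], setT) => /=.
    by split; [apply: lt_nbhsr; rewrite ltr_pdivrMr// ltr_pMr// ltr1n|exact: filterT].
  by move=> [s x] /= [/ltW].
near=> q => q1 s01.
have q2 : s0 / 2 <= q.1 by near: q.
have Hq : `|heat (embed phi) s0 x0 - heat (embed phi) q.1 q.2| < e / 4.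
  by near: q; exact: heat_embed_near.
have s02 : s0 / 2 <= s0 by rewrite ler_pdivrMr// ler_peMr ?(ltW s0p)// ler1n.
have Ha := H q.1 q.2 q2 q1; have Hb := H s0 x0 s02 s01.
move: Ha Hb Hq; rewrite !ler_norml !ltr_norml => /andP[? ?] /andP[? ?] /andP[? ?].
apply/andP; split; lra.
Unshelve. all: by end_near. Qed.

End embedding.

(** * Measurability of the heat flow on the space of distributions *)

Section space_time_integral.
Local Open Scope ereal_scope.
Context {R : realType} {d : nat} (L : R).
Local Notation mR := (measurableTypeR R).
Local Notation leb := (@lebesgue_measure R).

Definition st_int (H : R -> 'rV[R]_d -> \bar R) : \bar R :=
  \int[leb]_(s in `]0%R, 1%R]) torus_integral L (H s).

Definition st_meas dZ (Z : measurableType dZ) (H : Z -> R -> 'rV[R]_d -> \bar R) :=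
  jmeas (fun (zs : Z * mR) x => H zs.1 zs.2 x).

Lemma st_meas_slice dZ (Z : measurableType dZ) (H : Z -> R -> 'rV[R]_d -> \bar R) z :
  st_meas H -> jmeas (fun (s : mR) x => H z s x).
Proof.
apply: (@jmeas_comp _ _ _ (Z * mR)%type _ mR _ (fun s => (z, s))).
by apply: measurable_fun_pair => //; exact: measurable_cst.
Qed.

Lemma st_meas_section dZ (Z : measurableType dZ) (H : Z -> R -> 'rV[R]_d -> \bar R) s :
  st_meas H -> jmeas (fun z x => H z s x).
Proof.
apply: (@jmeas_comp _ _ _ (Z * mR)%type _ Z _ (fun z => (z, s))).
by apply: measurable_fun_pair => //; exact: measurable_cst.
Qed.

Lemma measurable_st_int dZ (Z : measurableType dZ) (H : Z -> R -> 'rV[R]_d -> \bar R) :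
  st_meas H -> measurable_fun setT (fun z => st_int (H z)).
Proof.
move=> mH; exact: (measurable_cell_section (measurable_itv _) (jmeas_torus_integral L mH)).
Qed.

Lemma tonelli_st_int dZ (Z : measurableType dZ) (mu : {sigma_finite_measure set Z -> \bar R})
    (H : Z -> R -> 'rV[R]_d -> \bar R) :
  st_meas H -> (forall z s x, 0 <= H z s x) ->
  \int[mu]_z st_int (H z) = st_int (fun s x => \int[mu]_z H z s x).
Proof.
move=> mH H0.
rewrite (tonelli_cell mu (measurable_itv _) (jmeas_torus_integral L mH)); last first.
  by move=> z; apply: torus_integral_ge0.
apply: eq_integral => s _ /=.
rewrite (tonelli_torus L mu (G := fun z x => H z s x))//.
exact: st_meas_section.
Qed.

Lemma st_int_ge0 (H : R -> 'rV[R]_d -> \bar R) : (forall s x, 0 <= H s x) -> 0 <= st_int H.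
Proof. by move=> H0; apply: integral_ge0 => s _; apply: torus_integral_ge0. Qed.

Lemma st_int_mono (H K : R -> 'rV[R]_d -> \bar R) :
  (forall s x, (0 < s <= 1)%R -> H s x <= K s x) -> st_int H <= st_int K.
Proof.
move=> HK; apply: integral_mono => s /=; rewrite in_itv /= => s01.
by apply: torus_integral_mono => x _; exact: HK.
Qed.

Lemma st_intD dZ (Z : measurableType dZ) (H K : Z -> R -> 'rV[R]_d -> \bar R) z :
  st_meas H -> st_meas K -> (forall z s x, 0 <= H z s x) -> (forall z s x, 0 <= K z s x) ->
  st_int (fun s x => H z s x + K z s x) = st_int (H z) + st_int (K z).
Proof.
move=> mH mK H0 K0; rewrite /st_int -ge0_integralD//.
- apply: eq_integral => s _.
  by rewrite (ge0_torus_integralD L (f := fun (s : mR) x => H z s x) (g := fun s x => K z s x))//;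
    exact: st_meas_slice.
- by move=> s _; apply: torus_integral_ge0.
- exact: measurable_funTS (jmeas_torus_integral L (st_meas_slice z mH)).
- by move=> s _; apply: torus_integral_ge0.
- exact: measurable_funTS (jmeas_torus_integral L (st_meas_slice z mK)).
Qed.

Lemma st_intZl dZ (Z : measurableType dZ) (H : Z -> R -> 'rV[R]_d -> \bar R) z (k : R) :
  st_meas H -> (forall z s x, 0 <= H z s x) -> (0 <= k)%R ->
  st_int (fun s x => k%:E * H z s x) = k%:E * st_int (H z).
Proof.
move=> mH H0 k0; rewrite /st_int -ge0_integralZl_EFin//.
- apply: eq_integral => s _.
  by rewrite (ge0_torus_integralZl L (f := fun (s : mR) x => H z s x))//; exact: st_meas_slice.
- by move=> s _; apply: torus_integral_ge0.
- exact: measurable_funTS (jmeas_torus_integral L (st_meas_slice z mH)).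
Qed.

End space_time_integral.

Section borel_measurability.
Context {R : realType} {d : nat} {L alpha0 : R}.
Hypotheses (L0 : 0 < L) (alpha0_ge0 : 0 <= alpha0).
Local Notation C := (Cneg d L alpha0).
Local Notation mR := (measurableTypeR R).

Lemma heat_sub_le_ball (k l : C) s x e : 0 < s <= 1 -> Cneg_ball k e l ->
  `|heat k s x - heat l s x| < e / s `^ (alpha0 / 2).
Proof.
move=> s01 kl; have [s0 _] := andP s01.
rewrite ltr_pdivlMr ?powR_gt0// mulrC -lte_fin.
exact: le_lt_trans (heat_le_besov alpha0 _ x s01) kl.
Qed.

Lemma open_heat_gt s x (a : R) : 0 < s <= 1 -> open [set k : C | a < heat k s x].
Proof.
move=> s01; have [s0 _] := andP s01.
have w0 : 0 < s `^ (alpha0 / 2) by exact: powR_gt0.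
rewrite openE => k /= ak; apply/nbhs_ballP.
exists ((heat k s x - a) * s `^ (alpha0 / 2)) => /=; first by rewrite mulr_gt0// subr_gt0.
move=> l /(heat_sub_le_ball x s01); rewrite mulfK ?gt_eqF//.
by rewrite ltr_norml => /andP[_]; rewrite /=; lra.
Qed.

Lemma measurable_heat s x : 0 < s <= 1 ->
  measurable_fun setT (fun k : borel C => heat (k : C) s x : mR).
Proof.
move=> s01; apply: (measurability _ (RGenOInfty.measurableE R)) => //.
move=> /= _ [_ [a ->] <-]; rewrite setTI; apply: sub_sigma_algebra.
rewrite (_ : _ @^-1` _ = [set k : C | a < heat k s x]); first exact: open_heat_gt.
by apply/seteqP; split => k /=; rewrite in_itv /= andbT.
Qed.

Lemma measurable_besov alpha : measurable_fun setT (fun k : borel C => besov_norm alpha (k : C)).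
Proof.
apply: (measurability _ (ErealGenOInfty.measurableE R)) => //.
move=> /= _ [_ [a ->] <-]; rewrite setTI; apply: sub_sigma_algebra.
rewrite preimage_itvoy.
(* the norm is a supremum of continuous functions *)
rewrite openE => k /= /ereal_sup_gt[_ [s s01 <-]].
have {}s01 : 0 < s <= 1 by move: s01; rewrite /= in_itv.
have [s0 _] := andP s01; have w0 : 0 < s `^ (alpha / 2) by exact: powR_gt0.
have v0 : 0 < s `^ (alpha0 / 2) by exact: powR_gt0.
rewrite -lte_pdivrMl// => /ereal_sup_gt[_ [x _ <-]].
rewrite -EFinM lte_fin ltr_pdivrMl// => ax; apply/nbhs_ballP.
set h := `|_| in ax; pose e := (h - (s `^ (alpha / 2))^-1 * a) * s `^ (alpha0 / 2).
have e0 : 0 < e by rewrite /e mulr_gt0// subr_gt0 ltr_pdivrMl.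
exists e => //= l /(heat_sub_le_ball x s01); rewrite mulfK ?gt_eqF// => kl.
apply: lt_le_trans (heat_le_besov alpha l x s01).
rewrite lte_fin -ltr_pdivrMl//.
have : h <= `|heat l s x| + `|heat k s x - heat l s x|.
  by rewrite /h -{1}(subrK (heat l s x) (heat k s x)) addrC ler_normD.
move: kl; lra.
Qed.

(** Total in the time variable, so that joint measurability can be stated on a
    product space. *)
Definition sheat (f : testfun d L -> R^o) s x : R := if 0 < s <= 1 then heat f s x else 0.

Lemma measurable_sheat dZ (Z : measurableType dZ) (X : Z -> C) x :
  measurable_fun setT (X : Z -> borel C) ->
  measurable_fun setT (fun zs : Z * mR => sheat (X zs.1) zs.2 x).
Proof.
move=> mX.
apply: (@measurable_left_continuous _ _ _ (fun zs : Z * mR => sheat (X zs.1) zs.2 x)).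
  move=> s /=.
  rewrite /sheat; have [s01|_] := boolP (0 < s <= 1); last exact: measurable_cst.
  exact: (measurableT_comp (measurable_heat x s01) mX).
move=> z s e e0 /=; have [s0|s0] := leP s 0.
  exists 1 => // y /andP[_ ys]; rewrite /sheat.
  by rewrite !(ltNge 0) (le_trans ys s0) s0 /= subrr normr0.
have [s1|s1] := leP s 1; last first.
  exists (s - 1); rewrite ?subr_gt0// => y; rewrite subKr => /andP[y1 _].
  by rewrite /sheat !(leNgt _ 1) y1 s1 !andbF subrr normr0.
have inX : in_Cneg alpha0 (X z) by case: (X z).
have [[A B] /= [sA xB] AB] := heat_near L0 x alpha0_ge0 inX s0 e0.
have /nbhs_ballP[r r0 rA] := sA.
exists (Num.min r s) => [|y]; first by rewrite lt_min r0.
rewrite ltrBlDr -ltrBlDl lt_min => /andP[/andP[sr ss] ys].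
have y0 : 0 < y by lra.
rewrite /sheat y0 s0 s1 (le_trans ys s1) /= distrC.
have Ay : A y by apply: rA; rewrite -ball_normE /= ger0_norm ?subr_ge0.
exact: (AB (y, x) (conj Ay (nbhs_singleton xB)) (le_trans ys s1) s1).
Qed.

Lemma continuous_sheat (k : C) s : continuous (sheat k s : 'rV[R]_d -> R).
Proof.
have -> : sheat k s = if 0 < s <= 1 then heat k s else cst 0.
  by rewrite /sheat; case: ifP.
have [/andP[s0 s1]|_] := boolP (0 < s <= 1); last exact: cst_continuous.
move=> x; have FF : Filter (nbhs x) by exact: nbhs_filter.
apply/cvgrPdist_lt => e e0; have ink : in_Cneg alpha0 k by case: k.
have [[A B] /= [sA xB] AB] := heat_near L0 x alpha0_ge0 ink s0 e0.
apply: filterS xB => y By.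
exact: (AB (s, y) (conj (nbhs_singleton sA) By) s1 s1).
Qed.

(** One family covers the L^p norms of differences (j = 0) and the integrand
    (|f_s| + |g_s|)^j |f_s - g_s| that bounds a difference of powers (i = 1). *)
Definition mixed (w : R -> R) i j (f g : testfun d L -> R^o) s x : \bar R :=
  (w s * (`|sheat f s x - sheat g s x| ^+ i * (`|sheat f s x| + `|sheat g s x|) ^+ j))%:E.

Lemma mixed_ge0 w i j f g s x : (forall s, 0 <= w s) -> (0 <= mixed w i j f g s x)%E.
Proof.
by move=> w0; rewrite lee_fin mulr_ge0// mulr_ge0 ?exprn_ge0// addr_ge0.
Qed.

Lemma st_meas_mixed dZ (Z : measurableType dZ) (X Y : Z -> C) w i j :
  measurable_fun setT (X : Z -> borel C) -> measurable_fun setT (Y : Z -> borel C) ->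
  measurable_fun setT (w : mR -> mR) ->
  st_meas (fun z => mixed w i j (X z) (Y z)).
Proof.
move=> mX mY mw; apply: (@jmeas_continuous _ _ _ (Z * mR)%type) => [x|[z s]].
  have mXs := measurable_sheat x mX; have mYs := measurable_sheat x mY.
  apply: measurable_funM; first exact: (measurableT_comp mw (@measurable_snd _ _ Z mR)).
  apply: measurable_funM; apply: measurable_funX.
    apply: measurableT_comp; first exact: normr_measurable.
    exact: measurable_funB.
  by apply: measurable_funD; apply: measurableT_comp => //; exact: normr_measurable.
have cX := @continuous_sheat (X z) s; have cY := @continuous_sheat (Y z) s.
move=> x /=; have FF : Filter (nbhs x) by exact: nbhs_filter.
have cE (h : 'rV[R]_d -> R) n : h y @[y --> x] --> h x -> h y ^+ n @[y --> x] --> h x ^+ n.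
  by move=> ch; exact: (cvg_comp h (fun t => t ^+ n) ch (@exprn_continuous R n (h x))).
have c1 := cE _ i (cvg_norm (cvgB (cX x) (cY x))).
have c2 := cE _ j (cvgD (cvg_norm (cX x)) (cvg_norm (cY x))).
by apply: (cvgM (cvg_cst (w s)) (cvgM (c1 FF FF) (c2 FF FF FF))).
Qed.

End borel_measurability.

(** * Besov embedding for nonnegative distributions *)

Section boxes.
Local Open Scope ereal_scope.
Context {R : realType} (L : R).
Local Notation mR := (measurableTypeR R).
Local Notation leb := (@lebesgue_measure R).

Lemma integral_ge_sub (D : set R) (f : R -> \bar R) (a b c : R) :
  measurable (D : set mR) -> `[a, b]%classic `<=` D -> (a <= b)%R -> (0 <= c)%R ->
  (forall x, D x -> 0 <= f x) -> (forall x, (a <= x <= b)%R -> c%:E <= f x) ->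
  (c * (b - a))%:E <= \int[leb]_(x in D) f x.
Proof.
move=> mD abD ab c0 f0 fc.
have <- : \int[leb]_(x in D) ((fun=> c%:E) \_ `[a, b]) x = (c * (b - a))%:E.
  rewrite -integral_mkcondr setIidr// integral_cst//=.
  rewrite lebesgue_measure_itv /= lte_fin; case: ifPn => [_|].
    by rewrite -EFinD -EFinM.
  rewrite -leNgt => ba; have -> : a = b by apply/eqP; rewrite eq_le ab ba.
  by rewrite mule0 subrr mulr0.
apply: integral_mono => x Dx; rewrite /patch; case: ifPn => [|_]; last exact: f0.
by rewrite inE /= in_itv /=; exact: fc.
Qed.

Lemma torus_integral_ge_box n (f : 'rV[R]_n -> \bar R) (a : 'rV[R]_n) (h c : R) :
  (0 <= h)%R -> (0 <= c)%R -> (forall i, (0 <= a 0%R i)%R /\ (a 0%R i + h <= L)%R) ->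
  (forall x, 0 <= f x) ->
  (forall x : 'rV[R]_n, (forall i, (a 0%R i <= x 0%R i <= a 0%R i + h)%R) -> c%:E <= f x) ->
  (c * h ^+ n)%:E <= torus_integral L f.
Proof.
move=> h0; elim: n f a c => [|n IH] f a c c0 aL f0 fc.
  by rewrite expr0 mulr1; apply: fc => -[].
pose a0 := a 0%R ord0; pose a' : 'rV[R]_n := \row_i a 0%R (lift ord0 i).
have [a00 a0L] := aL ord0.
rewrite exprSr mulrA -[X in (_ * X)%R](addrK a0) (addrC h).
apply: integral_ge_sub.
- exact: measurable_itv.
- move=> x /=; rewrite !in_itv /= => /andP[x1 x2].
  by rewrite (le_trans a00 x1) (le_trans x2 a0L).
- by rewrite lerDl.
- by rewrite mulr_ge0// exprn_ge0.
- by move=> x _; exact: torus_integral_ge0.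
move=> x xa; apply: (IH _ a') => // [i|y ya]; first by rewrite mxE; exact: aL.
apply: fc => i; rewrite mxE; case: splitP => j ij.
  by rewrite mxE (_ : i = ord0)//; apply: val_inj; rewrite /= ij; case: j {ij} => -[].
rewrite (_ : i = lift ord0 j); first by have := ya j; rewrite mxE.
by apply: val_inj; rewrite /= ij.
Qed.

End boxes.

(** The weight of r^a with respect to the scale-invariant measure dr / r. *)
Definition rweight {R : realType} (a : R) : R -> R := fun r => if 0 < r then r `^ a / r else 0.

Lemma rweight_ge0 {R : realType} (a r : R) : 0 <= rweight a r.
Proof.
by rewrite /rweight; case: ifPn => // r0; rewrite divr_ge0 ?powR_ge0// ltW.
Qed.

Section positive.
Context {R : realType} {d : nat} {L : R}.
Hypothesis L0 : 0 < L.
Local Notation TF := (testfun d L).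
Implicit Types (x y z : 'rV[R]_d) (s r : R).

Section pair.
Variables (f g : TF -> R^o).
Hypotheses (lf : linear f) (lg : linear g) (gf : distr_le g f).

(** f - g is a nonnegative functional, so it inherits pointwise inequalities between
    test functions. *)
Lemma distr_le_scale (phi psi : TF) (c : R) : (forall z, phi z <= c * psi z) ->
  f phi - g phi <= c * (f psi - g psi).
Proof.
move=> H; have lin (h : TF -> R^o) : linear h -> h (-1 *: phi + c *: psi) = - h phi + c * h psi.
  move=> lh; have h0 : h 0 = 0 by have := lh (-1) 0 0; rewrite scaler0 addr0 scaleN1r addNr.
  rewrite lh -[c *: psi]addr0 (lh c) h0 addr0.
  by rewrite -[-1 *: h phi]/(-1 * h phi) mulN1r.
have H0 : forall z, 0 <= (-1 *: phi + c *: psi : TF) z.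
  move=> z; rewrite -[testfun_val _ z]/(-1 * phi z + c * psi z) mulN1r addrC subr_ge0.
  exact: H.
have := gf H0; rewrite (lin f lf) (lin g lg); lra.
Qed.

Lemma heat_sub_ge0 s x : 0 < s -> 0 <= heat f s x - heat g s x.
Proof.
move=> s0; rewrite subr_ge0 !heatE; apply: gf => z; exact: hk_ge0.
Qed.

Definition harnack_cst : R := (2 * expR 1) ^+ d.

Lemma heat_sub_move s r x y : 0 < s -> 2 * s <= r <= 4 * s ->
  (forall i, (y 0 i - x 0 i) ^+ 2 <= s) ->
  heat f s x - heat g s x <= harnack_cst * (heat f r y - heat g r y).
Proof. by move=> s0 sr xy; apply: distr_le_scale => z; exact: hk_move. Qed.

Lemma heat_sub_quarter s x : 4^-1 <= s <= 1 ->
  heat f s x - heat g s x <= quarter_bound L ^+ d * (heat f 4^-1 x - heat g 4^-1 x).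
Proof. by move=> s4; apply: distr_le_scale => z; exact: hk_quarter. Qed.

Definition box_ratio : R := Num.min 1 (L / 2).

Definition embed_cst (p : nat) : R := box_ratio ^+ d / (2 * harnack_cst ^+ p).

(** By the Harnack inequality, the value of the difference at (s, x) is dominated by
    its values on a space-time box of sides sqrt s in space and s in time. *)
Lemma heat_sub_le_st_int (p : nat) (a : R) s x : 0 <= a -> 0 < s <= 4^-1 -> in_cell L x ->
  ((embed_cst p * (s `^ a * Num.sqrt s ^+ d * (heat f s x - heat g s x) ^+ p))%:E <=
   st_int L (mixed (rweight a) p 0 f g))%E.
Proof.
move=> a0 /andP[s0 s4] xc; set U := heat f s x - heat g s x.
have U0 : 0 <= U by exact: heat_sub_ge0.
have C0 : 0 < harnack_cst by rewrite exprn_gt0// mulr_gt0// expR_gt0.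
have c0 : 0 < box_ratio by rewrite lt_min ltr01 divr_gt0.
pose h := box_ratio * Num.sqrt s.
have h0 : 0 <= h by rewrite mulr_ge0 ?sqrtr_ge0// ltW.
have s1 : s <= 1 by apply: le_trans s4 _; rewrite invf_le1// ler1n.
have sq1 : Num.sqrt s <= 1 by rewrite -sqrtr1 ler_wsqrtr.
have hs : h ^+ 2 <= s.
  rewrite exprMn sqr_sqrtr ?(ltW s0)// -[leRHS]mul1r ler_wpM2r ?(ltW s0)//.
  by rewrite exprn_ile1 ?(ltW c0)// ge_min lexx.
have hL : h <= L / 2.
  rewrite -[leRHS]mulr1 ler_pM ?(ltW c0) ?sqrtr_ge0//.
  by rewrite ge_min lexx orbT.
(* The lower corner of a box of side h that has x as a point and lies in the cell. *)
pose b : 'rV[R]_d := \row_i (if x 0 i <= L / 2 then x 0 i else x 0 i - h).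
have bL i : 0 <= b 0 i /\ b 0 i + h <= L.
  have /andP[x1 x2] := xc i; rewrite mxE.
  by move: h0 hL; move: (h) => k k0 kL; have [xL|xL] := leP (x 0 i) (L / 2); split; lra.
pose c := s `^ a / (4 * s) * (U / harnack_cst) ^+ p.
have cc0 : 0 <= c.
  by rewrite mulr_ge0 ?exprn_ge0 ?divr_ge0 ?powR_ge0 ?mulr_ge0 ?(ltW s0) ?(ltW C0).
have -> : embed_cst p * (s `^ a * Num.sqrt s ^+ d * U ^+ p) = c * h ^+ d * (4 * s - 2 * s).
  rewrite /embed_cst /c /h !exprMn exprVn; field.
  by rewrite !gt_eqF ?exprn_gt0.
apply: integral_ge_sub.
- exact: measurable_itv.
- move=> r /=; rewrite !in_itv /= => /andP[r1 r2]; apply/andP; split.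
    by apply: lt_le_trans r1; rewrite mulr_gt0.
  by apply: (le_trans r2); move: s4; rewrite -[4^-1]mul1r ler_pdivlMr// mulrC.
- by rewrite ler_wpM2r ?(ltW s0)// ler_nat.
- by rewrite mulr_ge0// exprn_ge0.
- by move=> r _; apply: torus_integral_ge0 => y _; exact/mixed_ge0/rweight_ge0.
move=> r rs; have r0 : 0 < r by case/andP: rs => + _; apply: lt_le_trans; rewrite mulr_gt0.
have r1 : r <= 1.
  by case/andP: rs => _ /le_trans; apply; move: s4; rewrite -[4^-1]mul1r ler_pdivlMr// mulrC.
apply: (@torus_integral_ge_box _ _ _ _ b) => // [y|y yb]; first exact/mixed_ge0/rweight_ge0.
rewrite lee_fin expr0 mulr1 /sheat r0 r1 /= /rweight r0 ler_pM ?exprn_ge0 ?divr_ge0 ?powR_ge0//.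
- by rewrite mulr_ge0// ltW.
- exact: ltW.
- rewrite ler_pM ?powR_ge0 ?invr_ge0 ?mulr_ge0 ?(ltW s0)//.
    rewrite ge0_ler_powR ?nnegrE ?(ltW s0) ?(ltW r0)//.
    by case/andP: rs => + _; apply: le_trans; rewrite ler_peMl ?(ltW s0)// ler1n.
  by rewrite lef_pV2 ?posrE ?mulr_gt0//; case/andP: rs.
rewrite lerXn2r ?nnegrE ?divr_ge0 ?(ltW C0)// (ger0_norm (heat_sub_ge0 y r0)).
rewrite ler_pdivrMr// mulrC; apply: heat_sub_move => // i.
have := yb i; rewrite mxE => /andP[y1 y2].
have yx : `|y 0 i - x 0 i| <= h.
  move: h0 y1 y2; rewrite ler_norml; move: (h) => k k0.
  by have [xL|xL] := leP (x 0 i) (L / 2) => y1 y2; apply/andP; split; lra.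
by apply: le_trans hs; rewrite -[leLHS]real_normK ?num_real// lerXn2r ?nnegrE.
Qed.

Lemma heat_periodic (k : TF -> R^o) s x (n : 'rV[int]_d) : 0 < s ->
  heat k s (x + \row_i (L * (n 0 i)%:~R)) = heat k s x.
Proof. by move=> s0; rewrite !heatE hk_periodic. Qed.

Lemma cell_rep x : exists n : 'rV[int]_d, in_cell L (x + \row_i (L * (n 0 i)%:~R)).
Proof.
have H (i : 'I_d) := period_rep L0 (x 0 i).
exists (\row_i projT1 (cid (H i))) => i; rewrite !mxE.
exact: projT2 (cid (H i)).
Qed.

End pair.

Lemma besov_le alpha (f : TF -> R^o) (B : R) :
  (forall s x, 0 < s <= 1 -> s `^ (alpha / 2) * `|heat f s x| <= B) ->
  (besov_norm alpha f <= B%:E)%E.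
Proof.
move=> H; apply: ge_ereal_sup => _ [s s01 <-].
have {}s01 : 0 < s <= 1 by move: s01; rewrite /= in_itv.
have [s0 _] := andP s01; have w0 : 0 < s `^ (alpha / 2) by exact: powR_gt0.
rewrite -lee_pdivlMl// -EFinM; apply: ge_ereal_sup => _ [x _ <-].
by rewrite lee_fin ler_pdivlMl// H.
Qed.

(** The Besov embedding, which trades the integrability exponent p for d / p
    derivatives: here the factor s^(d / 2) is the volume of the box. *)
Lemma besov_pos_embed (p : nat) (alpha' : R) : (0 < p)%N -> 0 <= alpha' ->
  exists2 K : R, 0 < K & forall f g : TF -> R^o, linear f -> linear g -> distr_le g f ->
  ((besov_norm (alpha' + d%:R / p%:R) (f \- g)%R) `^ p%:R <=
    K%:E * st_int L (mixed (rweight (alpha' * p%:R / 2)) p 0 f g))%E.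
Proof.
move=> p0 a0; set a := alpha' * p%:R / 2; set alpha := alpha' + _.
have pR : 0 < p%:R :> R by rewrite ltr0n.
have al0 : 0 <= alpha by apply: addr_ge0 => //; apply: divr_ge0.
have aa : 0 <= a by rewrite divr_ge0// mulr_ge0// ltW.
pose Q := quarter_bound L ^+ d.
have c0 : 0 < embed_cst p.
  rewrite divr_gt0 ?exprn_gt0 ?lt_min ?ltr01 ?divr_gt0//.
  by rewrite mulr_gt0 ?exprn_gt0 ?mulr_gt0 ?expR_gt0.
have Q0 : 0 <= Q.
  rewrite exprn_ge0// mulr_ge0 ?expR_ge0//.
  by apply: le_trans (theta_le_bound L0 0 _); rewrite ?theta_ge0 ?invr_gt0.
pose q := (4^-1 : R) `^ a * Num.sqrt 4^-1 ^+ d.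
have q0 : 0 < q by rewrite mulr_gt0 ?powR_gt0 ?exprn_gt0 ?sqrtr_gt0 ?invr_gt0.
pose K := (1 + Q ^+ p / q) / embed_cst p.
have Qq0 : 0 <= Q ^+ p / q by apply: divr_ge0; [exact: exprn_ge0|exact: ltW].
have K0 : 0 < K by apply: divr_gt0 => //; apply: ltr_wpDr.
exists K => // f g lf lg gf.
set S := st_int _ _; have S0 : (0 <= S)%E by apply: st_int_ge0 => s x; exact/mixed_ge0/rweight_ge0.
case SE : S S0 => [t| |] // t0; last by rewrite gt0_muley ?lte_fin// leey.
rewrite lee_fin in t0.
have small s x : 0 < s <= 4^-1 ->
    embed_cst p * (s `^ a * Num.sqrt s ^+ d * (heat f s x - heat g s x) ^+ p) <= t.
  move=> s4; have [n xc] := cell_rep x; have [s0 _] := andP s4.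
  rewrite -(heat_periodic f x n s0) -(heat_periodic g x n s0) -lee_fin -SE.
  exact: heat_sub_le_st_int.
have Kt0 : 0 <= K * t by rewrite mulr_ge0// ltW.
suff H : (besov_norm alpha (f \- g)%R <= ((K * t) `^ p%:R^-1)%:E)%E.
  have -> : (K%:E * t%:E = (((K * t) `^ p%:R^-1)%:E) `^ p%:R)%E.
    by rewrite poweR_EFin -powRrM mulVf ?gt_eqF// powRr1.
  apply: gt0_ler_poweR; rewrite ?in_itv /= ?leey ?andbT ?(ltW pR)//.
    have H1 : 0 < (1 : R) <= 1 by apply/andP; split; [exact: ltr01|exact: lexx].
    apply: le_trans (heat_le_besov alpha (f \- g)%R 0 H1).
    by rewrite lee_fin mulr_ge0// powR_ge0.
  by rewrite lee_fin powR_ge0.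
apply: besov_le => s x s01; have [s0 s1] := andP s01.
have U0 : 0 <= heat f s x - heat g s x by exact: heat_sub_ge0.
rewrite -[`|_|]/(`|heat f s x - heat g s x|) ger0_norm//.
set U := heat f s x - _ in U0 *.
have l0 : 0 <= s `^ (alpha / 2) * U by rewrite mulr_ge0 ?powR_ge0.
have -> : s `^ (alpha / 2) * U = ((s `^ (alpha / 2) * U) `^ p%:R) `^ p%:R^-1.
  by rewrite -powRrM mulfV ?gt_eqF// powRr1.
rewrite ge0_ler_powR ?nnegrE ?powR_ge0 ?invr_ge0//.
rewrite powR_mulrn// exprMn /K mulrAC ler_pdivlMr// mulrC.
have [s4|s4] := leP s 4^-1.
  have -> : (s `^ (alpha / 2)) ^+ p = s `^ a * Num.sqrt s ^+ d.
    have -> : Num.sqrt s ^+ d = s `^ (2^-1 * d%:R).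
      by rewrite powRrM powR12_sqrt ?powR_mulrn ?sqrtr_ge0// ltW.
    rewrite -powR_mulrn ?powR_ge0// -powRrM -powRD; last by rewrite (gt_eqF s0) implybT.
    by congr (_ `^ _); rewrite /alpha /a; field; rewrite gt_eqF.
  apply: (@le_trans _ _ t); first by apply: small; rewrite s0.
  by rewrite ler_peMl// lerDl.
have s4' : 4^-1 <= s <= 1 by rewrite s1 ltW.
have H4 := @small 4^-1 x; rewrite invr_gt0 ltr0n lexx /= in H4; have {}H4 := H4 isT.
apply: (@le_trans _ _ (Q ^+ p / q * t)); last by rewrite ler_wpM2r// lerDr.
have U4 := heat_sub_quarter lf lg gf x s4'; rewrite -/U -/Q in U4.
have V0 : 0 <= heat f 4^-1 x - heat g 4^-1 x by apply: heat_sub_ge0; rewrite ?invr_gt0.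
set V := heat f 4^-1 x - _ in U4 V0 H4.
apply: (@le_trans _ _ (embed_cst p * (Q * V) ^+ p)).
  rewrite ler_wpM2l ?(ltW c0)// -[leRHS]mul1r ler_pM ?exprn_ge0 ?powR_ge0//.
    have := ger_powR s01 (divr_ge0 al0 (ler0n R 2)); rewrite powRr0.
    by apply: exprn_ile1; rewrite powR_ge0.
  by rewrite lerXn2r ?nnegrE ?mulr_ge0.
rewrite exprMn mulrCA -[leRHS]mulrA; apply: ler_wpM2l; first exact: exprn_ge0.
rewrite ler_pdivlMl//.
by rewrite mulrCA.
Qed.

End positive.

(** * The coupled estimate *)

Section power_integral.
Context {R : realType}.
Local Notation mR := (measurableTypeR R).
Local Notation leb := (@lebesgue_measure R).

Lemma measurable_rweight (e : R) : measurable_fun setT (rweight e : mR -> mR).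
Proof.
rewrite (_ : rweight e = fun r => \1_(`]0, +oo[%classic) r * (r `^ e * r `^ (-1))).
  apply: measurable_funM; first by apply: measurable_indic; exact: measurable_itv.
  by apply: measurable_funM; exact: measurable_powR.
apply/funext => r; rewrite /rweight indicE.
have -> : (r \in `]0, +oo[%classic) = (0 < r) by apply/idP/idP; rewrite inE /= in_itv /= andbT.
by case: ifPn => r0; rewrite ?mul0r// mul1r powR_inv1// ltW.
Qed.

Lemma integral_rweight_le (e : R) : 0 < e ->
  (\int[leb]_(s in `]0%R, 1%R]) (rweight e s)%:E <= (e^-1)%:E)%E.
Proof.
move=> e0; pose F (n : nat) : set mR := `[n.+2%:R^-1, 1]%classic.
have a0 n : 0 < n.+2%:R^-1 :> R by rewrite invr_gt0.
have a1 n : n.+2%:R^-1 < 1 :> R by rewrite invf_lt1// ltr1n.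
have FE : \bigcup_n F n = `]0, 1]%classic.
  apply/seteqP; split => [x [n _]|x]; rewrite /F /= !in_itv /= => /andP[x1 x2].
    by rewrite x2 andbT; exact: lt_le_trans x1.
  exists (Num.truncn x^-1) => //=; rewrite in_itv /= x2 andbT invf_ple ?posrE//.
  by apply: le_trans (ltW (truncnS_gt _)) _; rewrite ler_nat.
have Fn n : (\int[leb]_(s in F n) (rweight e s)%:E <= (e^-1)%:E)%E.
  have pos (x : R) : x \in `]n.+2%:R^-1, 1[ -> x \in `]0, +oo[.
    by rewrite !in_itv /= andbT => /andP[+ _]; exact: lt_trans.
  have cP (r x : R) : 0 < x -> {for x, continuous (fun y : R => y `^ r)}.
    move=> x0; apply: differentiable_continuous; apply/derivable1_diffP.
    by apply: derivable_powR; rewrite in_itv /= andbT.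
  have -> : (\int[leb]_(s in F n) (rweight e s)%:E =
      \int[leb]_(s in `[(n.+2%:R^-1)%R, 1%R]) (s `^ (e - 1))%:E)%E.
    apply: eq_integral => x; rewrite inE /F /= in_itv /= => /andP[x1 _].
    have x0 := lt_le_trans (a0 n) x1.
    have -> : x `^ (e - 1) = x `^ e / x.
      by rewrite powRB ?powRr1 ?(ltW x0)// (gt_eqF x0) implybT.
    by rewrite /rweight x0.
  rewrite (@continuous_FTC2 _ _ (fun s => e^-1 * s `^ e))//.
  - rewrite powR1 mulr1 -EFinB lee_fin lerBlDr lerDl mulr_ge0 ?powR_ge0//.
    by rewrite invr_ge0 ltW.
  - apply: continuous_in_subspaceT => x; rewrite inE /= in_itv /= => /andP[x1 _].
    by apply: cP; exact: lt_le_trans x1.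
  - split => [x /pos x0||].
    + by apply: derivableM => //; exact: derivable_powR.
    + apply: cvg_at_right_filter; apply: cvgM; first exact: cvg_cst.
      exact: cP.
    + apply: cvg_at_left_filter; apply: cvgM; first exact: cvg_cst.
      exact: cP.
  - move=> x /pos x0; rewrite derive1E deriveM//; last exact: derivable_powR.
    rewrite derive_cst scaler0 addr0 -derive1E powR_derive1//.
    by rewrite /GRing.scale /= mulrA mulVf ?gt_eqF// mul1r.
rewrite -FE.
have mr n : measurable_fun (F n) (fun s : mR => (rweight e s)%:E).
  by apply/measurable_EFinP; apply: measurable_funTS; exact: measurable_rweight.
have r0 n x : F n x -> (0 <= (rweight e x)%:E)%E by rewrite lee_fin rweight_ge0.
have nF : nondecreasing_seq F.
  move=> m n mn; apply/subsetPset => x; rewrite /F /= !in_itv /= => /andP[x1 ->].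
  by rewrite andbT; apply: le_trans x1; rewrite lef_pV2 ?posrE// ler_nat.
have mF n : measurable (F n) by exact: measurable_itv.
have C := @ge0_nondecreasing_set_cvg_integral _ _ _ F _ leb nF mF mr r0.
rewrite -(cvg_lim _ C)//; apply: lime_le; first by apply/cvg_ex; exists (\int[leb]_(x in \bigcup_i F i) (rweight e x)%:E)%E.
exact: nearW.
Qed.

End power_integral.

Section elementary.
Context {R : realType}.
Implicit Types a b : R.

(** The increasing function that extends the power n.+1 of the half-line. *)
Definition spow n (x : R) := x * `|x| ^+ n.

(** For a and b of one sign, (a - b)^(n + 1) is at most the difference of the powers by
    superadditivity; the constant is needed when they have opposite signs. *)
Lemma subX_le_spow n a b : b <= a ->
  (a - b) ^+ n.+1 <= 2 ^+ n.+1 * (spow n a - spow n b).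
Proof.
have pospos (x y : R) : 0 <= y -> y <= x -> (x - y) ^+ n.+1 <= x ^+ n.+1 - y ^+ n.+1.
  move=> y0 yx; rewrite lerBrDr; have c0 : 0 <= x - y by rewrite subr_ge0.
  rewrite -[x in leRHS](subrK y); elim: n (x - y) c0 => [c c0|m IH c c0]; first by rewrite !expr1.
  rewrite [leRHS]exprS; apply: le_trans (ler_wpM2l (addr_ge0 c0 y0) (IH _ c0)).
  rewrite mulrDl !mulrDr -!exprS.
  by apply: lerD; rewrite ?lerDl ?lerDr mulr_ge0// exprn_ge0.
have one (x : R) : 0 <= x -> x <= 2 ^+ n.+1 * x.
  by move=> x0; rewrite ler_peMl// exprn_ege1// ler1n.
move=> ba; rewrite /spow; have [b0|b0] := leP 0 b.
  have a0 := le_trans b0 ba; rewrite !ger0_norm// -!exprS.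
  by apply: le_trans (pospos _ _ b0 ba) (one _ _); rewrite subr_ge0 lerXn2r.
have [a0|a0] := leP 0 a.
  rewrite ger0_norm// ltr0_norm// -exprS -mulNr -exprS.
  set c := - b; have c0 : 0 < c by rewrite oppr_gt0.
  have H : (a + c) ^+ n.+1 <= (2 * Num.max a c) ^+ n.+1.
    rewrite lerXn2r ?nnegrE ?addr_ge0 ?mulr_ge0 ?le_max ?a0 ?(ltW c0)//.
    by rewrite mulrC mulr_natr mulr2n lerD// le_max lexx ?orbT.
  apply: le_trans H _; rewrite exprMn ler_wpM2l ?exprn_ge0//.
  by case: (leP a c) => _; rewrite ?lerDl ?lerDr exprn_ge0// ltW.
have na0 : 0 <= - a by rewrite oppr_ge0 ltW.
have ab' : - a <= - b by rewrite lerN2.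
have E (x : R) : x * (- x) ^+ n = - (- x) ^+ n.+1 by rewrite exprS mulNr opprK.
rewrite !ltr0_norm// !E.
have -> : - (- a) ^+ n.+1 - - (- b) ^+ n.+1 = (- b) ^+ n.+1 - (- a) ^+ n.+1.
  by rewrite opprK addrC.
have -> : a - b = - b - - a by rewrite opprK addrC.
by apply: le_trans (pospos _ _ na0 ab') (one _ _); rewrite subr_ge0 lerXn2r// nnegrE (le_trans na0).
Qed.

Lemma spow_lip n a b :
  `|spow n a - spow n b| <= n.+1%:R * (`|a - b| * (`|a| + `|b|) ^+ n).
Proof.
elim: n => [|n IH]; first by rewrite /spow !expr0 !mulr1 mul1r.
have -> : spow n.+1 a - spow n.+1 b =
    (spow n a - spow n b) * `|a| + spow n b * (`|a| - `|b|).
  by rewrite /spow !exprSr; ring.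
set M := `|a| + `|b|; have M0 : 0 <= M by rewrite addr_ge0.
have Mn : 0 <= `|a - b| * M ^+ n by rewrite mulr_ge0// exprn_ge0.
apply: le_trans (ler_normD _ _) _.
have -> : n.+2%:R * (`|a - b| * M ^+ n.+1) =
    n.+1%:R * (`|a - b| * M ^+ n.+1) + `|a - b| * M ^+ n.+1 by rewrite -natr1; ring.
apply: lerD.
  rewrite normrM normr_id exprSr !mulrA; apply: ler_pM => //; last by rewrite lerDl.
  by rewrite -mulrA.
rewrite normrM /spow normrM normrX normr_id -exprS mulrC ler_pM//.
  exact: ler_dist_dist.
by rewrite lerXn2r ?nnegrE// lerDr.
Qed.

End elementary.

Section coupled.
Context {R : realType} {d : nat} {L alpha0 : R}.
Hypotheses (L0 : 0 < L) (alpha0_ge0 : 0 <= alpha0).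
Local Notation C := (Cneg d L alpha0).
Local Notation mR := (measurableTypeR R).
Local Notation leb := (@lebesgue_measure R).
Local Notation TF := (testfun d L).

(** A fixed pair of distributions is a pair of constant random variables. *)
Lemma st_meas_mixed_cst (k l : C) e i j :
  st_meas (fun _ : unit => mixed (rweight e) i j k l).
Proof.
apply: (st_meas_mixed L0 alpha0_ge0 (X := fun=> k) (Y := fun=> l)).
- exact: measurable_cst.
- exact: measurable_cst.
- exact: measurable_rweight.
Qed.

Lemma besov_norm_p2E (k l : C) alpha :
  besov_norm_p alpha 2 ((k : TF -> R^o) \- (l : TF -> R^o))%R =
  ((st_int L (mixed (rweight alpha) 2 0 k l)) `^ 2^-1)%E.
Proof.
rewrite /besov_norm_p; congr (_ `^ _)%E; apply: eq_integral => s.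
rewrite inE /= in_itv /= => s01; have [s0 s1] := andP s01.
rewrite /Lp_norm -poweRrM mulVf ?pnatr_eq0// poweRe1; last first.
  by apply: torus_integral_ge0 => x _; rewrite lee_fin powR_ge0.
have w0 : 0 <= s `^ (alpha * 2 / 2) / s by rewrite divr_ge0 ?powR_ge0// ltW.
pose q (_ : unit) (x : 'rV[R]_d) : \bar R := ((`|sheat k s x - sheat l s x|) ^+ 2)%:E.
have Jq : jmeas q.
  apply: jmeas_continuous => [x|_ x]; first exact: measurable_cst.
  have FF : Filter (nbhs x) by exact: nbhs_filter.
  have ck := @continuous_sheat _ _ _ _ L0 alpha0_ge0 k s x.
  have cl := @continuous_sheat _ _ _ _ L0 alpha0_ge0 l s x.
  have cn : `|sheat k s y - sheat l s y| @[y --> x] --> `|sheat k s x - sheat l s x|.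
    by apply: cvg_norm; exact: (cvgB ck cl).
  exact: (cvg_comp _ (fun t => t ^+ 2) cn (@exprn_continuous R 2 _)).
transitivity ((s `^ (alpha * 2 / 2) / s)%:E * torus_integral L (q tt))%E.
  congr (_ * _)%E; apply: eq_torus_integral => x _.
  by rewrite /q /sheat s01 powR_mulrn.
have q0 z x : (0 <= q z x)%E by rewrite lee_fin exprn_ge0.
rewrite -(ge0_torus_integralZl L tt Jq q0 w0).
apply: eq_torus_integral => x _; rewrite /q /mixed -EFinM expr0 mulr1.
by rewrite /rweight s0 mulfK// pnatr_eq0.
Qed.

Lemma metric_p2E (k l : C) alpha :
  ((metric_p alpha 2 k l) `^ 2 = mine (st_int L (mixed (rweight alpha) 2 0 k l)) 1)%E.
Proof.
rewrite /metric_p besov_norm_p2E; set S := st_int _ _.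
have S0 : (0 <= S)%E by apply: st_int_ge0 => s x; exact/mixed_ge0/rweight_ge0.
have [S1|S1] := leP S 1%E.
  have -> : mine (S `^ 2^-1)%E 1%E = (S `^ 2^-1)%E.
    apply/min_idPl; rewrite -[leRHS](poweR1r 2^-1).
    by apply: gt0_ler_poweR; rewrite ?in_itv /= ?leey ?andbT ?invr_ge0.
  by rewrite -poweRrM mulVf ?pnatr_eq0// poweRe1// (min_idPl S1).
have -> : mine (S `^ 2^-1)%E 1%E = 1%E.
  apply/min_idPr; rewrite -[leLHS](poweR1r 2^-1).
  by apply: gt0_ler_poweR; rewrite ?in_itv /= ?leey ?andbT ?invr_ge0// ltW.
by rewrite poweR1r.
Qed.

Lemma st_int_rweight_le (k l : C) (e : R) : 0 < e ->
  (st_int L (mixed (rweight e) 0 0 k l) <= (L ^+ d / e)%:E)%E.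
Proof.
move=> e0; have Ld : 0 <= L ^+ d by rewrite exprn_ge0// ltW.
rewrite EFinM; apply: le_trans (lee_wpmul2l (_ : (0 <= (L ^+ d)%:E)%E) (integral_rweight_le e0)); last first.
  by rewrite lee_fin.
rewrite -ge0_integralZl_EFin//.
- apply: integral_mono => s _; rewrite -EFinM [leRHS](_ : _ = (rweight e s * L ^+ d)%:E); last by rewrite mulrC.
  by rewrite -torus_integral_cst ?(ltW L0)//; apply: torus_integral_mono => x _; rewrite lee_fin !expr0 !mulr1.
- by move=> s _; rewrite lee_fin rweight_ge0.
- by apply/measurable_EFinP; apply: measurable_funTS; exact: measurable_rweight.
Qed.

Lemma st_int_mixedZ (k l : C) (c e : R) i j : 0 <= c ->
  st_int L (mixed (fun r => c * rweight e r) i j k l) =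
  (c%:E * st_int L (mixed (rweight e) i j k l))%E.
Proof.
move=> c0; rewrite -(st_intZl L tt (st_meas_mixed_cst k l e i j) _ c0); last first.
  by move=> _ s x; exact/mixed_ge0/rweight_ge0.
congr (st_int L _); apply/funext => s; apply/funext => x.
by rewrite /mixed -EFinM -mulrA.
Qed.

Lemma st_int_mixedD (k l : C) (c1 c2 e1 e2 : R) i1 j1 i2 j2 : 0 <= c1 -> 0 <= c2 ->
  st_int L (fun s x => mixed (fun r => c1 * rweight e1 r)%R i1 j1 k l s x +
                       mixed (fun r => c2 * rweight e2 r)%R i2 j2 k l s x)%E =
  (c1%:E * st_int L (mixed (rweight e1) i1 j1 k l) +
   c2%:E * st_int L (mixed (rweight e2) i2 j2 k l))%E.
Proof.
move=> c10 c20; rewrite -!st_int_mixedZ//.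
have w0 c e : 0 <= c -> forall r : R, 0 <= c * rweight e r.
  by move=> c0 r; rewrite mulr_ge0// rweight_ge0.
have mw c e : measurable_fun setT ((fun r => c * rweight e r) : mR -> mR).
  by apply: measurable_funM; [exact: measurable_cst|exact: measurable_rweight].
have mm c e i j : st_meas (fun _ : unit => mixed (fun r => c * rweight e r) i j k l).
  apply: (st_meas_mixed L0 alpha0_ge0 (X := fun=> k) (Y := fun=> l)).
  - exact: measurable_cst.
  - exact: measurable_cst.
  - exact: mw.
rewrite -(st_intD L tt (mm c1 e1 i1 j1) (mm c2 e2 i2 j2))//.
- by move=> _ s x; apply: mixed_ge0; exact: w0.
- by move=> _ s x; apply: mixed_ge0; exact: w0.
Qed.

Definition norm_pow alpha (n : nat) (k : C) : \bar R := ((besov_norm alpha k) `^ n%:R)%E.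

Lemma norm_pow_fin alpha (n : nat) (k : C) (N : R) : besov_norm alpha k = N%:E -> 0 <= N ->
  norm_pow alpha n k = (N ^+ n)%:E.
Proof. by move=> kN N0; rewrite /norm_pow kN poweR_EFin powR_mulrn. Qed.

Lemma besov_ge0 alpha (k : C) : (0 <= besov_norm alpha k)%E.
Proof.
have H1 : 0 < (1 : R) <= 1 by apply/andP; split; [exact: ltr01|exact: lexx].
apply: le_trans (heat_le_besov alpha k 0 H1).
by rewrite lee_fin mulr_ge0 ?powR_ge0.
Qed.

Lemma heat_le alpha (k : C) (N s : R) x : besov_norm alpha k = N%:E -> 0 < s <= 1 ->
  `|heat k s x| <= s `^ (- (alpha / 2)) * N.
Proof.
move=> kN s01; have [s0 _] := andP s01.
rewrite powRN mulrC ler_pdivlMr ?powR_gt0// mulrC -lee_fin -kN.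
exact: heat_le_besov.
Qed.

(** Young's inequality with threshold h trades moments of the norms against the
    square of the L^2 distance. When this square exceeds 1, the truncated distance
    no longer measures the difference, but it is then equal to 1, which pays for the
    term 1 / h left by Young's inequality for the moments alone. *)
Lemma coupled_bound (n : nat) (alpha' alpha'' : R) : alpha'' < alpha' ->
  exists2 K : R, 0 < K & forall (k l : C) (h : R), 0 < h ->
    (st_int L (mixed (rweight (alpha' * n.+1%:R / 2)) 1 n k l) <=
     (K * h)%:E * (1 + (norm_pow alpha'' (2 * n.+1) k + norm_pow alpha'' (2 * n.+1) l)) +
     (K / h)%:E * mine (st_int L (mixed (rweight alpha'') 2 0 k l)) 1)%E.
Proof.
move=> aa; set p := n.+1.
pose eta := (alpha' - alpha'') * p%:R / 2.
have eta0 : 0 < eta by rewrite divr_gt0// mulr_gt0 ?subr_gt0 ?ltr0n.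
pose A e := L ^+ d / e.
have A0 e : 0 < e -> 0 <= A e by move=> e0; rewrite divr_ge0 ?exprn_ge0// ltW.
pose K := 1 + 4 ^+ p * (A (2 * eta) + A eta).
have eta20 : 0 < 2 * eta by exact: mulr_gt0.
have K1 : 1 <= K.
  rewrite /K lerDl; apply: mulr_ge0; first exact: exprn_ge0.
  by apply: addr_ge0; exact: A0.
have K0 : 0 < K by exact: lt_le_trans ltr01 K1.
exists K => // k l h h0.
set S1 := st_int L (mixed _ 1 n k l); set S2 := st_int _ _.
have S20 : (0 <= S2)%E by apply: st_int_ge0 => s x; exact/mixed_ge0/rweight_ge0.
have m0 : (0 <= mine S2 1)%E by rewrite le_min S20 lee_fin ler01.
have P0 (k' : C) : (0 <= norm_pow alpha'' (2 * p) k')%E by exact: poweR_ge0.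
have Kh : 0 < K * h by rewrite mulr_gt0.
have Kh' : 0 <= K / h by rewrite divr_ge0 ?ltW.
have [Py|Pfin] := eqVneq (norm_pow alpha'' (2 * p) k + norm_pow alpha'' (2 * p) l)%E +oo%E.
  rewrite Py addey// gt0_muley ?lte_fin// addye ?leey//.
  by rewrite gt_eqF// (lt_le_trans ltNy0)// mule_ge0// lee_fin.
have pp : (2 * p)%:R != 0 :> R by rewrite pnatr_eq0 muln_eq0.
have fin (k' : C) : norm_pow alpha'' (2 * p) k' != +oo%E -> exists2 N, 0 <= N & besov_norm alpha'' k' = N%:E.
  have := besov_ge0 alpha'' k'; rewrite /norm_pow; case: (besov_norm _ _) => [N| |] //.
    by rewrite lee_fin => N0 _; exists N.
  by rewrite poweRyr// eqxx.
have [nk nk0 kE] : exists2 N, 0 <= N & besov_norm alpha'' k = N%:E.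
  by apply: fin; apply: contra_neq Pfin => ->; rewrite addye// gt_eqF// (lt_le_trans ltNy0).
have [nl nl0 lE] : exists2 N, 0 <= N & besov_norm alpha'' l = N%:E.
  by apply: fin; apply: contra_neq Pfin => ->; rewrite addey// gt_eqF// (lt_le_trans ltNy0).
rewrite (norm_pow_fin _ kE)// (norm_pow_fin _ lE)//.
pose N := nk + nl; have N0 : 0 <= N by rewrite addr_ge0.
have N2p : N ^+ (2 * p) <= 4 ^+ p * (nk ^+ (2 * p) + nl ^+ (2 * p)).
  have H : N <= 2 * Num.max nk nl.
    by rewrite mulr_natl mulr2n lerD// le_max lexx ?orbT.
  apply: (@le_trans _ _ ((2 * Num.max nk nl) ^+ (2 * p))).
    by rewrite lerXn2r ?nnegrE// mulr_ge0// le_max nk0.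
  rewrite exprMn exprM -[2 ^+ 2]/(2 * 2) -natrM ler_wpM2l ?exprn_ge0//.
  by case: (leP nk nl) => _; rewrite ?lerDl ?lerDr exprn_ge0.
(* The factors (|k_s| + |l_s|)^n are absorbed by s^(n alpha'' / 2); what remains is
   the weight of exponent eta more than what a single factor requires. *)
have pw s x : 0 < s <= 1 ->
  rweight (alpha' * p%:R / 2) s * (`|sheat k s x - sheat l s x| ^+ 1 *
     (`|sheat k s x| + `|sheat l s x|) ^+ n) <=
  N ^+ n * (rweight (alpha'' / 2 + eta) s * `|sheat k s x - sheat l s x|).
  move=> s01; have [s0 s1] := andP s01; rewrite /sheat s01 expr1.
  set D := `|_ - _|; rewrite [leRHS]mulrCA [X in _ <= _ * X]mulrC.
  have -> : rweight (alpha' * p%:R / 2) s =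
     rweight (alpha'' / 2 + eta) s * (s `^ (alpha'' / 2)) ^+ n.
    rewrite /rweight s0 [RHS]mulrAC; congr (_ / s).
    rewrite -powR_mulrn ?powR_ge0// -powRrM -powRD; last by rewrite (gt_eqF s0) implybT.
    by congr (_ `^ _); rewrite /eta /p -natr1; field.
  rewrite -mulrA ler_wpM2l ?rweight_ge0// mulrCA ler_wpM2l ?normr_ge0// -exprMn.
  rewrite lerXn2r ?nnegrE// ?mulr_ge0 ?addr_ge0 ?powR_ge0//.
  rewrite -ler_pdivlMl ?powR_gt0// -powRN mulrDr.
  by apply: lerD; exact: heat_le.
have sD s x : 0 < s <= 1 -> `|sheat k s x - sheat l s x| <= s `^ (- (alpha'' / 2)) * N.
  move=> s01; rewrite /sheat s01 mulrDr; apply: le_trans (ler_normB _ _) _.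
  by apply: lerD; exact: heat_le.
have Np1 : N ^+ (2 * n) <= 1 + N ^+ (2 * p).
  have [N1|N1] := leP N 1.
    by apply: (@le_trans _ _ 1); [rewrite exprn_ile1|rewrite lerDl exprn_ge0].
  by rewrite ler_wpDl// ler_weXn2l ?(ltW N1)// leq_mul2l /= leqnSn.
pose M := 1 + (nk ^+ (2 * p) + nl ^+ (2 * p)).
have M1 : 1 <= M by rewrite lerDl addr_ge0// exprn_ge0.
have NM : 1 + N ^+ (2 * p) <= 4 ^+ p * M.
  by rewrite /M mulrDr mulr1 lerD// exprn_ege1// ler1n.
have AK e : 0 < e -> e = 2 * eta \/ e = eta -> A e * (1 + N ^+ (2 * p)) <= K * M.
  move=> e0 ee; apply: (@le_trans _ _ (A e * (4 ^+ p * M))); first by apply: ler_wpM2l NM; exact: A0.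
  rewrite mulrA ler_wpM2r ?(le_trans ler01 M1)// /K ler_wpDl// mulrC ler_wpM2l ?exprn_ge0//.
  by case: ee => ->; rewrite ?lerDl ?lerDr A0.
have h2 : 0 <= h^-1 / 2 by rewrite divr_ge0// invr_ge0 ltW.
have hN2 : 0 <= h * N ^+ (2 * n) / 2 by rewrite divr_ge0// mulr_ge0 ?exprn_ge0// ltW.
have [S21|S21] := leP S2 1%E.
  apply: (@le_trans _ _ ((h^-1 / 2)%:E * S2 + (h * N ^+ (2 * n) / 2)%:E *
      st_int L (mixed (rweight (2 * eta)) 0 0 k l))%E).
    rewrite -st_int_mixedD//; apply: st_int_mono => s x s01.
    rewrite -EFinD lee_fin; apply: le_trans (pw s x s01) _.
    have [s0 s1] := andP s01; rewrite !expr0 !mulr1 /rweight s0.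
    set D := `|_ - _|; set a := s `^ (alpha'' / 2); set b := s `^ eta.
    have -> : s `^ (alpha'' / 2 + eta) = a * b.
      by rewrite powRD// (gt_eqF s0) implybT.
    have -> : s `^ alpha'' = a ^+ 2.
      by rewrite -powR_mulrn ?powR_ge0// -powRrM; congr (_ `^ _); field.
    have -> : s `^ (2 * eta) = b ^+ 2.
      by rewrite -powR_mulrn ?powR_ge0// -powRrM; congr (_ `^ _); field.
    rewrite mulnC exprM; set q := N ^+ n.
    have Y : 0 <= (a * D - h * (q * b)) ^+ 2 / h / s / 2.
      by rewrite !divr_ge0 ?sqr_ge0// ltW.
    rewrite -subr_ge0; apply: le_trans Y _; rewrite le_eqVlt; apply/orP; left; apply/eqP.
    by field; rewrite !gt_eqF.
  rewrite addeC; apply: leeD; last first.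
    rewrite lee_wpmul2r// lee_fin mulrC ler_wpM2r ?invr_ge0 ?(ltW h0)//.
    by apply: le_trans K1; rewrite invf_le1// ler1n.
  have hE : (0 <= (h * N ^+ (2 * n) / 2)%:E)%E by rewrite lee_fin.
  apply: le_trans (lee_wpmul2l hE (st_int_rweight_le k l eta20)) _.
  rewrite -EFinM -!EFinD -EFinM lee_fin -/(A (2 * eta)) -/M.
  have B : A (2 * eta) * N ^+ (2 * n) <= K * M.
    by apply: le_trans (AK _ eta20 (or_introl erefl)); rewrite ler_wpM2l ?A0.
  have -> : h * N ^+ (2 * n) / 2 * A (2 * eta) = h * (A (2 * eta) * N ^+ (2 * n)) / 2 by ring.
  rewrite [leRHS](_ : _ = h * (K * M)); last by ring.
  rewrite ler_pdivrMr//; apply: (@le_trans _ _ (h * (K * M))); first by rewrite ler_wpM2l ?(ltW h0).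
  by rewrite ler_peMr ?ler1n// mulr_ge0 ?(ltW h0)// mulr_ge0 ?(ltW K0)// (le_trans ler01).
apply: (@le_trans _ _ ((N ^+ p)%:E * st_int L (mixed (rweight eta) 0 0 k l))%E).
  have Np0 : 0 <= N ^+ p by rewrite exprn_ge0.
  rewrite -st_int_mixedZ//; apply: st_int_mono => s x s01.
  rewrite lee_fin; apply: le_trans (pw s x s01) _.
  have [s0 s1] := andP s01; rewrite !expr0 !mulr1 /p exprSr -mulrA ler_wpM2l ?exprn_ge0//.
  apply: (@le_trans _ _ (rweight (alpha'' / 2 + eta) s * (s `^ (- (alpha'' / 2)) * N))).
    by rewrite ler_wpM2l ?rweight_ge0// sD.
  rewrite /rweight s0 le_eqVlt; apply/orP; left; apply/eqP.
  have -> : s `^ (alpha'' / 2 + eta) = s `^ eta / s `^ (- (alpha'' / 2)).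
    by rewrite -powRN opprK -powRD 1?addrC// (gt_eqF s0) implybT.
  by field; rewrite !gt_eqF ?powR_gt0.
have NE : (0 <= (N ^+ p)%:E)%E by rewrite lee_fin exprn_ge0.
apply: le_trans (lee_wpmul2l NE (st_int_rweight_le k l eta0)) _.
rewrite -[leLHS]/((N ^+ p * A eta)%:E) -[leRHS]/((K * h * M + K / h * 1)%:E) lee_fin mulr1.
have B := AK _ eta0 (or_intror erefl).
have AKm : A eta <= K.
  rewrite /K ler_wpDl// -[leLHS]mul1r ler_pM ?A0 ?exprn_ege1 ?ler1n//.
  by rewrite lerDr A0.
have Y : N ^+ p <= h * N ^+ (2 * p) + h^-1.
  rewrite mulnC exprM; set q := N ^+ p; have q0 : 0 <= q by rewrite exprn_ge0.
  have Z : 0 <= (h * q - 1) ^+ 2 / h + q.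
    by apply: addr_ge0 => //; apply: divr_ge0; [exact: sqr_ge0|exact: ltW].
  rewrite -subr_ge0; apply: le_trans Z _; rewrite le_eqVlt; apply/orP; left; apply/eqP.
  by field; rewrite gt_eqF.
apply: (@le_trans _ _ ((h * N ^+ (2 * p) + h^-1) * A eta)); first by rewrite ler_wpM2r ?A0.
rewrite mulrDl; apply: lerD.
  rewrite -mulrA [leRHS](_ : _ = h * (K * M)); last by ring.
  rewrite ler_wpM2l ?(ltW h0)// mulrC; apply: le_trans B; rewrite ler_wpM2l ?A0//.
  by rewrite lerDr.
by rewrite mulrC ler_wpM2r// invr_ge0 ltW.
Qed.

End coupled.

(** * Comparison of two ordered random distributions *)

Section transfer.
Local Open Scope ereal_scope.
Context {R : realType} d1 d2 dY (T1 : measurableType d1) (T2 : measurableType d2)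
  (Y : measurableType dY).
Variables (mu1 : {measure set T1 -> \bar R}) (mu2 : {measure set T2 -> \bar R}).
Variables (X1 : T1 -> Y) (X2 : T2 -> Y).
Hypotheses (mX1 : measurable_fun setT X1) (mX2 : measurable_fun setT X2).
Hypothesis same_law : forall A, measurable A -> mu1 (X1 @^-1` A) = mu2 (X2 @^-1` A).

Lemma ge0_integral_same_law (phi : Y -> \bar R) : measurable_fun setT phi ->
  (forall y, 0 <= phi y) -> \int[mu1]_w phi (X1 w) = \int[mu2]_w phi (X2 w).
Proof.
move=> mphi phi0.
have E1 := ge0_integral_pushforward mX1 mu1 (measurableT) mphi (fun y _ => phi0 y).
have E2 := ge0_integral_pushforward mX2 mu2 (measurableT) mphi (fun y _ => phi0 y).
rewrite !preimage_setT in E1 E2; rewrite -[LHS]E1 -[RHS]E2.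
by apply: eq_measure_integral => A mA _; exact: same_law.
Qed.

Lemma integral_same_law (phi : Y -> \bar R) : measurable_fun setT phi ->
  \int[mu1]_w phi (X1 w) = \int[mu2]_w phi (X2 w).
Proof.
move=> mphi; rewrite integralE [RHS]integralE.
have E (T : Type) (X : T -> Y) : (fun w => phi (X w))^\+ = (fun w => phi^\+ (X w)).
  by apply/funext => w; rewrite !funeposE.
have E' (T : Type) (X : T -> Y) : (fun w => phi (X w))^\- = (fun w => phi^\- (X w)).
  by apply/funext => w; rewrite !funenegE.
rewrite (E _ X1) (E _ X2) (E' _ X1) (E' _ X2).
congr (_ - _).
  exact: (ge0_integral_same_law (measurable_funepos mphi) (funepos_ge0 phi)).
exact: (ge0_integral_same_law (measurable_funeneg mphi) (funeneg_ge0 phi)).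
Qed.

End transfer.

Section ordered_pair.
Context {R : realType} {d : nat} {L alpha0 : R}.
Hypotheses (L0 : 0 < L) (alpha0_ge0 : 0 <= alpha0).
Local Notation C := (Cneg d L alpha0).
Local Notation B := (borel C).
Local Notation mR := (measurableTypeR R).
Local Notation TF := (testfun d L).
Context {dOm : measure_display} {Om : measurableType dOm} (P : probability Om R).
Variables (X Y : Om -> C).
Hypotheses (mX : measurable_fun setT (X : Om -> B)) (mY : measurable_fun setT (Y : Om -> B)).
Hypothesis YX : forall w, distr_le (Y w) (X w).
Variable pi : probability (B * B)%type R.
Hypothesis pi_coupling : coupling (law P X) (law P Y) pi.

Lemma pi_fst (phi : B -> \bar R) : measurable_fun setT phi ->
  (\int[pi]_z phi z.1 = \int[P]_w phi (X w))%E.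
Proof.
move=> mphi; apply: (integral_same_law (X1 := fst) (X2 := (X : Om -> B))) => //.
move=> A mA; have [E _] := pi_coupling mA; rewrite -[RHS]/(law P X A) -E; congr (pi _).
by apply/seteqP; split => [[k l] //|[k l] []].
Qed.

Lemma pi_snd (phi : B -> \bar R) : measurable_fun setT phi ->
  (\int[pi]_z phi z.2 = \int[P]_w phi (Y w))%E.
Proof.
move=> mphi; apply: (integral_same_law (X1 := snd) (X2 := (Y : Om -> B))) => //.
move=> A mA; have [_ E] := pi_coupling mA; rewrite -[RHS]/(law P Y A) -E; congr (pi _).
by apply/seteqP; split => [[k l] //|[k l] []].
Qed.

Variables (alpha : R) (n : nat) (M : R).
Hypothesis XM : (\int[P]_w norm_pow alpha n.+1 (X w) <= M%:E)%E.
Hypothesis YM : (\int[P]_w norm_pow alpha n.+1 (Y w) <= M%:E)%E.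

Lemma measurable_spow : measurable_fun setT (@spow R n).
Proof.
apply: measurable_funM => //; apply: measurable_funX; exact: normr_measurable.
Qed.

Lemma spow_integrable (V : Om -> C) s x : measurable_fun setT (V : Om -> B) ->
  (\int[P]_w norm_pow alpha n.+1 (V w) <= M%:E)%E -> 0 < s <= 1 ->
  P.-integrable setT (fun w => (spow n (heat (V w) s x))%:E).
Proof.
move=> mV VM s01; have [s0 _] := andP s01.
have mh : measurable_fun setT (fun w => spow n (heat (V w) s x)).
  apply: (measurableT_comp measurable_spow).
  exact: (measurableT_comp (measurable_heat x s01) mV).
apply/integrableP; split; first exact/measurable_EFinP.
pose c := (s `^ (- (alpha / 2))) ^+ n.+1.
have c0 : 0 <= c by rewrite exprn_ge0// powR_ge0.
apply: (@le_lt_trans _ _ (c%:E * M%:E)%E); last by rewrite -EFinM ltry.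
apply: le_trans (lee_wpmul2l _ VM); last by rewrite lee_fin.
rewrite -ge0_integralZl_EFin//; last 2 first.
- by move=> w _; exact: poweR_ge0.
- apply: (measurableT_comp (measurable_poweR _)).
  exact: (measurableT_comp (measurable_besov alpha) mV).
apply: integral_mono => w _; rewrite /=.
apply: (@le_trans _ _ (c%:E * norm_pow alpha n.+1 (V w))%E) => //.
have := besov_ge0 alpha (V w); rewrite /norm_pow.
case VE : (besov_norm alpha (V w)) => [N| |] // N0; last first.
  by rewrite poweRyr ?pnatr_eq0// gt0_muley ?leey// lte_fin exprn_gt0// powR_gt0.
rewrite lee_fin in N0; rewrite poweR_EFin powR_mulrn// -EFinM lee_fin -exprMn.
rewrite /spow normrM normrX normr_id -exprS lerXn2r ?nnegrE ?mulr_ge0 ?powR_ge0//.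
exact: heat_le.
Qed.

(** The order makes X_s - Y_s nonnegative, so its power is bounded by a difference of
    odd powers, whose expectation is the same under every coupling. *)
Lemma ordered_pointwise s x (w0 : R -> R) : 0 < s <= 1 -> (forall r, 0 <= w0 r) ->
  (\int[P]_w mixed w0 n.+1 0 (X w) (Y w) s x <=
   \int[pi]_z mixed (fun r => 2 ^+ n.+1 * n.+1%:R * w0 r)%R 1 n (z.1 : C) (z.2 : C) s x)%E.
Proof.
move=> s01 w00; have [s0 _] := andP s01.
have iX := spow_integrable x mX XM s01; have iY := spow_integrable x mY YM s01.
pose phi (k : B) : \bar R := (spow n (heat (k : C) s x))%:E.
have mphi : measurable_fun setT phi.
  by apply/measurable_EFinP; apply: (measurableT_comp measurable_spow); exact: measurable_heat.
have i1 : pi.-integrable setT (fun z => phi z.1).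
  apply/integrableP; split; first exact: measurableT_comp.
  rewrite (@pi_fst (fun k => `|phi k|%E)); last exact: measurableT_comp.
  by have /integrableP[] := iX.
have i2 : pi.-integrable setT (fun z => phi z.2).
  apply/integrableP; split; first exact: measurableT_comp.
  rewrite (@pi_snd (fun k => `|phi k|%E)); last exact: measurableT_comp.
  by have /integrableP[] := iY.
pose c := 2 ^+ n.+1 * w0 s; have c0 : 0 <= c by rewrite mulr_ge0// exprn_ge0.
apply: (@le_trans _ _ (\int[P]_w (c%:E * (phi (X w) - phi (Y w))))%E).
  apply: integral_mono => w _; rewrite /mixed expr0 mulr1 /sheat s01 /phi -EFinB -EFinM lee_fin.
  rewrite /c [2 ^+ _ * _]mulrC -mulrA ler_wpM2l// ger0_norm ?heat_sub_ge0//.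
  by apply: subX_le_spow; rewrite -subr_ge0; exact: heat_sub_ge0.
rewrite integralZl//; last exact: integrableB.
rewrite integralB//.
rewrite -(pi_fst mphi) -(pi_snd mphi) -integralB// -integralZl//; last exact: integrableB.
apply: integral_mono => -[k l] _; rewrite /mixed expr1 /sheat s01 /phi /= -EFinB -EFinM lee_fin.
rewrite /c -!mulrA ler_wpM2l ?exprn_ge0// mulrCA ler_wpM2l//.
exact: le_trans (ler_norm _) (spow_lip _ _ _).
Qed.

Lemma ordered_st_int e :
  (\int[P]_w st_int L (mixed (rweight e) n.+1 0 (X w) (Y w)) <=
   (2 ^+ n.+1 * n.+1%:R)%:E *
     \int[pi]_z st_int L (mixed (rweight e) 1 n (z.1 : C) (z.2 : C)))%E.
Proof.
set c := 2 ^+ n.+1 * n.+1%:R; have c0 : 0 <= c by rewrite mulr_ge0// exprn_ge0.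
have mf : measurable_fun setT ((fun z : (B * B)%type => z.1 : C) : _ -> B) by exact: measurable_fst.
have ms : measurable_fun setT ((fun z : (B * B)%type => z.2 : C) : _ -> B) by exact: measurable_snd.
have mw a : measurable_fun setT ((fun r => a * rweight e r) : mR -> mR).
  by apply: measurable_funM; [exact: measurable_cst|exact: measurable_rweight].
have m1 := st_meas_mixed L0 alpha0_ge0 (w := rweight e) n.+1 0 mX mY (measurable_rweight e).
have m2 := st_meas_mixed L0 alpha0_ge0 (w := fun r => c * rweight e r) 1 n mf ms (mw c).
have m3 := st_meas_mixed L0 alpha0_ge0 (w := rweight e) 1 n mf ms (measurable_rweight e).
rewrite (tonelli_st_int L P m1); last by move=> w s x; exact/mixed_ge0/rweight_ge0.
apply: (@le_trans _ _ (st_int L (fun s x =>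
    \int[pi]_z mixed (fun r => c * rweight e r)%R 1 n (z.1 : C) (z.2 : C) s x)%E)).
  by apply: st_int_mono => s x s01; apply: ordered_pointwise => // r; exact: rweight_ge0.
rewrite -(tonelli_st_int L pi m2); last first.
  by move=> w s x; apply: mixed_ge0 => r; rewrite mulr_ge0 ?rweight_ge0.
under eq_integral do rewrite st_int_mixedZ//.
rewrite ge0_integralZl_EFin//.
- by move=> z _; apply: st_int_ge0 => s x; exact/mixed_ge0/rweight_ge0.
- exact: (measurable_st_int L m3).
Qed.

End ordered_pair.

(** * Reduction to constant initial data *)

Section constants.
Context {R : realType} {d : nat} {L : R}.
Hypothesis L0 : 0 < L.
Local Notation TF := (testfun d L).

Lemma besov_mono alpha (f g : TF -> R^o) :
  (forall s x, 0 < s <= 1 -> `|heat f s x| <= `|heat g s x|) ->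
  (besov_norm alpha f <= besov_norm alpha g)%E.
Proof.
move=> fg; apply: ge_ereal_sup => _ [s s01 <-].
have s01' : 0 < s <= 1 by move: s01; rewrite /= in_itv.
apply: (@le_trans _ _ ((s `^ (alpha / 2))%:E * Loo_norm (heat g s))%E); last first.
  by apply: ereal_sup_ubound; exists s.
rewrite lee_wpmul2l ?lee_fin ?powR_ge0//; apply: ge_ereal_sup => _ [x _ <-].
apply: (@le_trans _ _ (`|heat g s x|%:E)); first by rewrite lee_fin fg.
by apply: ereal_sup_ubound; exists x.
Qed.

Lemma heat_sub_interval (a b f g : TF -> R^o) s x : 0 < s ->
  distr_le a f -> distr_le f b -> distr_le a g -> distr_le g b ->
  `|heat f s x - heat g s x| <= heat b s x - heat a s x.
Proof.
move=> s0 af fb ag gb.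
have H1 := heat_sub_ge0 L0 af x s0; have H2 := heat_sub_ge0 L0 fb x s0.
have H3 := heat_sub_ge0 L0 ag x s0; have H4 := heat_sub_ge0 L0 gb x s0.
by rewrite ler_norml; apply/andP; split; lra.
Qed.

Variable alpha0 : R.
Local Notation C := (Cneg d L alpha0).

Definition const_pos (n : nat) : C := Cneg_embed L0 alpha0 (cst_testfun n%:R).
Definition const_neg (n : nat) : C := Cneg_embed L0 alpha0 (cst_testfun (- n%:R)).

Lemma const_pos_mono m n : (m <= n)%N -> distr_le (const_pos m) (const_pos n).
Proof. by move=> mn; apply: embed_le => // x _ /=; rewrite ler_nat. Qed.

Lemma const_neg_mono m n : (m <= n)%N -> distr_le (const_neg n) (const_neg m).
Proof. by move=> mn; apply: embed_le => // x _ /=; rewrite lerN2 ler_nat. Qed.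

Lemma const_neg_pos n : distr_le (const_neg n) (const_pos n).
Proof. by apply: embed_le => // x _ /=; rewrite -subr_ge0 opprK addr_ge0. Qed.

(** An element of the space need not lie between two constants, but smooth
    functions do, they are dense, and the map is continuous. *)
Lemma sup_over_constants (alpha : R) (U : C -> C) (v : C -> Cneg d L alpha) (S : \bar R) :
  (forall f g : C, distr_le f g -> distr_le (U f) (U g)) ->
  (forall f : C, (v f : TF -> R^o) = U f) -> continuous v ->
  (forall n, (besov_norm alpha (U (const_pos n) \- U (const_neg n))%R <= S)%E) ->
  forall f1 f2 : C, (besov_norm alpha (U f2 \- U f1)%R <= S)%E.
Proof.
move=> Umono vU cv US.
have smooth (phi1 phi2 : TF) : (besov_norm alpha
    (U (Cneg_embed L0 alpha0 phi2) \- U (Cneg_embed L0 alpha0 phi1))%R <= S)%E.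
  have [n1 H1] := embed_between L0 phi1; have [n2 H2] := embed_between L0 phi2.
  pose n := maxn n1 n2; have [a1 b1] := H1 n (leq_maxl _ _).
  have [a2 b2] := H2 n (leq_maxr _ _).
  apply: le_trans (US n); apply: besov_mono => s x /andP[s0 _].
  apply: le_trans (ler_norm _); rewrite -[X in `|X|]/(heat _ s x - heat _ s x).
  by apply: heat_sub_interval => //; exact: Umono.
have approx (f : C) (e : R) : 0 < e -> exists phi,
    (besov_norm alpha (U f \- U (Cneg_embed L0 alpha0 phi))%R < e%:E)%E.
  move=> e0; have nv : nbhs (v f) (ball (v f) e) by exact: nbhsx_ballx.
  have /nbhs_ballP[r r0 rf] := cv f _ nv.
  have [_ fd] : in_Cneg alpha0 f by case: f {nv rf}.
  have [phi fphi] := fd r r0; exists phi.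
  have H : Cneg_ball (v f) e (v (Cneg_embed L0 alpha0 phi)) := rf (Cneg_embed L0 alpha0 phi) fphi.
  by move: H; rewrite /Cneg_ball !vU.
move=> f1 f2; apply/lee_addgt0Pr => e e0; have e2 : 0 < e / 2 by rewrite divr_gt0.
have [phi1 H1] := approx f1 _ e2; have [phi2 H2] := approx f2 _ e2.
apply: le_trans (besov_triangle alpha _ _ (U (Cneg_embed L0 alpha0 phi2))) _.
rewrite addeC; apply: (@le_trans _ _ ((S + (e / 2)%:E) + (e / 2)%:E)%E); last first.
  by rewrite -addeA -EFinD -splitr.
apply: leeD; last exact: ltW.
apply: le_trans (besov_triangle alpha _ _ (U (Cneg_embed L0 alpha0 phi1))) _.
by apply: leeD; [exact: smooth|rewrite besovN; exact: ltW].
Qed.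

End constants.

(** * Exponential loss of memory *)

Section semiflow_bounds.
Context {R : realType} {d : nat} {L alpha0 : R}.
Hypotheses (L0 : 0 < L) (alpha0_ge0 : 0 <= alpha0).
Local Notation C := (Cneg d L alpha0).
Local Notation B := (borel C).
Local Notation mR := (measurableTypeR R).
Local Notation TF := (testfun d L).
Context {dOm : measure_display} {Om : measurableType dOm} (P : probability Om R).
Variables (F : R -> R -> set (set Om)) (delta lambda : R) (u : R -> R -> C -> Om -> C).
Hypotheses (wn : white_noise_semiflow P F u) (op : order_preserving u)
  (cd : coming_down P u delta) (em : exponential_mixing P u delta lambda).
Implicit Types (alpha : R) (f : C) (w : Om).

Lemma measurable_flow t f : 0 <= t -> measurable_fun setT (u t 0 f : Om -> B).
Proof.
move=> t0 _ A mA; rewrite setTI.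
have H : 0 <= (0 : R) <= t by rewrite lexx.
have [_ Fm] := wn_sub_sigma wn H; apply: Fm.
exact: (wn_measurable wn f H mA).
Qed.

(** Restarting the flow one unit of time before t (or at 0 when t < 1) makes the
    bound at time t independent of the initial datum. The exponent of the
    singularity may depend on the restarting time, but the elapsed time 1 makes it
    disappear for t >= 1; for t < 1 only the exponent at 0 is used. *)
Lemma flow_moments alpha (q : nat) (t0 : R) : 0 < t0 -> (0 < q)%N ->
  alpha0 - delta < alpha <= alpha0 ->
  exists M : R, forall t f, t0 <= t -> (\int[P]_w norm_pow alpha q (u t 0 f w) <= M%:E)%E.
Proof.
move=> t0p q0 ha; have [K [K0 Km Kb]] := cd.
have [g0 g00 Hg0] := Kb 0 (lexx 0).
pose c := 1 + t0 `^ (- g0); have c0 : 0 <= c by rewrite addr_ge0// powR_ge0.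
have q1 : 1 <= q%:R :> R by rewrite ler1n.
have Sfin := Km q%:R q1; set S := ereal_sup _ in Sfin.
have SS s : 0 <= s -> (\int[P]_w ((K s w) `^ q%:R)%:E <= S)%E.
  move=> s0; apply: ereal_sup_ubound; exists s; first by rewrite /= in_itv /= s0.
  by rewrite unlock.
have S0 : (0 <= S)%E.
  by apply: le_trans (SS 0 (lexx 0)); apply: integral_ge0 => w _; rewrite lee_fin powR_ge0.
have Sf : S = (fine S)%:E by rewrite fineK// ge0_fin_numE.
exists (c ^+ q * fine S) => t f tt0.
have [s s0 H] : exists2 s, 0 <= s & forall w, (besov_norm alpha (u t 0%R f w) <= (c * K s w)%:E)%E.
  have tp := lt_le_trans t0p tt0.
  have [t1|t1] := leP 1 t.
    have s0 : 0 <= t - 1 by rewrite subr_ge0.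
    exists (t - 1) => // w; have [g gp Hg] := Kb _ s0.
    have st : 0 <= t - 1 <= t by rewrite s0 lerBlDr lerDl ler01.
    rewrite (wn_flow wn f w st).
    have h1 : (1 `^ g)%:E = 1%E :> \bar R by rewrite powR1.
    apply: (@le_trans _ _ (K (t - 1) w)%:E); last first.
      by rewrite lee_fin ler_peMl ?K0// lerDl powR_ge0.
    apply: le_trans (Hg alpha w ha).
    apply: le_trans (ereal_sup_ubound _); last by exists (u (t - 1) 0 f w) => //; reflexivity.
    apply: ereal_sup_ubound; exists t; first by rewrite /= in_itv /= subrK lerBlDr lerDl ler01 lexx.
    by rewrite opprB addrC subrK h1 mul1e.
  exists 0 => // w.
  have g_gt0 : 0 < t0 `^ g0 by exact: powR_gt0.
  apply: (@le_trans _ _ ((t0 `^ (- g0) * K 0 w)%:E)); last first.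
    by rewrite lee_fin ler_wpM2r ?K0// lerDr.
  rewrite powRN EFinM lee_pdivlMl//.
  apply: (@le_trans _ _ ((t `^ g0)%:E * besov_norm alpha (u t 0%R f w))%E).
    apply: lee_wpmul2r; first exact: besov_ge0.
    rewrite lee_fin; apply: ge0_ler_powR; rewrite ?nnegrE //; exact: ltW.
  apply: le_trans (Hg0 alpha w ha).
  apply: le_trans (ereal_sup_ubound _); last by exists f => //; reflexivity.
  apply: ereal_sup_ubound; exists t; last by rewrite subr0.
  by rewrite /= in_itv /= add0r (ltW tp) (ltW t1).
have cq : 0 <= c ^+ q by exact: exprn_ge0.
rewrite EFinM -Sf; apply: le_trans (lee_wpmul2l _ (SS s s0)); last by rewrite lee_fin.
rewrite -ge0_integralZl_EFin//; last 2 first.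
- by move=> w _; rewrite lee_fin powR_ge0.
- apply/measurable_EFinP; exact: (measurableT_comp (measurable_powR q%:R) (@measurable_funPT _ _ _ _ (K s))).
apply: integral_mono => w _; rewrite -EFinM -powR_mulrn// -powRM ?K0// -poweR_EFin.
apply: gt0_ler_poweR; rewrite ?in_itv /= ?leey ?andbT ?besov_ge0 ?lee_fin ?mulr_ge0 ?K0//.
Qed.

(** The infimum over couplings need not be attained; a factor 2 makes room for a
    coupling that depends on t. *)
Lemma good_coupling alpha : alpha0 - delta < alpha <= alpha0 ->
  exists2 M : R, 0 < M & forall t f1 f2, 0 <= t ->
  exists2 pi : probability (B * B)%type R, coupling (law P (u t 0 f1)) (law P (u t 0 f2)) pi &
   (\int[pi]_z mine (st_int L (mixed (rweight alpha) 2 0 (z.1 : C) (z.2 : C))) 1 <=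
     (M * expR (- (lambda * t)) ^+ 2)%:E)%E.
Proof.
move=> ha; have p2 : 1 <= 2 :> R by rewrite ler1n.
have [M0 HM] := em ha p2.
pose M := Num.max 1 M0; have M1 : 0 < M by rewrite lt_max ltr01.
exists (4 * M ^+ 2) => [|t f1 f2 t0]; first by rewrite mulr_gt0// exprn_gt0.
set E := expR _; have E0 : 0 < E by exact: expR_gt0.
have ME : 0 < M * E by rewrite mulr_gt0.
set A := [set \int[pi]_z (metric_p alpha 2 z.1 z.2) `^ 2 | pi in
  coupling (law P (u t 0 f1)) (law P (u t 0 f2))]%E.
have W : ((ereal_inf A) `^ 2^-1 <= (M * E)%:E)%E.
  apply: (@le_trans _ _ (M0 * E)%:E); last by rewrite lee_fin ler_wpM2r ?(ltW E0)// le_max lexx orbT.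
  by apply: le_trans (HM t t0); apply: ereal_sup_ubound; exists f1 => //; exists f2.
have A0 : (0 <= ereal_inf A)%E.
  apply: le_ereal_inf_tmp => _ [pi _ <-]; apply: integral_ge0 => z _; exact: poweR_ge0.
have lt2 : (ereal_inf A < ((2 * (M * E)) ^+ 2)%:E)%E.
  apply: (@le_lt_trans _ _ ((M * E) ^+ 2)%:E).
    have -> : ereal_inf A = (((ereal_inf A) `^ 2^-1) `^ 2)%E.
      by rewrite -poweRrM mulVf ?pnatr_eq0// poweRe1.
    rewrite -powR_mulrn ?(ltW ME)// -poweR_EFin.
    by apply: gt0_ler_poweR; rewrite ?in_itv /= ?leey ?andbT ?poweR_ge0 ?lee_fin ?(ltW ME).
  by rewrite lte_fin ltrXn2r ?nnegrE ?mulr_ge0 ?(ltW M1) ?(ltW E0)// ltr_pMl// ltr1n.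
have [_ [pi cpi <-] lpi] := ereal_inf_lt lt2.
exists pi => //; have -> : 4 * M ^+ 2 * E ^+ 2 = (2 * (M * E)) ^+ 2 by ring.
apply: le_trans (ltW lpi); rewrite le_eqVlt; apply/orP; left; apply/eqP.
by apply: eq_integral => z _; rewrite -(metric_p2E L0 alpha0_ge0).
Qed.

End semiflow_bounds.

Section decay.
Context {R : realType} {d : nat} {L alpha0 : R}.
Hypotheses (L0 : 0 < L) (alpha0_ge0 : 0 <= alpha0).
Local Notation C := (Cneg d L alpha0).
Local Notation B := (borel C).
Local Notation TF := (testfun d L).
Context {dOm : measure_display} {Om : measurableType dOm} (P : probability Om R).
Variables (F : R -> R -> set (set Om)) (delta lambda : R) (u : R -> R -> C -> Om -> C).
Hypotheses (wn : white_noise_semiflow P F u) (op : order_preserving u)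
  (cd : coming_down P u delta) (em : exponential_mixing P u delta lambda).

Lemma flow_le t (f g : C) w : 0 <= t -> distr_le g f -> distr_le (u t 0 g w) (u t 0 f w).
Proof. by move=> t0; apply: op; rewrite lexx. Qed.

(** The threshold h of coupled_bound is chosen to balance its two terms: the moments
    contribute h, and the squared distance, of order exp (- 2 lambda t), is divided
    by h. *)
Lemma mean_ordered (n : nat) (alpha' alpha'' t0 : R) : 0 < t0 ->
  alpha0 - delta < alpha'' <= alpha0 -> alpha'' < alpha' ->
  exists2 M : R, 0 <= M & forall t (f g : C), t0 <= t -> distr_le g f ->
    (\int[P]_w st_int L (mixed (rweight (alpha' * n.+1%:R / 2)) n.+1 0 (u t 0 f w) (u t 0 g w)) <=
     (M * expR (- (lambda * t)))%:E)%E.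
Proof.
move=> t0p ha aa; have [K K0 HK] := coupled_bound (d := d) L0 alpha0_ge0 n aa.
have [M1 HM1] := flow_moments wn cd t0p (ltn0Sn n) ha.
have p2 : (0 < 2 * n.+1)%N by rewrite muln_gt0.
have [M2 HM2] := flow_moments wn cd t0p p2 ha.
have [M3 M30 HM3] := good_coupling L0 alpha0_ge0 em ha.
have N0 q (k : C) : (0 <= norm_pow alpha'' q k)%E by exact: poweR_ge0.
have M20 : 0 <= M2.
  rewrite -lee_fin; apply: le_trans (HM2 t0 point (lexx _)).
  by apply: integral_ge0 => w _.
pose c : R := 2 ^+ n.+1 * n.+1%:R.
have c0 : 0 <= c by rewrite mulr_ge0// exprn_ge0.
exists (c * (K * (1 + (M2 + M2)) + K * M3)).
  apply: mulr_ge0 => //; apply: addr_ge0; apply: mulr_ge0; try exact: ltW.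
  by rewrite !addr_ge0.
move=> t f g t0t gf; have t_ge0 : 0 <= t by exact: le_trans (ltW t0p) t0t.
have [pi cpi Hpi] := HM3 t f g t_ge0.
have mX := measurable_flow wn f t_ge0; have mY := measurable_flow wn g t_ge0.
have YX w : distr_le (u t 0 g w) (u t 0 f w) by exact: flow_le.
apply: le_trans (ordered_st_int L0 alpha0_ge0 mX mY YX cpi (HM1 t f t0t) (HM1 t g t0t) _) _.
rewrite -/c -(mulrA c) [leRHS]EFinM; apply: lee_wpmul2l; first by rewrite lee_fin.
set h := expR _ in Hpi *; have h0 : 0 < h by exact: expR_gt0.
pose A (k : B) := norm_pow alpha'' (2 * n.+1) (k : C).
have mA : measurable_fun setT A.
  exact: (measurableT_comp (measurable_poweR _) (measurable_besov alpha'')).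
pose D (z : (B * B)%type) := mine (st_int L (mixed (rweight alpha'') 2 0 (z.1 : C) (z.2 : C))) 1%E.
have D0 z : (0 <= D z)%E.
  rewrite /D le_min; apply/andP; split; last by rewrite lee_fin.
  by apply: st_int_ge0 => s x; exact/mixed_ge0/rweight_ge0.
have mf : measurable_fun setT ((fun z : (B * B)%type => z.1 : C) : _ -> B) by exact: measurable_fst.
have ms : measurable_fun setT ((fun z : (B * B)%type => z.2 : C) : _ -> B) by exact: measurable_snd.
have mD : measurable_fun setT D.
  apply: measurable_mine; last exact: measurable_cst.
  exact: (measurable_st_int L (st_meas_mixed L0 alpha0_ge0 2 0 mf ms (measurable_rweight alpha''))).
have mA1 : measurable_fun setT (fun z : (B * B)%type => A z.1) by exact: measurableT_comp.
have mA2 : measurable_fun setT (fun z : (B * B)%type => A z.2) by exact: measurableT_comp.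
pose G (z : (B * B)%type) := (1 + (A z.1 + A z.2))%E.
have G0 z : (0 <= G z)%E by rewrite !adde_ge0//; exact: N0.
have mA12 : measurable_fun setT (fun z : (B * B)%type => A z.1 + A z.2)%E by exact: emeasurable_funD.
have mG : measurable_fun setT G by apply: emeasurable_funD => //; exact: measurable_cst.
have Kh : 0 <= K * h by rewrite mulr_ge0 ?ltW.
have Kh' : 0 <= K / h by rewrite divr_ge0 ?ltW.
apply: (@le_trans _ _ (\int[pi]_z ((K * h)%:E * G z + (K / h)%:E * D z))%E).
  by apply: integral_mono => z _; exact: HK.
rewrite ge0_integralD//; last 4 first.
- by move=> z _; rewrite mule_ge0 ?lee_fin.
- exact: measurable_funeM.
- by move=> z _; rewrite mule_ge0 ?lee_fin.
- exact: measurable_funeM.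
rewrite !ge0_integralZl_EFin//.
have IG : (\int[pi]_z G z <= (1 + (M2 + M2))%:E)%E.
  rewrite ge0_integralD//; last first.
    by move=> z _; rewrite adde_ge0//; exact: N0.
  rewrite ge0_integralD//; try by move=> z _; exact: N0.
  rewrite integral_cst// [X in (1 * X)%E]probability_setT mule1.
  rewrite (pi_fst mX cpi mA) (pi_snd mY cpi mA) !EFinD.
  by rewrite leeD2l// leeD//; exact: HM2.
apply: (@le_trans _ _ ((K * h)%:E * (1 + (M2 + M2))%:E + (K / h)%:E * (M3 * h ^+ 2)%:E)%E).
  by apply: leeD; apply: lee_wpmul2l; rewrite ?lee_fin.
rewrite -!EFinM -EFinD lee_fin le_eqVlt; apply/orP; left; apply/eqP.
by field; rewrite gt_eqF.
Qed.

(** The supremum itself is not known to be measurable, but it lies below an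
    increasing limit along constant data, to which monotone convergence applies. *)
Lemma mean_sup (alpha' : R) (n : nat) : 0 <= alpha' ->
  alpha0 - delta < alpha' + d%:R / n.+1%:R <= alpha0 -> flow_continuity u delta ->
  exists2 K : R, 0 < K & forall t M : R, 0 < t ->
  (forall f g : C, distr_le g f ->
    (\int[P]_w st_int L (mixed (rweight (alpha' * n.+1%:R / 2)) n.+1 0 (u t 0 f w) (u t 0 g w)) <= M%:E)%E) ->
  (\int[P]_w (ereal_sup [set besov_norm (alpha' + d%:R / n.+1%:R) (u t 0 f2 w \- u t 0 f1 w)%R
     | f1 in [set: C] & f2 in [set: C]]) `^ n.+1%:R <= (K * M)%:E)%E.
Proof.
move=> a'0 ha fc; set alpha := alpha' + _ in ha *.
have [K K0 HK] := @besov_pos_embed R d L L0 n.+1 alpha' (ltn0Sn n) a'0.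
exists K => // t M t0 HM; have t_ge0 := ltW t0.
pose w1 : R -> R := rweight (alpha' * n.+1%:R / 2).
have w10 s : 0 <= w1 s by exact: rweight_ge0.
pose S (m : nat) (w : Om) : \bar R := st_int L (mixed w1 n.+1 0
  (u t 0 (const_pos L0 alpha0 m) w) (u t 0 (const_neg L0 alpha0 m) w)).
have S0 m w : (0 <= S m w)%E by apply: st_int_ge0 => s x; exact: mixed_ge0.
have mS m : measurable_fun setT (S m).
  apply: (measurable_st_int L); apply: (st_meas_mixed L0 alpha0_ge0).
  - exact: (measurable_flow wn).
  - exact: (measurable_flow wn).
  - exact: measurable_rweight.
have S_nd w : nondecreasing_seq (S ^~ w).
  move=> m m' mm'; apply: st_int_mono => s x s01; have [s0 _] := andP s01.
  have P1 := flow_le w t_ge0 (const_pos_mono L0 alpha0 mm').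
  have N1 := flow_le w t_ge0 (const_neg_mono L0 alpha0 mm').
  have NP := flow_le w t_ge0 (const_neg_pos L0 alpha0 m).
  have NP' := flow_le w t_ge0 (const_neg_pos L0 alpha0 m').
  rewrite /mixed !expr0 !mulr1 /sheat s01 lee_fin ler_wpM2l// lerXn2r ?nnegrE//.
  apply: le_trans (ler_norm _); apply: heat_sub_interval => //.
    by move=> phi phi0; exact: le_trans (N1 phi phi0) (NP phi phi0).
  by move=> phi phi0; exact: le_trans (NP phi phi0) (P1 phi phi0).
have S_cvg w : S ^~ w @ \oo --> ereal_sup (range (S ^~ w)).
  exact: ereal_nondecreasing_cvgn.
have p0 : n.+1%:R != 0 :> R by rewrite pnatr_eq0.
have pw w : ((ereal_sup [set besov_norm alpha (u t 0 f2 w \- u t 0 f1 w)%R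
     | f1 in [set: C] & f2 in [set: C]]) `^ n.+1%:R <= K%:E * limn (S ^~ w))%E.
  rewrite (cvg_lim _ (S_cvg w))//; set Z := ereal_sup (range (S ^~ w)).
  have Z0 : (0 <= Z)%E by apply: le_trans (S0 0%N w) _; apply: ereal_sup_ubound; exists 0%N.
  have KZ : (0 <= K%:E * Z)%E by rewrite mule_ge0// lee_fin ltW.
  have lin (f : C) : linear (f : TF -> R^o) by case: f => f [[]].
  have tt : 0 <= (0 : R) < t by rewrite lexx.
  have [v vU cv] := fc t 0 alpha w tt ha.
  have H := @sup_over_constants R d L L0 alpha0 alpha (fun f => u t 0 f w) v ((K%:E * Z) `^ n.+1%:R^-1)%E
    (fun f g gf => flow_le w t_ge0 gf) vU cv _.
  set Y := ereal_sup _.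
  have Y0 : (0 <= Y)%E.
    apply: (@le_trans _ _ (besov_norm alpha (u t 0 point w \- u t 0 point w)%R)).
      by rewrite besov0// => phi /=; rewrite subrr.
    by apply: ereal_sup_ubound; exists point => //; exists point.
  have -> : (K%:E * Z = ((K%:E * Z) `^ n.+1%:R^-1) `^ n.+1%:R)%E.
    by rewrite -poweRrM mulVf// poweRe1.
  apply: gt0_ler_poweR; rewrite ?in_itv /= ?leey ?andbT ?poweR_ge0//.
  apply: ge_ereal_sup => _ [f1 _ [f2 _ <-]]; apply: H => m.
  set b := besov_norm _ _.
  have b0 : (0 <= b)%E.
    apply: (@le_trans _ _ (besov_norm alpha (0%R : TF -> R^o))); first by rewrite besov0.
    by apply: besov_mono => s x _; rewrite [X in `|X| <= _](_ : _ = 0)// normr0.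
  have -> : b = ((b `^ n.+1%:R) `^ n.+1%:R^-1)%E by rewrite -poweRrM mulfV// poweRe1.
  apply: gt0_ler_poweR; rewrite ?in_itv /= ?leey ?andbT ?poweR_ge0 ?invr_ge0//.
  apply: le_trans (HK _ _ (lin _) (lin _) (flow_le w t_ge0 (const_neg_pos L0 alpha0 m))) _.
  by apply: lee_wpmul2l; [rewrite lee_fin ltW|apply: ereal_sup_ubound; exists m].
apply: (@le_trans _ _ (\int[P]_w (K%:E * limn (S ^~ w)))%E).
  by apply: integral_mono => w _; exact: pw.
have lim0 w : (0 <= limn (S ^~ w))%E.
  rewrite (cvg_lim _ (S_cvg w))//; apply: le_trans (S0 0%N w) _.
  by apply: ereal_sup_ubound; exists 0%N.
rewrite ge0_integralZl_EFin//; last 2 first.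
- have mlim : measurable_fun setT (fun w => ereal_sup (range (S ^~ w))).
    exact: (@emeasurable_fun_cvg _ _ _ setT S _ mS (fun w _ => S_cvg w)).
  by under eq_fun do rewrite (cvg_lim _ (S_cvg _))//.
- exact: ltW.
rewrite monotone_convergence// EFinM; apply: lee_wpmul2l; first by rewrite lee_fin ltW.
apply: lime_le.
  apply: ereal_nondecreasing_is_cvgn => m m' mm'.
  by apply: integral_mono => w _; exact: S_nd.
by apply: nearW => m; apply: HM; exact: const_neg_pos.
Qed.

End decay.

(* The multiplicative constant is uniform over t in [t0, +oo[ for each t0 > 0:
   at t = 0, where u may be the identity, the supremum over the initial data
   can be infinite. *)
Theorem theorem2p5 (R : realType) (d : nat) (L : R)
  (dOm : measure_display) (Om : measurableType dOm) (P : probability Om R)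
  (F : R -> R -> set (set Om)) (alpha0 delta lambda : R)
  (u : R -> R -> Cneg d L alpha0 -> Om -> Cneg d L alpha0) :
  (0 < d)%N -> 0 < L -> 0 < alpha0 -> 0 < delta <= alpha0 ->
  white_noise_semiflow P F u ->
  flow_continuity u delta ->
  order_preserving u ->
  coming_down P u delta ->
  0 < lambda -> exponential_mixing P u delta lambda ->
  forall alpha : R, alpha0 - delta < alpha <= alpha0 ->
  forall p : nat, d%:R / (alpha - alpha0 + delta) < p%:R ->
  forall t0 : R, 0 < t0 ->
  exists M : R, forall t : R, t0 <= t ->
    ((\int[P]_w (ereal_sup [set besov_norm alpha (u t 0%R f2 w \- u t 0%R f1 w)%R
                             | f1 in [set: Cneg d L alpha0]
                             & f2 in [set: Cneg d L alpha0]]) `^ p%:R) `^ p%:R^-1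
     <= (M * expR (- (lambda / p%:R * t)))%:E)%E.
Proof.
move=> d0 L0 a00 dd wn fc op cd lam0 em alpha ha p dp t0 t0p.
have a0 := ltW a00; have [al ar] := andP ha.
have den0 : 0 < alpha - alpha0 + delta by lra.
have p0 : 0 < p%:R :> R by apply: le_lt_trans dp; rewrite divr_ge0// ltW.
case: p p0 dp => [|n] p0 dp; first by rewrite ltxx in p0.
have {}dp : d%:R / n.+1%:R < alpha - alpha0 + delta.
  by rewrite ltr_pdivrMr// mulrC -ltr_pdivrMr.
have [dl dr] := andP dd; have dn0 : 0 <= d%:R / n.+1%:R :> R by rewrite divr_ge0.
pose alpha' := alpha - d%:R / n.+1%:R; pose alpha'' := (alpha0 - delta + alpha') / 2.
have alphaE : alpha = alpha' + d%:R / n.+1%:R by rewrite subrK.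
have [a'0 a''l a''r] : [/\ 0 <= alpha', alpha0 - delta < alpha'' <= alpha0 & alpha'' < alpha'].
  rewrite /alpha'' /alpha'; move: (_ / _) dn0 dp => q q0 qd.
  by split; [lra|apply/andP; split; lra|lra].
have [M M0 HM] := mean_ordered L0 a0 wn op cd em n t0p a''l a''r.
rewrite alphaE in ha *; have [K K0 HK] := mean_sup L0 a0 wn op a'0 ha fc.
exists ((K * M) `^ n.+1%:R^-1) => t t0t; have tp := lt_le_trans t0p t0t.
have H := HK t _ tp (fun f g => HM t f g t0t).
have KM0 : 0 <= K * M by rewrite mulr_ge0// ltW.
rewrite mulrA in H.
have -> : expR (- (lambda / n.+1%:R * t)) = expR (- (lambda * t)) `^ n.+1%:R^-1.
  by rewrite -expRM; congr expR; rewrite mulNr mulrAC.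
rewrite -powRM ?expR_ge0// -poweR_EFin.
apply: gt0_ler_poweR; rewrite ?in_itv /= ?leey ?andbT ?invr_ge0 ?ler0n ?lee_fin ?mulr_ge0 ?expR_ge0//.
  by apply: integral_ge0 => w _; exact: poweR_ge0.
exact: ltW.
Qed.
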